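(* Let $$P(z)=p_0+\sum_{m\in M}p_mz^m+\sum_{n\in N}q_n\bar z^n,\qquad z\in\mathbb D,$$ where $p_0\in\mathbb R$ with $p_0\ge1$, $M,N\subset\{1,2,3,\dots\}$ are finite sets, and $p_m,q_n\in\mathbb C$ are non-zero for all $m\in M$, $n\in N$, with $$\sum_{m\in M}|p_m|+\sum_{n\in N}|q_n|=1.$$ (i) If $p_0>1$, then the Toeplitz operator $T_P$ is invertible on $A^2$. (ii) If $p_0=1$, then $T_P$ is not invertible if and only if there exist $\lambda\in[0,2\pi]$ and, for all $m\in M$ and $n\in N$, integers $k_m$ and $\ell_n$ such that $$m\lambda+\arg p_m=\pi+2\pi k_m\quad\text{and}\quad -n\lambda+\arg q_n=\pi+2\pi\ell_n .$$
   Context: $\mathbb D$ is the open unit disc, $A^2$ the Bergman space of analytic functions in $L^2(\mathbb D,dA)$ with $dA$ normalized area measure, $P_B$ the orthogonal projection $L^2\to A^2$, and for bounded $\varphi$ the Toeplitz operator is $T_\varphi f=P_B(\varphi f)$ on $A^2$. $\arg z$ denotes an argument of the complex number $z$. *)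

(* Defs.v *)
(* MathComp-Analysis (measure/integration, derivatives, trigo)
   + mathcomp-real-closed complex numbers R[i]. *)
From mathcomp Require Import all_boot all_order all_algebra.
From mathcomp Require Import all_classical all_reals all_analysis.
From mathcomp Require Import complex.
Import Order.TTheory GRing.Theory Num.Theory numFieldNormedType.Exports.

Set Implicit Arguments.
Unset Strict Implicit.
Unset Printing Implicit Defensive.

Local Open Scope ring_scope.
Local Open Scope classical_set_scope.

(* The plane R^2 ~ C, with Lebesgue (area) measure. *)
Definition R2 (R : realType) := (measurableTypeR R * measurableTypeR R)%type.

Definition area (R : realType) : {measure set (R2 R) -> \bar R} :=
  ((@lebesgue_measure R) \x (@lebesgue_measure R))%E.

(* The unit disc, seen in R^2 *)
Definition disc2 (R : realType) : set (R2 R) := [set x | x.1 ^+ 2 + x.2 ^+ 2 < 1].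

(* identification R^2 -> C *)
Definition toC (R : realType) (x : R2 R) : R[i] := Complex x.1 x.2.

(* squared modulus, real valued *)
Definition normsq (R : realType) (z : R[i]) : R := (complex.Re z) ^+ 2 + (complex.Im z) ^+ 2.

(* z belongs to the open unit disc D *)
Definition in_disc (R : realType) (z : R[i]) : Prop := `|z| < 1.

(* integral over D against the normalized area measure dA = dx dy / pi,
   of a real-valued function of z *)
Definition dA_int (R : realType) (u : R[i] -> R) : R :=
  Rintegral (@area R) (@disc2 R) (fun x => u (toC x)) / pi.

(* u (restricted to D) belongs to L^2(D, dA) *)
Definition inL2D (R : realType) (u : R[i] -> R[i]) : Prop :=
  measurable_fun (@disc2 R) (fun x => complex.Re (u (toC x))) /\
  measurable_fun (@disc2 R) (fun x => complex.Im (u (toC x))) /\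
  (\int[@area R]_(x in @disc2 R) ((normsq (u (toC x))) / pi)%:E < +oo)%E.

(* analytic (= complex differentiable) at every point of D *)
Definition holomorphic_on_disc (R : realType) (f : R[i] -> R[i]) : Prop :=
  forall z : R[i], in_disc z -> derivable (f : R[i]^o -> R[i]^o) z 1.

(* membership in the Bergman space A^2 *)
Definition bergman (R : realType) (f : R[i] -> R[i]) : Prop :=
  holomorphic_on_disc f /\ inL2D f.

(* L^2(D, dA) inner product <u, v> = int_D u conj(v) dA *)
Definition inner (R : realType) (u v : R[i] -> R[i]) : R[i] :=
  Complex (dA_int (fun z => complex.Re (u z * (v z)^*)))
          (dA_int (fun z => complex.Im (u z * (v z)^*))).

(* g = P_B u : g is the orthogonal projection of u in L^2 onto A^2 *)
Definition bergman_proj (R : realType) (u g : R[i] -> R[i]) : Prop :=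
  bergman g /\ forall h, bergman h -> inner (fun z => u z - g z) h = 0.

(* g = T_phi f = P_B (phi f) *)
Definition toeplitz (R : realType) (phi f g : R[i] -> R[i]) : Prop :=
  bergman_proj (fun z => phi z * f z) g.

(* equality as elements of A^2 (i.e. on D) *)
Definition eq_on_disc (R : realType) (f g : R[i] -> R[i]) : Prop :=
  forall z, in_disc z -> f z = g z.

(* the A^2 norm *)
Definition normA2 (R : realType) (f : R[i] -> R[i]) : R :=
  Num.sqrt (dA_int (fun z => normsq (f z))).

(* T_phi is invertible on A^2: bijective on A^2 with bounded inverse *)
Definition toeplitz_invertible (R : realType) (phi : R[i] -> R[i]) : Prop :=
  (forall g, bergman g -> exists f, bergman f /\ toeplitz phi f g) /\
  (forall f1 f2 g, bergman f1 -> bergman f2 ->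
     toeplitz phi f1 g -> toeplitz phi f2 g -> eq_on_disc f1 f2) /\
  (exists c : R, 0 < c /\ forall f g, bergman f -> toeplitz phi f g ->
     normA2 f <= c * normA2 g).

(* t is an argument of z *)
Definition is_arg (R : realType) (z : R[i]) (t : R) : Prop :=
  z = `|z| * Complex (cos t) (sin t).

(* the symbol P(z) = p0 + sum_{m in M} p_m z^m + sum_{n in N} q_n conj(z)^n *)
Definition symbolP (R : realType) (p0 : R) (M N : seq nat) (p q : nat -> R[i])
    (z : R[i]) : R[i] :=
  Complex p0 0 + \sum_(m <- M) p m * z ^+ m + \sum_(n <- N) q n * (z^*) ^+ n.

(* Main.v *)
(* Multiplication by [P] satisfies [Re <P f, f> >= delta ||f||^2] whenever
   [Re P >= delta > 0] on the disc; then [|1 - rho P| <= k < 1] for a small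
   [rho > 0] and [f |-> P_B ((1 - rho P) f + rho g)] is a contraction of the
   complete space [A^2], whose fixed point solves [T_P f = g].  Since the
   coefficients of [P - p0] have total modulus 1, [Re P >= p0 - 1]; for [p0 = 1],
   [Re P] is bounded below by a positive constant unless all terms of [P - 1]
   attain their modulus with the sign -1 at one point of the circle, which is
   the condition on [lam].

   If that happens at [zeta], then [P zeta = 0].  Pairing [T_P f = g] with [g],
   a bounded inverse would give [||g|| <= c ||conj P g||] for every [g] in [A^2],
   which fails for the functions [((1 + z conj zeta) / 2)^n] peaking at [zeta].

   Completeness of [A^2] needs point evaluations to be bounded and locally
   uniform limits to be holomorphic.  As holomorphy only means complex
   differentiability, both are obtained from Goursat's theorem on rectangles:
   it yields a Cauchy estimate which, applied to [f^2] on rectangles with well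
   chosen sides, bounds [|f|^2] by an area integral and, applied to difference
   quotients, shows that they converge uniformly. *)

Require Import Defs.
From mathcomp Require Import all_boot all_order all_algebra.
From mathcomp Require Import all_classical all_reals all_analysis.
From mathcomp Require Import complex.
From mathcomp Require Import measurable_realfun ring lra.
Import Order.TTheory GRing.Theory Num.Theory numFieldNormedType.Exports.
Local Open Scope ring_scope.
Local Open Scope classical_set_scope.

(** * Complete subspaces and contractions *)

(** Functions are not identified when they agree almost everywhere, so [A^2] is a predicate on
    functions with a semi-inner product, and Hilbert space facts are stated through it. Real scalars
    suffice: [A^2] is stable under multiplication by [i], so orthogonality for the real part of the
    inner product is complex orthogonality.

    Cauchy's formula is needed only as an inequality, and winding numbers are avoided. After a
    rotation the value at the centre [w] is some [A >= 0], and the difference quotient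
    [(F - A) / (z - w)] has contour integral zero; on each side of the rectangle the part coming
    from [A] has a definite sign. The quotient is only known to be continuous at [w], so Goursat's
    theorem is proved with finitely many exceptional vertical lines.

    For [p0 = 1], positivity on the circle is carried into the disc by comparing powers of the
    radius, with no maximum principle. For the converse, [P] is Lipschitz, so [|P|^2] is small where
    the peaking functions concentrate; their mass near [zeta] is measured on a small box inside the
    disc. *)

Lemma discriminant_le (R : realType) (a b c : R) :
  (forall t, 0 <= a * t ^+ 2 - 2 * b * t + c) -> b ^+ 2 <= a * c.
Proof.
move=> h; have a0 : 0 <= a.
  rewrite leNgt; apply/negP => a0.
  have c0 : 0 <= c by have := h 0; rewrite expr0n /= !mulr0 subrr add0r.
  (* If [a < 0], then at this [t >= 1] the factor [a * t - 2 * b] is at most [- (c + 1) + a], so the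
     quadratic is negative. *)
  pose t := (2 * `|b| + c + 1) / (- a) + 1.
  have na0 : 0 < - a by lra.
  have hb := ler_norm (- b); have hb0 := normr_ge0 b.
  rewrite normrN in hb.
  have q0 : 0 <= (2 * `|b| + c + 1) / (- a) by apply: divr_ge0; lra.
  have t1 : 1 <= t by rewrite /t; lra.
  have ht : a * t = - (2 * `|b| + c + 1) + a by rewrite /t; field; lra.
  have := h t; rewrite expr2 mulrA ht.
  by nra.
have [a00|an0] := eqVneq a 0.
  have [->|b0] := eqVneq b 0; first by rewrite a00 expr0n /= mul0r.
  have := h ((c + 1) / (2 * b)).
  have -> : 2 * b * ((c + 1) / (2 * b)) = c + 1 by field; lra.
  by rewrite a00; lra.
have := h (b / a).
have -> : a * (b / a) ^+ 2 - 2 * b * (b / a) + c = c - b ^+ 2 / a by field.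
have ap : 0 < a by rewrite lt_def an0.
by rewrite subr_ge0 ler_pdivrMr // mulrC.
Qed.

Lemma le0_of_le_eps (R : realType) (x C : R) :
  (forall e, 0 < e -> x <= C * e) -> x <= 0.
Proof.
move=> h; rewrite leNgt; apply/negP => x0.
have C1 : 0 < `|C| + 1 by have := normr_ge0 C; lra.
have e0 : 0 < x / (`|C| + 1) / 2 by apply: divr_gt0 => //; apply: divr_gt0.
have := h _ e0; have e0' := ltW e0.
have hC : C * (x / (`|C| + 1) / 2) <= (`|C| + 1) * (x / (`|C| + 1) / 2).
  by apply: ler_wpM2r => //; have := ler_norm C; lra.
have eC : (`|C| + 1) * (x / (`|C| + 1) / 2) = x / 2 by field; lra.
rewrite eC in hC.
by lra.
Qed.

Section hilbert.
(** [V] will be the space of all functions, [L] the square-integrable ones and [A] the Bergman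
    space. [ip] is a semi-inner product: functions that agree on the disc are at distance zero, so
    the results are orthogonality relations rather than equations in [V]. *)
Variables (R : realType) (V : lmodType R) (L A : V -> Prop) (ip : V -> V -> R).
Hypothesis L_lin : forall a u v, L u -> L v -> L (a *: u + v).
Hypothesis A_lin : forall a u v, A u -> A v -> A (a *: u + v).
Hypothesis A0 : A 0.
Hypothesis AL : forall u, A u -> L u.
Hypothesis ipC : forall u v, ip u v = ip v u.
Hypothesis ip_lin : forall a u v w, L u -> L v -> L w ->
  ip (a *: u + v) w = a * ip u w + ip v w.
Hypothesis ip_ge0 : forall u, 0 <= ip u u.

Let nrm u := Num.sqrt (ip u u).

Let L_N u : L u -> L (- u).
Proof. by move=> Lu; have := L_lin (-1) _ _ Lu (AL _ A0); rewrite addr0 scaleN1r. Qed.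
Let L_D u v : L u -> L v -> L (u + v).
Proof. by move=> Lu Lv; rewrite -[u]scale1r; apply: L_lin. Qed.
Let L_B u v : L u -> L v -> L (u - v).
Proof. by move=> Lu Lv; apply/L_D/L_N. Qed.
Let A_D u v : A u -> A v -> A (u + v).
Proof. by move=> Lu Lv; rewrite -[u]scale1r; apply: A_lin. Qed.
Let A_Z a u : A u -> A (a *: u).
Proof. by move=> Au; rewrite -[_ *: _]addr0; apply: A_lin. Qed.
Let A_B u v : A u -> A v -> A (u - v).
Proof. by move=> Au Av; rewrite -scaleN1r; apply/A_D/A_Z. Qed.

Let ipDl u v w : L u -> L v -> L w -> ip (u + v) w = ip u w + ip v w.
Proof. by move=> *; rewrite -[u in LHS]scale1r ip_lin // mul1r. Qed.
Let ip0l w : L w -> ip 0 w = 0.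
Proof.
move=> Lw; have := ipDl 0 0 w (AL _ A0) (AL _ A0) Lw.
by rewrite addr0; lra.
Qed.
Let ipZl a u w : L u -> L w -> ip (a *: u) w = a * ip u w.
Proof. by move=> *; rewrite -[a *: u]addr0 ip_lin ?ip0l ?addr0 //; apply: AL. Qed.
Let ipNl u w : L u -> L w -> ip (- u) w = - ip u w.
Proof. by move=> *; rewrite -scaleN1r ipZl // mulN1r. Qed.
Let ipBl u v w : L u -> L v -> L w -> ip (u - v) w = ip u w - ip v w.
Proof. by move=> *; rewrite ipDl ?ipNl //; apply: L_N. Qed.

Let ipDD u v : L u -> L v -> ip (u + v) (u + v) = ip u u + 2 * ip u v + ip v v.
Proof.
move=> Lu Lv; rewrite ipDl // 1?[ip u (_ + _)]ipC 1?[ip v (_ + _)]ipC; last exact: L_D.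
rewrite !ipDl // (ipC v u); ring.
Qed.
Let ipBB u v : L u -> L v -> ip (u - v) (u - v) = ip u u - 2 * ip u v + ip v v.
Proof.
move=> Lu Lv; have Nv := L_N v Lv; rewrite ipDD // (ipC u) !ipNl //.
by rewrite (ipC v (- v)) ipNl // (ipC v u); ring.
Qed.

Lemma cauchy_schwarz u v : L u -> L v -> ip u v ^+ 2 <= ip u u * ip v v.
Proof.
move=> Lu Lv; rewrite mulrC; apply: discriminant_le => t.
have Ltv : L (t *: v) by rewrite -[_ *: _]addr0; apply: L_lin => //; apply: AL.
have := ip_ge0 (u - t *: v).
rewrite ipBB // (ipC u (t *: v)) !ipZl // (ipC v (t *: v)) ipZl // (ipC v u).
move/le_trans; apply; rewrite le_eqVlt; apply/orP; left; apply/eqP; ring.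
Qed.

Let nrm_ge0 u : 0 <= nrm u. Proof. exact: sqrtr_ge0. Qed.
Let nrm2 u : nrm u ^+ 2 = ip u u. Proof. exact: sqr_sqrtr. Qed.

Let ip_le_nrm u v : L u -> L v -> `|ip u v| <= nrm u * nrm v.
Proof.
move=> Lu Lv; rewrite -(@ler_pXn2r _ 2) ?nnegrE ?mulr_ge0 //.
by rewrite exprMn !nrm2 real_normK ?num_real //; exact: cauchy_schwarz.
Qed.

Let nrmD u v : L u -> L v -> nrm (u + v) <= nrm u + nrm v.
Proof.
move=> Lu Lv; rewrite -(@ler_pXn2r _ 2) ?nnegrE ?addr_ge0 //.
rewrite nrm2 ipDD // sqrrD !nrm2 -mulr_natl.
have := ip_le_nrm u v Lu Lv; have := ler_norm (ip u v); lra.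
Qed.

Hypothesis A_complete : forall s : nat -> V, (forall n, A (s n)) ->
  (forall e, 0 < e -> exists n0, forall m n, (n0 <= m)%N -> (n0 <= n)%N ->
     ip (s m - s n) (s m - s n) <= e) ->
  exists2 a, A a & forall e, 0 < e -> exists n0, forall n, (n0 <= n)%N ->
     ip (s n - a) (s n - a) <= e.

Let nrm_conv s a (As : forall n, A (s n)) (Aa : A a) :
  (forall e, 0 < e -> exists n0, forall n, (n0 <= n)%N ->
     ip (s n - a) (s n - a) <= e) ->
  forall e, 0 < e -> exists n0, forall n, (n0 <= n)%N -> nrm (s n - a) <= e.
Proof.
move=> h e e0; have [n0 hn] := h _ (exprn_gt0 2 e0); exists n0 => n /hn.
by rewrite -nrm2 ler_pXn2r // ?nnegrE ?nrm_ge0 // ltW.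
Qed.

Lemma orthogonal_projection u : L u ->
  exists2 a, A a & forall h, A h -> ip (u - a) h = 0.
Proof.
move=> Lu; pose E := [set ip (u - a) (u - a) | a in [set a | A a]].
have E0 : has_inf E.
  split; first by exists (ip (u - 0) (u - 0)), 0.
  by exists 0 => _ [a _ <-].
pose d := inf E.
have dE a : A a -> d <= ip (u - a) (u - a).
  by move=> Aa; apply: ge_inf; [exact: E0.2 | exists a].
have : forall n : nat, exists a, A a /\ ip (u - a) (u - a) < d + n.+1%:R^-1.
  move=> n; have n0 : (0 : R) < n.+1%:R^-1 by rewrite invr_gt0.
  by have [_ [a Aa <-] ha] := inf_adherent n0 E0; exists a.
move=> /choice [s hs].
have As n : A (s n) by case: (hs n).
have Ls n := AL _ (As n); have Lus n : L (u - s n) by apply: L_B.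
have inve (e : R) : 0 < e -> exists n0, forall n, (n0 <= n)%N -> n.+1%:R^-1 <= e.
  move=> e0; exists (Num.truncn e^-1) => n hn.
  rewrite -[e]invrK lef_pV2 ?posrE ?invr_gt0 // ltW //.
  have ei : 0 <= e^-1 by rewrite invr_ge0 ltW.
  apply: (lt_le_trans (truncnS_gt _)).
  by rewrite ler_nat.
have [a Aa ha] : exists2 a, A a & forall e, 0 < e ->
    exists n0, forall n, (n0 <= n)%N -> ip (s n - a) (s n - a) <= e.
  apply: A_complete => // e e0.
  have [n0 hn0] := inve (e / 4) ltac:(lra); exists n0 => m n hm hn.
  (* Parallelogram law: the midpoint lies in [A], hence at squared distance at least [d] from [u],
     so the squared distance of [s m] and [s n] is at most twice the sum of their excesses over [d];
     hence the [e / 4]. *)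
  have A2 : A (2^-1 *: (s m + s n)) by apply/A_Z/A_D.
  have := dE _ A2.
  have -> : u - 2^-1 *: (s m + s n) = 2^-1 *: ((u - s m) + (u - s n)).
    rewrite addrACA -opprD scalerBr; congr (_ - _).
    by rewrite -[u + u]mulr2n -(scaler_nat 2 u) scalerA mulVf ?scale1r // pnatr_eq0.
  have LD := L_D _ _ (Lus m) (Lus n).
  have LDZ : L (2^-1 *: (u - s m + (u - s n))).
    by rewrite -[_ *: _]addr0; apply: L_lin => //; apply: AL.
  rewrite ipZl // ipC ipZl // ipDD //.
  have -> : s m - s n = (u - s n) - (u - s m) by rewrite opprB [RHS]addrC addrA subrK.
  rewrite (ipBB (u - s n) (u - s m)) // (ipC (u - s n) (u - s m)).
  have := (hs m).2; have := (hs n).2; have := hn0 _ hm; have := hn0 _ hn.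
  move: (ip (u - s m) (u - s m)) (ip (u - s n) (u - s n)) (ip (u - s m) (u - s n)) => x y z.
  move: (n.+1%:R^-1) (m.+1%:R^-1) => p q; lra.
exists a => // h Ah; have Lh := AL _ Ah; have La := AL _ Aa.
have ha' := nrm_conv s a As Aa ha.
suff : `|ip (u - a) h| <= 0 by rewrite normr_le0 => /eqP.
apply: (@le0_of_le_eps _ _ (2 * nrm h)) => e e0.
have [n1 hn1] := ha' e e0.
have [n2 hn2] := inve (e ^+ 2) (exprn_gt0 2 e0).
pose n := maxn n1 n2.
have -> : u - a = (u - s n) + (s n - a) by rewrite addrA subrK.
rewrite ipDl //; last exact: L_B.
apply: (le_trans (ler_normD _ _)).
have b2 : `|ip (s n - a) h| <= nrm h * e.
  apply: (le_trans (ip_le_nrm _ _ (L_B _ _ (Ls n) La) Lh)).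
  by rewrite mulrC; apply: ler_wpM2l => //; apply: hn1; rewrite leq_maxl.
suff b1 : `|ip (u - s n) h| <= nrm h * e by lra.
have e0w := ltW e0; rewrite -(@ler_pXn2r _ 2) ?nnegrE ?mulr_ge0 //.
rewrite exprMn real_normK ?num_real // nrm2.
(* No move by [t *: h] inside [A] lowers the squared distance by more than [n.+1%:R^-1], so a
   quadratic in [t] is nonnegative; its discriminant bounds the failure of orthogonality. *)
have : ip (u - s n) h ^+ 2 <= ip h h * n.+1%:R^-1.
  apply: discriminant_le => t.
  have Lth : L (t *: h) by apply: AL; apply: A_Z.
  have := dE (s n + t *: h) (A_D _ _ (As n) (A_Z t _ Ah)).
  have -> : u - (s n + t *: h) = (u - s n) - t *: h by rewrite opprD addrA.
  rewrite ipBB // (ipC _ (t *: h)) !ipZl // (ipC h (t *: h)) ipZl // (ipC h).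
  by have := (hs n).2; rewrite expr2; move: (n.+1%:R^-1) => q; lra.
move=> h1; apply: (le_trans h1); apply: ler_wpM2l => //.
by apply: hn2; rewrite leq_maxr.
Qed.

(* Banach iteration [s n.+1 = Q (T (s n) + g)], [Q] the orthogonal projection onto [A]. *)
Lemma contraction_projection_fixpoint (T : V -> V) (k : R) (g : V) :
  0 <= k < 1 -> L g -> (forall u, L u -> L (T u)) ->
  (forall u v, L u -> L v ->
     ip (T u - T v) (T u - T v) <= k ^+ 2 * ip (u - v) (u - v)) ->
  exists2 f, A f & forall h, A h -> ip (T f + g - f) h = 0.
Proof.
move=> /andP[k0 k1] Lg LT Tc.
have : forall u, exists a, L u -> A a /\ forall h, A h -> ip (u - a) h = 0.
  move=> u; have [Lu|nL] := pselect (L u); last by exists 0.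
  by have [a Aa ha] := orthogonal_projection u Lu; exists a.
move=> /choice [Q hQ].
have QA u : L u -> A (Q u) by move/hQ => [].
have QL u : L u -> L (Q u) by move/QA/AL.
have Qo u h : L u -> A h -> ip (u - Q u) h = 0 by move=> /hQ[_ +] Ah; apply.
have Qc u v : L u -> L v -> nrm (Q u - Q v) <= nrm (u - v).
  move=> Lu Lv.
  have Aq : A (Q u - Q v) by apply: A_B; apply: QA.
  have Lq := AL _ Aq; have Luv := L_B _ _ Lu Lv.
  (* Both [u - Q u] and [v - Q v] are orthogonal to [A]; with Cauchy-Schwarz this makes [Q]
     nonexpansive. *)
  have e : ip (u - v) (Q u - Q v) = ip (Q u - Q v) (Q u - Q v).
    apply/eqP; rewrite -subr_eq0 -ipBl //.
    have -> : u - v - (Q u - Q v) = (u - Q u) - (v - Q v).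
      by rewrite !opprB addrACA [RHS]addrACA [- v - _]addrC.
    by rewrite ipBl ?Qo ?subrr //; apply: L_B => //; apply: QL.
  have := ip_le_nrm _ _ Luv Lq; rewrite e ger0_norm // -nrm2 expr2.
  have [->|n0] := eqVneq (nrm (Q u - Q v)) 0; first by rewrite nrm_ge0.
  by rewrite ler_pM2r // lt_def n0 nrm_ge0.
pose F u := Q (T u + g).
have LTg u : L u -> L (T u + g) by move=> Lu; apply: L_D => //; apply: LT.
have FA u : L u -> A (F u) by move=> Lu; apply/QA/LTg.
have Fc u v : L u -> L v -> nrm (F u - F v) <= k * nrm (u - v).
  move=> Lu Lv; apply: (le_trans (Qc _ _ (LTg _ Lu) (LTg _ Lv))).
  have -> : T u + g - (T v + g) = T u - T v by rewrite opprD addrACA subrr addr0.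
  rewrite -(@ler_pXn2r _ 2) ?nnegrE ?mulr_ge0 // exprMn !nrm2; exact: Tc.
pose s n := iter n F 0.
have As n : A (s n) by elim: n => [//|n IH] /=; apply/FA/AL.
have Ls n := AL _ (As n).
pose D := nrm (s 1%N - s 0%N).
have D1 : 0 <= D / (1 - k) by apply: divr_ge0; [exact: nrm_ge0 | lra].
(* [D / (1 - k)] solves [x = k * x + D], so induction on [p] bounds the distance of every iterate
   from the start; applying [F] to both points [n] times then yields the Cauchy estimate [bd2]. *)
have bd p : nrm (s p - s 0%N) <= D / (1 - k).
  elim: p => [|p IH].
    by rewrite subrr /nrm ip0l ?sqrtr0 //; apply: AL.
  have -> : s p.+1 - s 0%N = (s p.+1 - s 1%N) + (s 1%N - s 0%N) by rewrite addrA subrK.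
  apply: (le_trans (nrmD _ _ (L_B _ _ (Ls _) (Ls _)) (L_B _ _ (Ls _) (Ls _)))).
  have := Fc _ _ (Ls p) (Ls 0%N); rewrite -/(s p.+1) -/(s 1%N) -/D => h1.
  have h2 : k * nrm (s p - s 0%N) <= k * (D / (1 - k)) by apply: ler_wpM2l.
  have e : D / (1 - k) = k * (D / (1 - k)) + D by field; lra.
  by rewrite e; apply: lerD => //; apply: (le_trans h1).
have bd2 n p : nrm (s (n + p)%N - s n) <= k ^+ n * (D / (1 - k)).
  elim: n => [|n IH]; first by rewrite add0n expr0 mul1r.
  apply: (le_trans (Fc _ _ (Ls _) (Ls _))).
  by rewrite exprS -mulrA; apply: ler_wpM2l.
have k0' : forall e, 0 < e -> exists n0, forall n, (n0 <= n)%N ->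
    k ^+ n * (D / (1 - k)) <= e.
  move=> e e0.
  have : (fun n => k ^+ n * (D / (1 - k))) @ \oo --> (0 : R).
    rewrite -(mul0r (D / (1 - k))); apply: cvgMl; apply: cvg_expr.
    by rewrite ger0_norm.
  move/cvgrPdist_le => /(_ e e0) [n0 _ hn0]; exists n0 => n hn.
  have := hn0 n hn; rewrite /= sub0r normrN; apply: le_trans; exact: ler_norm.
have [f Af hf] : exists2 a, A a & forall e, 0 < e ->
    exists n0, forall n, (n0 <= n)%N -> ip (s n - a) (s n - a) <= e.
  apply: A_complete => // e e0.
  have se0 : 0 < Num.sqrt e by rewrite sqrtr_gt0.
  have [n0 hn0] := k0' _ se0; exists n0.
  have main m n : (n0 <= n)%N -> (n <= m)%N -> ip (s m - s n) (s m - s n) <= e.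
    have e0w := ltW e0.
    move=> hn hm; rewrite -nrm2 -[leRHS](@sqr_sqrtr _ e) //.
    have s0w := ltW se0; rewrite ler_pXn2r ?nnegrE //.
    apply: (le_trans _ (hn0 n hn)); rewrite -(subnKC hm); exact: bd2.
  move=> m n hm hn; have [le|/ltnW le] := leqP n m; first exact: main.
  by rewrite -opprB ipNl ?(ipC _ (- _)) ?ipNl ?opprK ?main //; do ?apply: L_N; apply: L_B.
have hf' := nrm_conv s f As Af hf.
exists f => // h Ah; have Lh := AL _ Ah; have Lf := AL _ Af.
suff : `|ip (T f + g - f) h| <= 0 by rewrite normr_le0 => /eqP.
apply: (@le0_of_le_eps _ _ (2 * nrm h)) => e e0.
have [n0 hn0] := hf' e e0.
(* The last summand is orthogonal to [A] because [s n0.+1] is the projection of [T (s n0) + g]; the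
   other two have norm at most [e]. *)
have -> : T f + g - f = (T f - T (s n0)) + (s n0.+1 - f) + (T (s n0) + g - s n0.+1).
  rewrite -[in RHS]addrA [s n0.+1 - f + _]addrC addrA addrA; congr (_ - _).
  by rewrite [in RHS]addrA [in RHS]addrA subrK subrK.
have L1 := L_B _ _ (LT _ Lf) (LT _ (Ls n0)).
have L2 := L_B _ _ (Ls n0.+1) Lf.
have L3 := L_B _ _ (LTg _ (Ls n0)) (Ls n0.+1).
rewrite ipDl // ?Qo ?addr0 //; [| exact: LTg | exact: L_D].
rewrite ipDl //.
apply: (le_trans (ler_normD _ _)).
have i1 := ip_le_nrm _ _ L1 Lh; have i2 := ip_le_nrm _ _ L2 Lh.
have j2 := hn0 n0.+1 (leqnSn _).
have j1 : nrm (T f - T (s n0)) <= e.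
  have e0w := ltW e0; rewrite -(@ler_pXn2r _ 2) ?nnegrE // nrm2.
  apply: (le_trans (Tc _ _ Lf (Ls n0))).
  have -> : f - s n0 = - (s n0 - f) by rewrite opprB.
  have Lsf := L_B _ _ (Ls n0) Lf.
  rewrite ipNl // ?(ipC _ (- _)) ?ipNl // ?opprK; last exact: L_N.
  rewrite -nrm2; have := hn0 n0 (leqnn _) => j.
  rewrite -exprMn ler_pXn2r ?nnegrE ?mulr_ge0 //.
  by apply: (le_trans _ j); rewrite ler_piMl // ltW.
have := ler_wpM2r (nrm_ge0 h) j1; have := ler_wpM2r (nrm_ge0 h) j2.
by lra.
Qed.

End hilbert.

(** * Green's theorem for closed differentiable forms *)

Section segment_integral.
Variable R : realType.
Local Notation mu := (@lebesgue_measure R).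
Implicit Types (f g : R -> R) (a b m x : R).

Lemma fine_lebesgue_segment a b : a <= b -> fine (mu `[a, b]) = b - a.
Proof.
move=> ab; rewrite lebesgue_measure_itv /=.
by case: ifPn => [_ //|]; rewrite lte_fin -leNgt => ba; rewrite (le_anti (introT andP (conj ab ba))) subrr.
Qed.

Lemma segment_integrable f a b : {within `[a, b], continuous f} ->
  mu.-integrable `[a, b] (EFin \o f).
Proof. by move=> cf; apply: continuous_compact_integrable => //; exact: segment_compact. Qed.

Lemma Rintegral_segment_split f a m b : a <= m -> m <= b ->
  {within `[a, b], continuous f} ->
  \int[mu]_(x in `[a, b]) f x =
  \int[mu]_(x in `[a, m]) f x + \int[mu]_(x in `[m, b]) f x.
Proof.
move=> am mb cf; have itf := segment_integrable _ _ _ cf.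
have itm : mu.-integrable `]m, b] (EFin \o f).
  by apply: integrableS itf => //; apply: subset_itv; rewrite bnd_simp.
have am' : (BLeft a <= BRight m)%O by rewrite bnd_simp.
have mb' : (BRight m <= BRight b)%O by rewrite bnd_simp.
have := Rintegral_itvB itf am' mb'.
by rewrite (Rintegral_itv_obnd_cbnd itm) => <-; rewrite addrC subrK.
Qed.

Lemma Rintegral_segment_le f a b M : a <= b -> {within `[a, b], continuous f} ->
  (forall x, a <= x <= b -> f x <= M) ->
  \int[mu]_(x in `[a, b]) f x <= M * (b - a).
Proof.
move=> ab cf fM; rewrite -fine_lebesgue_segment // -Rintegral_cst //.
apply: le_Rintegral => //; first exact: segment_integrable.
  by apply: segment_integrable; apply: continuous_subspaceT => x; exact: cvg_cst.
Qed.

Lemma Rintegral_segment_ge f a b M : a <= b -> {within `[a, b], continuous f} ->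
  (forall x, a <= x <= b -> M <= f x) ->
  M * (b - a) <= \int[mu]_(x in `[a, b]) f x.
Proof.
move=> ab cf fM; rewrite -fine_lebesgue_segment // -Rintegral_cst //.
apply: le_Rintegral => //.
  by apply: segment_integrable; apply: continuous_subspaceT => x; exact: cvg_cst.
exact: segment_integrable.
Qed.

Lemma within_continuous_eps f a b :
  (forall x, a <= x <= b -> forall e, 0 < e -> exists2 d, 0 < d &
     forall x', `|x' - x| < d -> `|f x' - f x| <= e) ->
  {within `[a, b], continuous f}.
Proof.
move=> h; apply/subspace_continuousP => x; rewrite /= in_itv /= => xab.
apply: cvg_within_filter; apply/cvgrPdist_le => e e0.
have [d d0 hd] := h x xab e e0; near=> x'.
rewrite distrC; apply: hd; rewrite distrC; near: x'.
by apply/nbhs_ballP; exists d.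
Unshelve. all: by end_near. Qed.

End segment_integral.

(** * Bisection of rectangles *)

Section bisection.
Variable R : realType.

(* Goursat's bisection: an additive function of rectangles that is
   [o(perimeter ^ 2)] at every point vanishes. *)
Lemma additive_rectangle_eq0 (Phi : R -> R -> R -> R -> R) (a b c d : R) :
  a <= b -> c <= d ->
  (forall a' m b' c' d', a <= a' -> a' <= m -> m <= b' -> b' <= b ->
     c <= c' -> c' <= d' -> d' <= d ->
     Phi a' b' c' d' = Phi a' m c' d' + Phi m b' c' d') ->
  (forall a' b' c' m d', a <= a' -> a' <= b' -> b' <= b ->
     c <= c' -> c' <= m -> m <= d' -> d' <= d ->
     Phi a' b' c' d' = Phi a' b' c' m + Phi a' b' m d') ->
  (forall x y, a <= x <= b -> c <= y <= d -> forall e, 0 < e ->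
     exists2 t, 0 < t & forall a' b' c' d', a <= a' -> a' <= x -> x <= b' ->
       b' <= b -> c <= c' -> c' <= y -> y <= d' -> d' <= d ->
       b' - a' < t -> d' - c' < t ->
       `|Phi a' b' c' d'| <= e * ((b' - a') + (d' - c')) ^+ 2) ->
  Phi a b c d = 0.
Proof.
move=> ab cd addx addy loc.
pose P (Q : (R * R) * (R * R)) := Phi Q.1.1 Q.1.2 Q.2.1 Q.2.2.
pose valid (Q : (R * R) * (R * R)) :=
  [/\ a <= Q.1.1, Q.1.1 <= Q.1.2 & Q.1.2 <= b] /\
  [/\ c <= Q.2.1, Q.2.1 <= Q.2.2 & Q.2.2 <= d].
(* [Q'] is a quarter of [Q] that keeps at least a quarter of the absolute value; by the triangle
   inequality one of the four quarters does. *)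
pose half (Q Q' : (R * R) * (R * R)) :=
  [/\ valid Q', Q.1.1 <= Q'.1.1 /\ Q'.1.2 <= Q.1.2,
     Q.2.1 <= Q'.2.1 /\ Q'.2.2 <= Q.2.2,
     Q'.1.2 - Q'.1.1 = (Q.1.2 - Q.1.1) / 2 /\ Q'.2.2 - Q'.2.1 = (Q.2.2 - Q.2.1) / 2
   & `|P Q| <= 4 * `|P Q'|].
have : forall Q, exists Q', valid Q -> half Q Q'.
  move=> [[x1 x2] [y1 y2]].
  have [[[/= h1 h2 h3] [h4 h5 h6]]|nv] := pselect (valid ((x1, x2), (y1, y2))); last first.
    by exists ((x1, x2), (y1, y2)) => /nv.
  pose mx := (x1 + x2) / 2; pose my := (y1 + y2) / 2.
  have mid (u v : R) : u <= v -> [/\ u <= (u + v) / 2, (u + v) / 2 <= v,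
      (u + v) / 2 - u = (v - u) / 2 & v - (u + v) / 2 = (v - u) / 2].
    by clear; move=> ?; split; lra.
  have [mx1 mx2 ex1 ex2] := mid _ _ h2; have [my1 my2 ey1 ey2] := mid _ _ h5.
  rewrite -/mx -/my in mx1 mx2 ex1 ex2 my1 my2 ey1 ey2.
  have amx := le_trans h1 mx1; have mxb := le_trans mx2 h3.
  have cmy := le_trans h4 my1; have myd := le_trans my2 h6.
  have e : P ((x1, x2), (y1, y2)) =
      (P ((x1, mx), (y1, my)) + P ((x1, mx), (my, y2))) +
      (P ((mx, x2), (y1, my)) + P ((mx, x2), (my, y2))).
    by rewrite /P /= (addx x1 mx x2 y1 y2) // (addy x1 mx y1 my y2) // (addy mx x2 y1 my y2).
  set p0 := P _ in e; set p1 := P _ in e; set p2 := P _ in e.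
  set p3 := P _ in e; set p4 := P _ in e.
  have tri : `|p0| <= `|p1| + `|p2| + (`|p3| + `|p4|).
    rewrite e; apply: (le_trans (ler_normD _ _)).
    by apply: lerD; exact: ler_normD.
  have [k1|k1] := leP `|p0| (4 * `|p1|).
    exists ((x1, mx), (y1, my)) => _; rewrite /half /valid /=.
    by do !split.
  have [k2|k2] := leP `|p0| (4 * `|p2|).
    exists ((x1, mx), (my, y2)) => _; rewrite /half /valid /=.
    by do !split.
  have [k3|k3] := leP `|p0| (4 * `|p3|).
    exists ((mx, x2), (y1, my)) => _; rewrite /half /valid /=.
    by do !split.
  have [k4|k4] := leP `|p0| (4 * `|p4|).
    exists ((mx, x2), (my, y2)) => _; rewrite /half /valid /=.
    by do !split.
  by move: tri k1 k2 k3 k4; clear; lra.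
move=> /choice [step hstep].
pose s n := iter n step ((a, b), (c, d)).
have vs n : valid (s n).
  elim: n => [|n IH]; first by do !split => //=.
  by have [] := hstep _ IH.
have hs n : half (s n) (s n.+1) by apply: hstep.
have wid n : (s n).1.2 - (s n).1.1 = (b - a) / 2 ^+ n.
  elim: n => [|n IH]; first by rewrite expr0 divr1.
  have [_ _ _ [-> _] _] := hs n.
  by rewrite IH exprS invfM mulrA mulrAC.
have hei n : (s n).2.2 - (s n).2.1 = (d - c) / 2 ^+ n.
  elim: n => [|n IH]; first by rewrite expr0 divr1.
  have [_ _ _ [_ ->] _] := hs n.
  by rewrite IH exprS invfM mulrA mulrAC.
have big n : `|Phi a b c d| <= 4 ^+ n * `|P (s n)|.
  elim: n => [|n IH]; first by rewrite expr0 mul1r.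
  have [_ _ _ _ h] := hs n; apply: (le_trans IH).
  by rewrite exprSr -mulrA; apply: ler_wpM2l => //; exact: exprn_ge0.
have mono n k : (s n).1.1 <= (s (n + k)%N).1.1 /\ (s (n + k)%N).1.2 <= (s n).1.2 /\
    (s n).2.1 <= (s (n + k)%N).2.1 /\ (s (n + k)%N).2.2 <= (s n).2.2.
  elim: k => [|k IH]; first by rewrite addn0.
  rewrite addnS; have [_ [i1 i2] [i3 i4] _ _] := hs (n + k)%N.
  by move: IH i1 i2 i3 i4; clear; lra.
have cross1 n k : (s n).1.1 <= (s k).1.2.
  have [[_ v _] _] := vs (maxn n k).
  have [+ _] := mono n (maxn n k - n)%N; rewrite subnKC ?leq_maxl // => i1.
  have [_ [+ _]] := mono k (maxn n k - k)%N; rewrite subnKC ?leq_maxr // => i2.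
  exact: le_trans i1 (le_trans v i2).
have cross2 n k : (s n).2.1 <= (s k).2.2.
  have [_ [_ v _]] := vs (maxn n k).
  have [_ [_ [+ _]]] := mono n (maxn n k - n)%N; rewrite subnKC ?leq_maxl // => i1.
  have [_ [_ [_ +]]] := mono k (maxn n k - k)%N; rewrite subnKC ?leq_maxr // => i2.
  exact: le_trans i1 (le_trans v i2).
(* Nested intervals: the supremum of the left ends lies in all of them. *)
have supP (u v : nat -> R) : (forall n k, u n <= v k) ->
    exists x, forall n, u n <= x <= v n.
  move=> uv; exists (sup (range u)) => n; apply/andP; split.
    by apply: ub_le_sup; [exists (v 0%N) => _ [m _ <-] | exists n].
  by apply: ge_sup; [exists (u 0%N), 0%N | move=> _ [m _ <-]].
have [x hx] := supP _ _ cross1.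
have [y hy] := supP _ _ cross2.
have xab : a <= x <= b by have := hx 0%N.
have ycd : c <= y <= d by have := hy 0%N.
suff : `|Phi a b c d| <= 0 by rewrite normr_le0 => /eqP.
rewrite leNgt; apply/negP => pos.
pose l := (b - a) + (d - c); have l0 : 0 <= l by rewrite addr_ge0 // subr_ge0.
(* After [n] bisections, [|Phi| <= 4^n * e * (l / 2^n)^2 = e * l^2 <= |Phi| / 2], a contradiction.
   The [l + 1] keeps the denominator positive for a degenerate rectangle. *)
pose e := `|Phi a b c d| / (l + 1) ^+ 2 / 2.
have l1 : 0 < (l + 1) ^+ 2 by rewrite exprn_gt0 // ltr_wpDl.
have e0 : 0 < e by apply: divr_gt0 => //; apply: divr_gt0.
have [t t0 ht] := loc x y xab ycd e e0.
have [n hn] : exists n, l / 2 ^+ n < t.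
  have : (fun n => l * (2^-1) ^+ n) @ \oo --> (0 : R).
    rewrite -(mulr0 l); apply: cvgMr; apply: cvg_expr.
    by rewrite ger0_norm ?invr_ge0 // invf_lt1 // ltr1n.
  move/cvgrPdist_lt => /(_ t t0) [n _ hn]; exists n.
  have := hn n (leqnn n); rewrite /= sub0r normrN exprVn.
  by apply: le_lt_trans; exact: ler_norm.
have p2 : (0 : R) < 2 ^+ n by exact: exprn_gt0.
have [[v1 v2 v3] [v4 v5 v6]] := vs n.
have /andP[x1 x2] := hx n; have /andP[y1 y2] := hy n.
have ba2 : (b - a) / 2 ^+ n <= l / 2 ^+ n.
  by apply: ler_wpM2r; [rewrite invr_ge0 ltW | rewrite lerDl subr_ge0].
have dc2 : (d - c) / 2 ^+ n <= l / 2 ^+ n.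
  by apply: ler_wpM2r; [rewrite invr_ge0 ltW | rewrite lerDr subr_ge0].
have := ht _ _ _ _ v1 x1 x2 v3 v4 y1 y2 v6.
rewrite wid hei => /(_ (le_lt_trans ba2 hn) (le_lt_trans dc2 hn)) hP.
have := big n; rewrite -/(P (s n)) in hP.
have el : (b - a) / 2 ^+ n + (d - c) / 2 ^+ n = l / 2 ^+ n by rewrite -mulrDl.
rewrite el in hP; move=> hB.
have h4 : 4 ^+ n * `|P (s n)| <= e * l ^+ 2.
  apply: (le_trans (ler_wpM2l _ hP)); first exact: exprn_ge0.
  have -> : (4 : R) ^+ n = 2 ^+ n * 2 ^+ n by rewrite -exprMn -natrM.
  by rewrite le_eqVlt; apply/orP; left; apply/eqP; move: p2; clear => p2; field; rewrite gt_eqF.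
have h5 : l ^+ 2 <= (l + 1) ^+ 2 by rewrite ler_pXn2r ?nnegrE ?lerDl ?ler01 // addr_ge0.
have h6 : e * l ^+ 2 <= e * (l + 1) ^+ 2 by apply: ler_wpM2l => //; exact: ltW.
have h7 : e * (l + 1) ^+ 2 = `|Phi a b c d| / 2 by rewrite /e mulrAC divfK // gt_eqF.
move: (le_trans hB (le_trans h4 h6)); rewrite h7; move: pos; clear; lra.
Qed.

End bisection.

(** * Boundary integrals of closed forms over rectangles *)

Section green.
Variable R : realType.
Local Notation mu := (@lebesgue_measure R).
Implicit Types (p q : R -> R -> R) (a b c d x y : R).

Definition continuous2_at p x y := forall e, 0 < e -> exists2 t, 0 < t &
  forall x' y', `|x' - x| < t -> `|y' - y| < t -> `|p x' y' - p x y| <= e.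

(** The integral of [p dx + q dy] over the positively oriented boundary; opposite sides are paired,
    since it is their difference that is small for small or thin rectangles. *)
Definition boundary_integral p q a b c d : R :=
  \int[mu]_(x in `[a, b]) (p x c - p x d) + \int[mu]_(y in `[c, d]) (q b y - q a y).

(* Differentiability of [p] and [q] with [dp/dy = dq/dx = B]. *)
Definition closed_form_at p q x y := exists A B C : R,
  forall e, 0 < e -> exists2 t, 0 < t &
  forall x' y', `|x' - x| < t -> `|y' - y| < t ->
    `|p x' y' - p x y - (A * (x' - x) + B * (y' - y))| <= e * (`|x' - x| + `|y' - y|) /\
    `|q x' y' - q x y - (B * (x' - x) + C * (y' - y))| <= e * (`|x' - x| + `|y' - y|).

Lemma row_diff_continuous p a b c d
  (pc : forall x y, a <= x <= b -> c <= y <= d -> continuous2_at p x y) c' d' a' b' : a <= a' -> b' <= b -> c <= c' <= d -> c <= d' <= d ->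
  {within `[a', b'], continuous (fun x => p x c' - p x d')}.
Proof.
move=> aa bb hc hd; apply: within_continuous_eps => x /andP[x1 x2] e e0.
have xab : a <= x <= b by move: aa bb x1 x2; clear; lra.
have e20 : 0 < e / 2 by rewrite divr_gt0.
have [t1 t10 h1] := pc x c' xab hc _ e20.
have [t2 t20 h2] := pc x d' xab hd _ e20.
exists (Num.min t1 t2); first by rewrite lt_min t10.
move=> x'; rewrite lt_min => /andP[k1 k2].
have := h1 x' c' k1; rewrite subrr normr0 => /(_ t10) j1.
have := h2 x' d' k2; rewrite subrr normr0 => /(_ t20) j2.
have -> : p x' c' - p x' d' - (p x c' - p x d') =
  (p x' c' - p x c') - (p x' d' - p x d') by ring.
by apply: (le_trans (ler_normB _ _)); move: j1 j2; clear; lra.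
Qed.

Lemma column_diff_continuous q a b c d
  (qc : forall x y, a <= x <= b -> c <= y <= d -> continuous2_at q x y) a' b' c' d' : c <= c' -> d' <= d -> a <= a' <= b -> a <= b' <= b ->
  {within `[c', d'], continuous (fun y => q b' y - q a' y)}.
Proof.
move=> cc dd ha hb; apply: within_continuous_eps => y /andP[y1 y2] e e0.
have ycd : c <= y <= d by move: cc dd y1 y2; clear; lra.
have e20 : 0 < e / 2 by rewrite divr_gt0.
have [t1 t10 h1] := qc b' y hb ycd _ e20.
have [t2 t20 h2] := qc a' y ha ycd _ e20.
exists (Num.min t1 t2); first by rewrite lt_min t10.
move=> y'; rewrite lt_min => /andP[k1 k2].
have := h1 b' y'; rewrite subrr normr0 => /(_ t10 k1) j1.
have := h2 a' y'; rewrite subrr normr0 => /(_ t20 k2) j2.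
have -> : q b' y' - q a' y' - (q b' y - q a' y) =
  (q b' y' - q b' y) - (q a' y' - q a' y) by ring.
by apply: (le_trans (ler_normB _ _)); move: j1 j2; clear; lra.
Qed.

Lemma boundary_integral_addx p q a b c d
  (pc : forall x y, a <= x <= b -> c <= y <= d -> continuous2_at p x y)
  (qc : forall x y, a <= x <= b -> c <= y <= d -> continuous2_at q x y) a' m b' c' d' :
  a <= a' -> a' <= m -> m <= b' -> b' <= b -> c <= c' -> c' <= d' -> d' <= d ->
  boundary_integral p q a' b' c' d' =
  boundary_integral p q a' m c' d' + boundary_integral p q m b' c' d'.
Proof.
move=> h1 h2 h3 h4 h5 h6 h7; rewrite /boundary_integral.
have [ci di] : c <= c' <= d /\ c <= d' <= d by move: h5 h6 h7; clear; lra.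
have ai : a <= a' <= b by move: h1 h2 h3 h4; clear; lra.
have mi : a <= m <= b by move: h1 h2 h3 h4; clear; lra.
have bi : a <= b' <= b by move: h1 h2 h3 h4; clear; lra.
rewrite (Rintegral_segment_split _ _ a' m b') //; last first.
  exact: (row_diff_continuous p a b c d pc).
have -> : \int[mu]_(y in `[c', d']) (q b' y - q a' y) =
    \int[mu]_(y in `[c', d']) (q m y - q a' y) + \int[mu]_(y in `[c', d']) (q b' y - q m y).
  rewrite -RintegralD //; first by apply: eq_Rintegral => y _; ring.
  - by apply: segment_integrable; exact: (column_diff_continuous q a b c d qc).
  - by apply: segment_integrable; exact: (column_diff_continuous q a b c d qc).
ring.
Qed.

Lemma boundary_integral_addy p q a b c d
  (pc : forall x y, a <= x <= b -> c <= y <= d -> continuous2_at p x y)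
  (qc : forall x y, a <= x <= b -> c <= y <= d -> continuous2_at q x y) a' b' c' m d' :
  a <= a' -> a' <= b' -> b' <= b -> c <= c' -> c' <= m -> m <= d' -> d' <= d ->
  boundary_integral p q a' b' c' d' =
  boundary_integral p q a' b' c' m + boundary_integral p q a' b' m d'.
Proof.
move=> h1 h2 h3 h4 h5 h6 h7; rewrite /boundary_integral.
have [ai bi] : a <= a' <= b /\ a <= b' <= b by move: h1 h2 h3; clear; lra.
have ci : c <= c' <= d by move: h4 h5 h6 h7; clear; lra.
have mi : c <= m <= d by move: h4 h5 h6 h7; clear; lra.
have di : c <= d' <= d by move: h4 h5 h6 h7; clear; lra.
rewrite (Rintegral_segment_split _ _ c' m d') //; last first.
  exact: (column_diff_continuous q a b c d qc).
have -> : \int[mu]_(x in `[a', b']) (p x c' - p x d') =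
    \int[mu]_(x in `[a', b']) (p x c' - p x m) + \int[mu]_(x in `[a', b']) (p x m - p x d').
  rewrite -RintegralD //; first by apply: eq_Rintegral => y _; ring.
  - by apply: segment_integrable; exact: (row_diff_continuous p a b c d pc).
  - by apply: segment_integrable; exact: (row_diff_continuous p a b c d pc).
ring.
Qed.

(** The affine parts contribute [B (c' - d') (b' - a')] from the horizontal sides and
    [B (b' - a') (d' - c')] from the vertical ones; they cancel because dp/dy and dq/dx are the same
    [B]. Each paired difference has remainder at most [e * l], with [l] half the perimeter, which
    integrates to [e * l^2]. *)
Lemma boundary_integral_closed_small p q a b c d
  (pc : forall x y, a <= x <= b -> c <= y <= d -> continuous2_at p x y)
  (qc : forall x y, a <= x <= b -> c <= y <= d -> continuous2_at q x y) x y : closed_form_at p q x y ->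
  forall e, 0 < e ->
     exists2 t, 0 < t & forall a' b' c' d', a <= a' -> a' <= x -> x <= b' ->
       b' <= b -> c <= c' -> c' <= y -> y <= d' -> d' <= d ->
       b' - a' < t -> d' - c' < t ->
       `|boundary_integral p q a' b' c' d'| <= e * ((b' - a') + (d' - c')) ^+ 2.
Proof.
move=> [A [B [C hABC]]] e e0; have e20 : 0 < e / 2 by rewrite divr_gt0.
have [t t0 ht] := hABC _ e20.
exists t => // a' b' c' d' h1 h2 h3 h4 h5 h6 h7 h8 h9 h10.
have ab' : a' <= b' by exact: le_trans h2 h3.
have cd' : c' <= d' by exact: le_trans h6 h7.
pose l := (b' - a') + (d' - c'); have l0 : 0 <= l by rewrite addr_ge0 // subr_ge0.
have nx x' : a' <= x' <= b' -> `|x' - x| <= b' - a'.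
  by move=> i; rewrite ler_norml; move: i h2 h3; clear; lra.
have ny y' : c' <= y' <= d' -> `|y' - y| <= d' - c'.
  by move=> i; rewrite ler_norml; move: i h6 h7; clear; lra.
have est x' y' : a' <= x' <= b' -> c' <= y' <= d' ->
    `|p x' y' - p x y - (A * (x' - x) + B * (y' - y))| <= e / 2 * l /\
    `|q x' y' - q x y - (B * (x' - x) + C * (y' - y))| <= e / 2 * l.
  move=> hx' hy'; have i1 := nx _ hx'; have i2 := ny _ hy'.
  have [|| j1 j2] := ht x' y'; [exact: (le_lt_trans i1) | exact: (le_lt_trans i2) | ].
  have : e / 2 * (`|x' - x| + `|y' - y|) <= e / 2 * l.
    by apply: ler_wpM2l; [exact: ltW | exact: lerD].
  by move=> k; split; [exact: (le_trans j1) | exact: (le_trans j2)].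
have cI : c' <= c' <= d' by rewrite lexx.
have dI : c' <= d' <= d' by rewrite lexx cd'.
have aI : a' <= a' <= b' by rewrite lexx.
have bI : a' <= b' <= b' by rewrite lexx ab'.
have P1 x' : a' <= x' <= b' -> `|p x' c' - p x' d' - B * (c' - d')| <= e * l.
  move=> hx'; have [+ _] := est x' c' hx' cI; have [+ _] := est x' d' hx' dI.
  by rewrite !ler_norml; clear; lra.
have Q1 y' : c' <= y' <= d' -> `|q b' y' - q a' y' - B * (b' - a')| <= e * l.
  move=> hy'; have [_ +] := est b' y' bI hy'; have [_ +] := est a' y' aI hy'.
  by rewrite !ler_norml; clear; lra.
have cp : {within `[a', b'], continuous (fun x => p x c' - p x d')}.
  by apply: (row_diff_continuous p a b c d pc) => //; move: h5 h6 h7 h8; clear; lra.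
have cq : {within `[c', d'], continuous (fun y => q b' y - q a' y)}.
  by apply: (column_diff_continuous q a b c d qc) => //; move: h1 h2 h3 h4; clear; lra.
have u1 : \int[mu]_(x in `[a', b']) (p x c' - p x d') <= (B * (c' - d') + e * l) * (b' - a').
  apply: Rintegral_segment_le => // x' /P1; rewrite ler_norml; clear; lra.
have u2 : (B * (c' - d') - e * l) * (b' - a') <= \int[mu]_(x in `[a', b']) (p x c' - p x d').
  apply: Rintegral_segment_ge => // x' /P1; rewrite ler_norml; clear; lra.
have v1 : \int[mu]_(y in `[c', d']) (q b' y - q a' y) <= (B * (b' - a') + e * l) * (d' - c').
  apply: Rintegral_segment_le => // x' /Q1; rewrite ler_norml; clear; lra.
have v2 : (B * (b' - a') - e * l) * (d' - c') <= \int[mu]_(y in `[c', d']) (q b' y - q a' y).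
  apply: Rintegral_segment_ge => // x' /Q1; rewrite ler_norml; clear; lra.
have -> : e * (b' - a' + (d' - c')) ^+ 2 = e * l * (b' - a') + e * l * (d' - c').
  by rewrite /l; ring.
have r1 : (B * (c' - d') + e * l) * (b' - a') + (B * (b' - a') + e * l) * (d' - c') =
   e * l * (b' - a') + e * l * (d' - c') by ring.
have r2 : (B * (c' - d') - e * l) * (b' - a') + (B * (b' - a') - e * l) * (d' - c') =
   - (e * l * (b' - a') + e * l * (d' - c')) by ring.
rewrite /boundary_integral ler_norml; apply/andP.
by split; [rewrite -r2 | rewrite -r1]; exact: lerD.
Qed.

(** Thin columns can be discarded, whatever differentiability fails on them. The horizontal sides
    contribute a bounded integrand times the width; on the vertical sides [q x'] tends to [q x0]
    uniformly on [[c, d]] by compactness, so their difference is small. *)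
Lemma boundary_integral_thin p q a b c d (ab : a <= b) (cd : c <= d)
  (pc : forall x y, a <= x <= b -> c <= y <= d -> continuous2_at p x y)
  (qc : forall x y, a <= x <= b -> c <= y <= d -> continuous2_at q x y) x0 : a <= x0 <= b -> forall e, 0 < e ->
  exists2 t, 0 < t & forall a' b', a <= a' -> a' <= b' -> b' <= b ->
    x0 - t < a' -> b' < x0 + t -> `|boundary_integral p q a' b' c d| <= e.
Proof.
move=> hx0 e e0.
have cI : c <= c <= d by rewrite lexx.
have dI : c <= d <= d by rewrite lexx andbT.
have dc0 : 0 <= d - c by rewrite subr_ge0.
(* Both vertical sides are within [e1] of the column [x0], so together they contribute at most
   [2 * e1 * (d - c) <= e / 2]; the [+ 1] covers [c = d]. *)
pose e1 := e / (2 * (d - c + 1)) / 2.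
have e10 : 0 < e1.
  by rewrite !divr_gt0 // mulr_gt0 // ltr_wpDl.
have [tq tq0 hq] : exists2 t, 0 < t & forall x', `|x' - x0| < t ->
    forall y, c <= y <= d -> `|q x' y - q x0 y| <= e1.
  have := @segment_compact R c d; rewrite compact_near_coveringP => cov.
  have hn : \forall x' \near x0, `[c, d] `<=` (fun y => `|q x' y - q x0 y| <= e1).
    apply: (cov R (nbhs x0) (fun x' y => `|q x' y - q x0 y| <= e1)) => y.
    rewrite /= in_itv /= => ycd; have e120 : 0 < e1 / 2 by rewrite divr_gt0.
    have [t t0 ht] := qc x0 y hx0 ycd _ e120.
    exists (ball y t, ball x0 t); first by split; exact: nbhsx_ballx.
    move=> [y' x'] [/= hy' hx']; rewrite /ball /= in hy' hx'.
    have j1 := ht x' y' ltac:(by rewrite distrC) ltac:(by rewrite distrC).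
    have j2 := ht x0 y' ltac:(by rewrite subrr normr0) ltac:(by rewrite distrC).
    have -> : q x' y' - q x0 y' = (q x' y' - q x0 y) - (q x0 y' - q x0 y) by ring.
    by apply: (le_trans (ler_normB _ _)); move: j1 j2; clear; lra.
  have /nbhs_ballP [t /= t0 ht] := hn.
  exists t => // x' hx' y hy; apply: (ht x').
    by rewrite /ball /= distrC.
  by rewrite /= in_itv.
have [t1 t10 h1] := pc x0 c hx0 cI 1 ltr01.
have [t2 t20 h2] := pc x0 d hx0 dI 1 ltr01.
(* The [2] comes from the tolerance 1 in the continuity of [p] at each of the two end points of the
   column; [t3] below makes [M] times a width [2 * t3] equal to [e / 2]. *)
pose M := `|p x0 c| + `|p x0 d| + 2.
have M0 : 0 < M by rewrite /M; have := normr_ge0 (p x0 c); have := normr_ge0 (p x0 d); clear; lra.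
pose t3 := e / (4 * M); have t30 : 0 < t3 by rewrite divr_gt0 // mulr_gt0.
exists (Num.min (Num.min t1 t2) (Num.min tq t3)).
  by rewrite !lt_min t10 t20 tq0 t30.
move=> a' b' aa ab'' bb; set t := Num.min _ _ => k1 k2.
have tt1 : t <= t1 by rewrite /t !ge_min lexx.
have tt2 : t <= t2 by rewrite /t !ge_min lexx orbT.
have tt3 : t <= tq by rewrite /t !ge_min lexx !orbT.
have tt4 : t <= t3 by rewrite /t !ge_min lexx !orbT.
have nr x' r : a' <= x' <= b' -> t <= r -> `|x' - x0| < r.
  by move=> i ti; rewrite ltr_norml; move: i ti k1 k2; clear; lra.
have P1 x' : a' <= x' <= b' -> `|p x' c - p x' d| <= M.
  move=> hx'; have := h1 x' c (nr _ _ hx' tt1); rewrite subrr normr0 => /(_ t10) j1.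
  have := h2 x' d (nr _ _ hx' tt2); rewrite subrr normr0 => /(_ t20) j2.
  have -> : p x' c - p x' d = (p x' c - p x0 c) - (p x' d - p x0 d) + (p x0 c - p x0 d) by ring.
  apply: (le_trans (ler_normD _ _)).
  have := ler_normB (p x0 c) (p x0 d); have := ler_normB (p x' c - p x0 c) (p x' d - p x0 d).
  by rewrite /M; move: j1 j2; clear; lra.
have Q1 y : c <= y <= d -> `|q b' y - q a' y| <= 2 * e1.
  move=> hy.
  have j1 := hq b' (nr b' tq ltac:(by rewrite lexx ab'') tt3) y hy.
  have j2 := hq a' (nr a' tq ltac:(by rewrite lexx) tt3) y hy.
  have -> : q b' y - q a' y = (q b' y - q x0 y) - (q a' y - q x0 y) by ring.
  by apply: (le_trans (ler_normB _ _)); move: j1 j2; clear; lra.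
have cp : {within `[a', b'], continuous (fun x => p x c - p x d)}.
  exact: (row_diff_continuous p a b c d pc).
have cq : {within `[c, d], continuous (fun y => q b' y - q a' y)}.
  by apply: (column_diff_continuous q a b c d qc) => //; move: aa ab'' bb; clear; lra.
have u1 : \int[mu]_(x in `[a', b']) (p x c - p x d) <= M * (b' - a').
  apply: Rintegral_segment_le => // x' /P1; rewrite ler_norml; clear; lra.
have u2 : - M * (b' - a') <= \int[mu]_(x in `[a', b']) (p x c - p x d).
  apply: Rintegral_segment_ge => // x' /P1; rewrite ler_norml; clear; lra.
have v1 : \int[mu]_(y in `[c, d]) (q b' y - q a' y) <= 2 * e1 * (d - c).
  apply: Rintegral_segment_le => // x' /Q1; rewrite ler_norml; clear; lra.
have v2 : - (2 * e1) * (d - c) <= \int[mu]_(y in `[c, d]) (q b' y - q a' y).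
  apply: Rintegral_segment_ge => // x' /Q1; rewrite ler_norml; clear; lra.
have w1 : M * (b' - a') <= e / 2.
  have : M * (b' - a') <= M * (2 * t3) by apply: ler_wpM2l; [exact: ltW | move: k1 k2 tt4; clear; lra].
  have -> : M * (2 * t3) = e / 2 by rewrite /t3; move: M0; clear => M0; field; rewrite gt_eqF.
  by [].
have w2 : 2 * e1 * (d - c) <= e / 2.
  have : 2 * e1 * (d - c) <= 2 * e1 * (d - c + 1).
    by apply: ler_wpM2l; [rewrite mulr_ge0 // ltW | rewrite lerDl].
  have -> : 2 * e1 * (d - c + 1) = e / 2 by rewrite /e1; move: dc0; clear => dc0; field; rewrite gt_eqF // ltr_wpDl.
  by [].
rewrite /boundary_integral ler_norml.
move: u1 u2 v1 v2 w1 w2; rewrite !mulNr.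
set X := Rintegral _ _ _; set Y := Rintegral _ _ _ => u1 u2 v1 v2 w1 w2.
by move: u1 u2 v1 v2 w1 w2; clear; lra.
Qed.

Lemma green_closed_form p q a b c d : a <= b -> c <= d ->
  (forall x y, a <= x <= b -> c <= y <= d -> continuous2_at p x y) ->
  (forall x y, a <= x <= b -> c <= y <= d -> continuous2_at q x y) ->
  (forall x y, a <= x <= b -> c <= y <= d -> closed_form_at p q x y) ->
  boundary_integral p q a b c d = 0.
Proof.
move=> ab cd pc qc hpq.
apply: (@additive_rectangle_eq0 R (boundary_integral p q)) => //.
- by move=> *; apply: boundary_integral_addx pc qc _ _ _ _ _ _ _ _ _ _ _ _.
- by move=> *; apply: boundary_integral_addy pc qc _ _ _ _ _ _ _ _ _ _ _ _.
- move=> x y hx hy; apply: (boundary_integral_closed_small _ _ _ _ _ _ pc qc).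
  exact: hpq.
Qed.

(** Differentiability is required only strictly between the vertical sides: two thin columns along
    them contribute at most [2 * e], and the middle part vanishes by [green_closed_form]. *)
Lemma green_closed_form_inside p q a b c d : a <= b -> c <= d ->
  (forall x y, a <= x <= b -> c <= y <= d -> continuous2_at p x y) ->
  (forall x y, a <= x <= b -> c <= y <= d -> continuous2_at q x y) ->
  (forall x y, a < x < b -> c <= y <= d -> closed_form_at p q x y) ->
  boundary_integral p q a b c d = 0.
Proof.
move=> ab cd pc qc hpq.
suff : `|boundary_integral p q a b c d| <= 0 by rewrite normr_le0 => /eqP.
apply: (@le0_of_le_eps _ _ 2) => e e0.
have aI : a <= a <= b by rewrite lexx.
have bI : a <= b <= b by rewrite lexx ab.
have [t1 t10 h1] := boundary_integral_thin p q a b c d ab cd pc qc a aI e e0.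
have [t2 t20 h2] := boundary_integral_thin p q a b c d ab cd pc qc b bI e e0.
have [eq|ne] := eqVneq a b.
  have l1 : a - t1 < a by rewrite ltrBlDr ltrDl.
  have l2 : b < a + t1 by rewrite -eq ltrDl.
  by have := h1 a b (lexx _) ab (lexx _) l1 l2; move: e0; clear; lra.
have ltab : a < b by rewrite lt_def eq_sym ne.
pose s := Num.min (Num.min t1 t2) (b - a) / 3.
have [s0 s1 s2 s3] : [/\ 0 < s, s < t1, s < t2 & 3 * s <= b - a].
  have m0 : 0 < Num.min (Num.min t1 t2) (b - a) by rewrite !lt_min t10 t20 subr_gt0.
  have m1 : Num.min (Num.min t1 t2) (b - a) <= t1 by rewrite !ge_min lexx.
  have m2 : Num.min (Num.min t1 t2) (b - a) <= t2 by rewrite !ge_min lexx orbT.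
  have m3 : Num.min (Num.min t1 t2) (b - a) <= b - a by rewrite !ge_min lexx !orbT.
  by rewrite /s; move: m0 m1 m2 m3; clear => *; split; lra.
have [g1 g2 g3 g4] : [/\ a <= a + s, a + s <= b - s, b - s <= b & a + s <= b].
  by move: s0 s3; clear => *; split; lra.
have add := boundary_integral_addx p q a b c d pc qc.
rewrite (add a (a + s) b c d) // (add (a + s) (b - s) b c d) //.
have -> : boundary_integral p q (a + s) (b - s) c d = 0.
  have wide x : a + s <= x <= b - s -> a <= x <= b by move: g1 g3; clear; lra.
  apply: green_closed_form => // x y hx hy; [exact: pc (wide x hx) hy | exact: qc (wide x hx) hy | ].
  by apply: hpq => //; move: hx s0; clear; lra.
rewrite add0r; apply: (le_trans (ler_normD _ _)).
have i1 : `|boundary_integral p q a (a + s) c d| <= e.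
  by apply: h1 => //; [rewrite ltrBlDr ltrDl | rewrite ltrD2l].
have i2 : `|boundary_integral p q (b - s) b c d| <= e.
  by apply: h2 => //; [apply: le_trans g1 g2 | rewrite ltrD2l ltrN2 | rewrite ltrDl].
by move: i1 i2; clear; lra.
Qed.

(** Cutting at an exceptional abscissa turns it into a vertical side of both pieces, where
    [green_closed_form_inside] needs only continuity. [X] will contain the abscissa of the point
    where a difference quotient is filled in. *)
Lemma green_closed_form_off_columns p q a b c d (X : seq R) : a <= b -> c <= d ->
  (forall x y, a <= x <= b -> c <= y <= d -> continuous2_at p x y) ->
  (forall x y, a <= x <= b -> c <= y <= d -> continuous2_at q x y) ->
  (forall x y, a < x < b -> c <= y <= d -> x \notin X -> closed_form_at p q x y) ->
  boundary_integral p q a b c d = 0.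
Proof.
elim: X a b => [|x0 X IH] a b ab cd pc qc hpq.
  by apply: green_closed_form_inside => // x y hx hy; exact: hpq.
have [/andP[ax xb]|out] := boolP (a < x0 < b); last first.
  apply: IH => // x y hx hy xX; apply: hpq => //.
  by rewrite inE negb_or xX andbT; apply: contraNneq out => <-.
have [axw xbw] := (ltW ax, ltW xb).
rewrite (boundary_integral_addx p q a b c d pc qc a x0 b c d) //.
have wl x : a <= x <= x0 -> a <= x <= b by move: xbw; clear; lra.
have wr x : x0 <= x <= b -> a <= x <= b by move: axw; clear; lra.
rewrite !IH ?addr0 //.
- by move=> x y hx; apply/pc/wr.
- by move=> x y hx; apply/qc/wr.
- move=> x y hx hy xX; apply: hpq => //; first by move: hx axw; clear; lra.
  by rewrite inE negb_or xX andbT gt_eqF //; case/andP: hx.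
- by move=> x y hx; apply/pc/wl.
- by move=> x y hx; apply/qc/wl.
- move=> x y hx hy xX; apply: hpq => //; first by move: hx xbw; clear; lra.
  by rewrite inE negb_or xX andbT lt_eqF //; case/andP: hx.
Qed.

End green.

(** * Cauchy estimates for complex differentiable functions *)

Section complex_norm.
Variable R : realType.
Local Notation C := R[i].
Local Notation nc := (@Normc.normc R).
Implicit Types (z w : C) (f g : C -> C).

Lemma normc_ge0 z : 0 <= nc z.
Proof. by case: z => a b; exact: sqrtr_ge0. Qed.

Lemma normc_sqr z : nc z ^+ 2 = normsq z.
Proof. by case: z => a b; rewrite sqr_sqrtr // addr_ge0 ?sqr_ge0. Qed.

Lemma normc_eq0 z : (nc z == 0) = (z == 0).
Proof. by apply/eqP/eqP => [/Normc.eq0_normc //|->]; exact: Normc.normc0. Qed.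

Lemma normc_gt0 z : (0 < nc z) = (z != 0).
Proof. by rewrite lt_def normc_ge0 andbT normc_eq0. Qed.

Lemma normCE z : `|z| = (nc z)%:C%C.
Proof. by case: z. Qed.

Lemma normcD z w : nc (z + w) <= nc z + nc w.
Proof. exact: le_normcD. Qed.

Lemma normcB z w : nc (z - w) <= nc z + nc w.
Proof. by rewrite -(normcN w); exact: normcD. Qed.

Lemma normc_distC z w : nc (z - w) = nc (w - z).
Proof. by rewrite -normcN opprB. Qed.

Lemma normcM z w : nc (z * w) = nc z * nc w.
Proof. exact: Normc.normcM. Qed.

Lemma normcV z : nc z^-1 = (nc z)^-1.
Proof. exact: Normc.normcV. Qed.

Lemma Re_add z w : complex.Re (z + w) = complex.Re z + complex.Re w.
Proof. by case: z; case: w. Qed.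
Lemma Im_add z w : complex.Im (z + w) = complex.Im z + complex.Im w.
Proof. by case: z; case: w. Qed.
Lemma Re_sub z w : complex.Re (z - w) = complex.Re z - complex.Re w.
Proof. by case: z; case: w. Qed.
Lemma Im_sub z w : complex.Im (z - w) = complex.Im z - complex.Im w.
Proof. by case: z; case: w. Qed.
Lemma Re_mul z w : complex.Re (z * w) =
  complex.Re z * complex.Re w - complex.Im z * complex.Im w.
Proof. by case: z; case: w. Qed.
Lemma Im_mul z w : complex.Im (z * w) =
  complex.Re z * complex.Im w + complex.Im z * complex.Re w.
Proof. by case: z; case: w. Qed.

Lemma abs_Re_le z : `|complex.Re z| <= nc z.
Proof. by case: z => a b /=; rewrite -sqrtr_sqr ler_wsqrtr // lerDl sqr_ge0. Qed.
Lemma abs_Im_le z : `|complex.Im z| <= nc z.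
Proof. by case: z => a b /=; rewrite -sqrtr_sqr ler_wsqrtr // lerDr sqr_ge0. Qed.

Lemma normc_le_ReIm z : nc z <= `|complex.Re z| + `|complex.Im z|.
Proof.
case: z => a b /=; rewrite -(@ler_pXn2r _ 2) ?nnegrE ?sqrtr_ge0 ?addr_ge0 //.
rewrite sqr_sqrtr ?addr_ge0 ?sqr_ge0 // sqrrD !real_normK ?num_real //.
by rewrite -addrA [_ *+ 2 + _]addrC addrA lerDl mulrn_wge0 // mulr_ge0.
Qed.

Lemma posC_real (e : C) : 0 < e -> e = (complex.Re e)%:C%C /\ 0 < complex.Re e.
Proof. by case: e => a b; rewrite ltcE /= => /andP[/eqP -> ?]. Qed.

(** The norm of [R[i]] is itself [R[i]]-valued; with [nc] and real tolerances all estimates stay in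
    [R]. *)
Definition ccontinuous_at f z := forall e : R, 0 < e -> exists2 t : R, 0 < t &
  forall w, nc (w - z) < t -> nc (f w - f z) <= e.

Definition cderivative_at f z l := forall e : R, 0 < e -> exists2 t : R, 0 < t &
  forall w, nc (w - z) < t -> nc (f w - f z - l * (w - z)) <= e * nc (w - z).

Lemma nbhsC_ball (P : C -> Prop) z :
  (\forall w \near (z : C^o), P w) <-> exists2 t : R, 0 < t & forall w, nc (w - z) < t -> P w.
Proof.
split.
  move=> /nbhs_ballP [t /= /posC_real [-> t0] ht]; exists (complex.Re t) => // w hw.
  by apply: ht; rewrite /ball /= normCE ltcR normc_distC.
move=> [t t0 ht]; apply/nbhs_ballP; exists (t%:C%C); first by rewrite /= ltcR.
by move=> w; rewrite /ball /= normCE ltcR normc_distC; exact: ht.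
Qed.

Lemma continuousC_eps f z : {for z, continuous (f : C^o -> C^o)} <-> ccontinuous_at f z.
Proof.
split=> [cf e e0|h].
  have ec0 : (0 : C) < e%:C%C by rewrite ltcR.
  move/cvgrPdist_le: cf => /(_ _ ec0) /nbhsC_ball [t t0 ht]; exists t => // w /ht.
  by rewrite normCE lecR normc_distC.
have FF : Filter (nbhs (z : C^o)) by apply: nbhs_filter.
apply/(@cvgrPdist_le _ C^o C^o (nbhs (z : C^o)) FF) => e /posC_real [-> e0].
have [t t0 ht] := h _ e0; apply/nbhsC_ball; exists t => // w /ht.
by rewrite normCE lecR normc_distC.
Qed.

Lemma derivableC_eps f z :
  derivable (f : C^o -> C^o) z 1 <-> exists l, cderivative_at f z l.
Proof.
split.
  move=> /cvg_ex [/= l hl]; exists l => e e0.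
  have ec0 : (0 : C) < e%:C%C by rewrite ltcR.
  move/cvgrPdist_le: hl => /(_ _ ec0); rewrite near_withinE.
  move=> /(nbhsC_ball _ 0) [t t0 ht]; exists t => // w hw.
  have [->|wz] := eqVneq w z.
    by rewrite !subrr mulr0 subrr Normc.normc0 mulr0.
  have wz0 : w - z != 0 by rewrite subr_eq0.
  have := ht (w - z); rewrite subr0 => /(_ hw wz0).
  rewrite /= [(w - z) *: 1]mulr1 subrK normCE lecR.
  have -> : f w - f z - l * (w - z) = - ((l - (w - z)^-1 *: (f w - f z)) * (w - z)).
    by rewrite mulrBl [_ *: _]/(_ * _) mulrAC mulVf // mul1r opprB.
  rewrite normcN normcM => h; apply: ler_wpM2r => //; exact: normc_ge0.
move=> [l hl]; apply/cvg_ex; exists l.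
apply/cvgrPdist_le => e /posC_real [-> e0].
have [t t0 ht] := hl _ e0; rewrite near_withinE; apply/(nbhsC_ball _ 0).
exists t => // h; rewrite subr0 => ht' h0 /=.
rewrite [h *: 1]mulr1 normCE lecR.
have := ht (h + z); rewrite addrK => /(_ ht').
have -> : l - h^-1 *: (f (h + z) - f z) = - (h^-1 * (f (h + z) - f z - l * h)).
  by rewrite [_ *: _]/(_ * _) mulrBr [_ * (l * h)]mulrCA mulVf // mulr1 opprB.
rewrite normcN normcM normcV => k; rewrite ler_pdivrMl ?normc_gt0 //.
by rewrite [nc h * _]mulrC.
Qed.

Lemma derivableC_continuous f z : derivable (f : C^o -> C^o) z 1 ->
  {for z, continuous (f : C^o -> C^o)}.
Proof. by move=> /derivable1_diffP /differentiable_continuous. Qed.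

Lemma complex_cauchy_cvg (s : nat -> C) :
  (forall e : R, 0 < e -> exists n0, forall m n, (n0 <= m)%N -> (n0 <= n)%N ->
     nc (s m - s n) <= e) ->
  exists l, forall e : R, 0 < e -> exists n0, forall n, (n0 <= n)%N -> nc (s n - l) <= e.
Proof.
move=> hs.
have real (u : nat -> R) : (forall e : R, 0 < e -> exists n0, forall m n,
     (n0 <= m)%N -> (n0 <= n)%N -> `|u m - u n| <= e) ->
  exists l, forall e : R, 0 < e -> exists n0, forall n, (n0 <= n)%N -> `|u n - l| <= e.
  move=> hu.
  have : cvg (u @ \oo).
    apply/cauchy_cvgP/cauchy_ballP => e e0.
    have e20 : 0 < e / 2 by rewrite divr_gt0.
    have [n0 hn] := hu _ e20.
    exists (u @` [set n | (n0 <= n)%N], u @` [set n | (n0 <= n)%N]).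
      by split; exists n0 => // n /= ?; exists n.
    move=> [_ _] [/= [m hm <-] [n hn' <-]]; apply: (le_lt_trans (hn _ _ hm hn')).
    by move: e0; clear; lra.
  move=> /cvg_ex [/= l hl]; exists l => e e0.
  move/cvgrPdist_le: hl => /(_ e e0) [n0 _ h]; exists n0 => n /h /=.
  by rewrite distrC.
have [|x hx] := real (fun n => complex.Re (s n)).
  move=> e /hs [n0 hn]; exists n0 => m n hm hn'; rewrite -Re_sub.
  by apply: (le_trans (abs_Re_le _)); exact: hn.
have [|y hy] := real (fun n => complex.Im (s n)).
  move=> e /hs [n0 hn]; exists n0 => m n hm hn'; rewrite -Im_sub.
  by apply: (le_trans (abs_Im_le _)); exact: hn.
exists (Complex x y) => e e0; have e20 : 0 < e / 2 by rewrite divr_gt0.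
have [n1 h1] := hx _ e20; have [n2 h2] := hy _ e20.
exists (maxn n1 n2) => n; rewrite geq_max => /andP[/h1 k1 /h2 k2].
apply: (le_trans (normc_le_ReIm _)); rewrite Re_sub Im_sub /=.
by move: k1 k2; clear; lra.
Qed.

End complex_norm.

(** * Goursat's theorem on rectangles *)

Section goursat.
Variable R : realType.
Local Notation C := R[i].
Local Notation nc := (@Normc.normc R).
Local Notation mu := (@lebesgue_measure R).

(** [Im k dx + Re k dy] is the imaginary part of [k dz], the one that detects the residue of
    [1 / (z - w)]. It is closed by a Cauchy-Riemann equation: dp/dy and dq/dx are both the real part
    of the derivative [l]. *)
Lemma goursat_rectangle (k : C -> C) (a b c d : R) (X : seq R) : a <= b -> c <= d ->
  (forall x y, a <= x <= b -> c <= y <= d -> ccontinuous_at R k (Complex x y)) ->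
  (forall x y, a < x < b -> c <= y <= d -> x \notin X ->
     derivable (k : C^o -> C^o) (Complex x y) 1) ->
  boundary_integral R (fun x y => complex.Im (k (Complex x y)))
    (fun x y => complex.Re (k (Complex x y))) a b c d = 0.
Proof.
move=> ab cd ck dk.
have dist (x x' y y' t : R) : `|x' - x| < t / 2 -> `|y' - y| < t / 2 ->
    nc (Complex x' y' - Complex x y) < t.
  move=> h1 h2; apply: (le_lt_trans (normc_le_ReIm _ _)) => /=.
  by move: h1 h2; clear; lra.
apply: (green_closed_form_off_columns _ _ _ _ _ _ _ X) => //.
- move=> x y hx hy e e0; have [t t0 ht] := ck x y hx hy e e0.
  exists (t / 2); first by rewrite divr_gt0.
  move=> x' y' h1 h2; rewrite -Im_sub; apply: (le_trans (abs_Im_le _ _)).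
  by apply/ht/dist.
- move=> x y hx hy e e0; have [t t0 ht] := ck x y hx hy e e0.
  exists (t / 2); first by rewrite divr_gt0.
  move=> x' y' h1 h2; rewrite -Re_sub; apply: (le_trans (abs_Re_le _ _)).
  by apply/ht/dist.
- move=> x y hx hy xX.
  have /derivableC_eps [l hl] := dk x y hx hy xX.
  exists (complex.Im l), (complex.Re l), (- complex.Im l) => e e0.
  have [t t0 ht] := hl e e0.
  exists (t / 2); first by rewrite divr_gt0.
  move=> x' y' h1 h2.
  have h3 := ht (Complex x' y') (dist _ _ _ _ _ h1 h2).
  have h4 : e * nc (Complex x' y' - Complex x y) <= e * (`|x' - x| + `|y' - y|).
    by apply: ler_wpM2l; [exact: ltW | exact: normc_le_ReIm].
  have h5 := le_trans h3 h4.
  split; apply: (le_trans _ h5).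
    apply: (le_trans _ (abs_Im_le _ _)); rewrite !Im_sub Im_mul /=.
    by rewrite le_eqVlt; apply/orP; left; apply/eqP; congr (`|_|); ring.
  apply: (le_trans _ (abs_Re_le _ _)); rewrite !Re_sub Re_mul /=.
  by rewrite le_eqVlt; apply/orP; left; apply/eqP; congr (`|_|); ring.
Qed.

(** For such [z], [|z|^2 <= 8 r^2], so [Re (A / z) = A Re z / |z|^2 >= A / (8 r)]. Here [z] is a
    boundary point relative to the centre, rotated so that its side becomes the right one. *)
Lemma Re_quotient_le (v z : C) (A r : R) : 0 < r -> 0 <= A ->
  r <= complex.Re z <= 2 * r -> `|complex.Im z| <= 2 * r ->
  complex.Re ((v - A%:C%C) / z) <= nc v / r - A / (8 * r).
Proof.
move=> r0 A0 /andP[rz zr] zi.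
have tz : r <= nc z by apply: (le_trans rz); apply: (le_trans (ler_norm _)); exact: abs_Re_le.
have z0 : 0 < nc z by apply: lt_le_trans tz.
have -> : (v - A%:C%C) / z = v / z - A%:C%C / z by rewrite mulrBl.
rewrite Re_sub; apply: lerB.
  apply: (le_trans (ler_norm _)); apply: (le_trans (abs_Re_le _ _)).
  rewrite normcM normcV; apply: ler_wpM2l; first exact: normc_ge0.
  by rewrite lef_pV2.
have z20 : 0 < nc z ^+ 2 by rewrite exprn_gt0.
have zsq : nc z ^+ 2 <= 8 * r ^+ 2.
  rewrite normc_sqr /normsq -(real_normK (num_real (complex.Im z))).
  have : `|complex.Im z| ^+ 2 <= (2 * r) ^+ 2.
    by rewrite ler_pXn2r ?nnegrE // mulr_ge0 // ltW.
  have : complex.Re z ^+ 2 <= (2 * r) ^+ 2.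
    rewrite ler_pXn2r ?nnegrE //; first by apply: le_trans rz; exact: ltW.
    by rewrite mulr_ge0 // ltW.
  by clear; lra.
have -> : complex.Re (A%:C%C / z) = A * (complex.Re z / nc z ^+ 2).
  rewrite normc_sqr /normsq; case: z {rz zr zi tz z0 zsq z20} => x y.
  by rewrite Re_mul /= mul0r subr0.
apply: ler_wpM2l => //.
have -> : (8 * r)^-1 = r / (8 * r ^+ 2) by field; rewrite gt_eqF.
apply: ler_pM => //; [exact: ltW | by rewrite invr_ge0 mulr_ge0 // sqr_ge0 | ].
by rewrite lef_pV2 // posrE // mulr_gt0 // exprn_gt0.
Qed.

End goursat.

(** * Difference quotients and Cauchy's estimate on a rectangle *)

Section cauchy.
Variable R : realType.
Local Notation C := R[i].
Local Notation nc := (@Normc.normc R).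
Local Notation mu := (@lebesgue_measure R).

Lemma ccontinuous_at_near (f g : C -> C) (z : C) (r : R) : 0 < r ->
  (forall w, nc (w - z) < r -> f w = g w) -> ccontinuous_at R g z -> ccontinuous_at R f z.
Proof.
move=> r0 fg cg e e0; have [t t0 ht] := cg e e0.
exists (Num.min r t); first by rewrite lt_min r0.
move=> w; rewrite lt_min => /andP[/fg -> /ht].
by rewrite fg // subrr Normc.normc0.
Qed.

Lemma derivable_near (f g : C -> C) (z : C) (r : R) : 0 < r ->
  (forall w, nc (w - z) < r -> f w = g w) ->
  derivable (g : C^o -> C^o) z 1 -> derivable (f : C^o -> C^o) z 1.
Proof.
move=> r0 fg /derivableC_eps [l hl]; apply/derivableC_eps; exists l => e e0.
have [t t0 ht] := hl e e0; exists (Num.min r t); first by rewrite lt_min r0.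
move=> w; rewrite lt_min => /andP[/fg -> /ht].
by rewrite fg // subrr Normc.normc0.
Qed.

Lemma ccontinuousM (f g : C -> C) z : ccontinuous_at R f z -> ccontinuous_at R g z ->
  ccontinuous_at R (fun w => f w * g w) z.
Proof.
move=> /continuousC_eps cf /continuousC_eps cg; apply/continuousC_eps.
exact: (@cvgM _ C^o (nbhs (z : C^o)) (nbhs_filter (z : C^o)) f g _ _ cf cg).
Qed.

Lemma ccontinuousB (f g : C -> C) z : ccontinuous_at R f z -> ccontinuous_at R g z ->
  ccontinuous_at R (fun w => f w - g w) z.
Proof.
move=> /continuousC_eps cf /continuousC_eps cg; apply/continuousC_eps.
exact: (@cvgB _ C^o C^o (nbhs (z : C^o)) (nbhs_filter (z : C^o)) f g _ _ cf cg).
Qed.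

Lemma derivable_ccontinuous (f : C -> C) z : derivable (f : C^o -> C^o) z 1 ->
  ccontinuous_at R f z.
Proof. by move=> /derivableC_continuous /continuousC_eps. Qed.

Lemma derivable_inv_shift (w z : C) : z != w ->
  derivable ((fun s => (s - w)^-1) : C^o -> C^o) z 1.
Proof.
move=> zw; apply: (@derivableV _ C^o); first by rewrite subr_eq0.
by apply: (@derivableB _ C^o C^o); [exact: derivable_id | exact: derivable_cst].
Qed.

Lemma derivableC_sub (f g : C -> C) z : derivable (f : C^o -> C^o) z 1 ->
  derivable (g : C^o -> C^o) z 1 -> derivable ((fun s => f s - g s) : C^o -> C^o) z 1.
Proof. exact: (@derivableB _ C^o C^o). Qed.

Lemma derivableC_mul (f g : C -> C) z : derivable (f : C^o -> C^o) z 1 ->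
  derivable (g : C^o -> C^o) z 1 -> derivable ((fun s => f s * g s) : C^o -> C^o) z 1.
Proof. exact: (@derivableM _ C^o). Qed.

Lemma derivableC_cst (c z : C) : derivable ((fun=> c) : C^o -> C^o) z 1.
Proof. exact: (@derivable_cst _ C^o C^o). Qed.

(** When [l] is the derivative at [w], filling in [l] makes the quotient continuous at [w]; this is
    enough for Goursat's theorem with the column of [w] exceptional. *)
Definition dquot (f : C -> C) (w l z : C) : C :=
  if z == w then l else (f z - f w) / (z - w).

Lemma dquot_near (f : C -> C) w l z : z != w -> forall s, nc (s - z) < nc (z - w) ->
  dquot f w l s = (f s - f w) * (s - w)^-1.
Proof.
move=> zw s; rewrite /dquot; case: eqVneq => [->|//].
by rewrite normc_distC ltxx.
Qed.

Lemma dquot_ccontinuous (f : C -> C) w l z : cderivative_at R f w l ->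
  ccontinuous_at R f z -> ccontinuous_at R (dquot f w l) z.
Proof.
move=> hl cf; have [->|zw] := eqVneq z w.
  move=> e e0; have [t t0 ht] := hl e e0; exists t => // s /ht.
  rewrite /dquot eqxx; case: eqVneq => [-> _|sw].
    by rewrite subrr Normc.normc0 ltW.
  have sw0 : s - w != 0 by rewrite subr_eq0.
  have -> : f s - f w - l * (s - w) = ((f s - f w) / (s - w) - l) * (s - w).
    by rewrite mulrBl mulfVK.
  by rewrite normcM ler_pM2r // normc_gt0.
apply: (ccontinuous_at_near _ _ _ _ _ (dquot_near f w l z zw)).
  by rewrite normc_gt0 subr_eq0.
apply: ccontinuousM; last exact/derivable_ccontinuous/derivable_inv_shift.
by apply: ccontinuousB => //; exact/derivable_ccontinuous/derivableC_cst.
Qed.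

Lemma dquot_derivable (f : C -> C) w l z : z != w ->
  derivable (f : C^o -> C^o) z 1 -> derivable (dquot f w l : C^o -> C^o) z 1.
Proof.
move=> zw df; apply: (derivable_near _ _ _ _ _ (dquot_near f w l z zw)).
  by rewrite normc_gt0 subr_eq0.
apply: (derivableC_mul (fun s => f s - f w) (fun s => (s - w)^-1)).
  exact: (derivableC_sub f (fun=> f w) z df (derivableC_cst (f w) z)).
exact: derivable_inv_shift.
Qed.

(** A 1-Lipschitz [phi] covers the real part, the imaginary part and the modulus at once. *)
Lemma row_within_continuous (phi : C -> R) (g : C -> C) (y a b : R) :
  (forall z w, `|phi z - phi w| <= nc (z - w)) ->
  (forall x, a <= x <= b -> ccontinuous_at R g (Complex x y)) ->
  {within `[a, b], continuous (fun x => phi (g (Complex x y)))}.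
Proof.
move=> lip cg; apply: within_continuous_eps => x hx e e0.
have [t t0 ht] := cg x hx e e0; exists t => // x' hx'.
apply: (le_trans (lip _ _)); apply: ht; apply: (le_lt_trans (normc_le_ReIm _ _)).
by rewrite /= subrr normr0 addr0.
Qed.

Lemma column_within_continuous (phi : C -> R) (g : C -> C) (x a b : R) :
  (forall z w, `|phi z - phi w| <= nc (z - w)) ->
  (forall y, a <= y <= b -> ccontinuous_at R g (Complex x y)) ->
  {within `[a, b], continuous (fun y => phi (g (Complex x y)))}.
Proof.
move=> lip cg; apply: within_continuous_eps => y hy e e0.
have [t t0 ht] := cg y hy e e0; exists t => // y' hy'.
apply: (le_trans (lip _ _)); apply: ht; apply: (le_lt_trans (normc_le_ReIm _ _)).
by rewrite /= subrr normr0 add0r.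
Qed.

Lemma Re_lipschitz z w : `|complex.Re z - complex.Re w| <= nc (z - w).
Proof. by rewrite -Re_sub; exact: abs_Re_le. Qed.
Lemma Im_lipschitz z w : `|complex.Im z - complex.Im w| <= nc (z - w).
Proof. by rewrite -Im_sub; exact: abs_Im_le. Qed.
Lemma normc_lipschitz z w : `|nc z - nc w| <= nc (z - w).
Proof.
rewrite ler_norml; apply/andP; split.
  rewrite lerNl opprB lerBlDr normc_distC; apply: (le_trans _ (normcD _ _ _)).
  by rewrite subrK.
by rewrite lerBlDr; apply: (le_trans _ (normcD _ _ _)); rewrite subrK.
Qed.

Lemma Rintegral_segment_affine (g : R -> R) (a b c1 c2 : R) : a <= b ->
  {within `[a, b], continuous g} ->
  \int[mu]_(s in `[a, b]) (c1 * g s + c2) = c1 * \int[mu]_(s in `[a, b]) g s + c2 * (b - a)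
  /\ mu.-integrable `[a, b] (EFin \o (fun s => c1 * g s + c2)).
Proof.
move=> ab cg; have ig := segment_integrable _ _ _ _ cg.
have i1 : mu.-integrable `[a, b] (EFin \o (fun s => c1 * g s)).
  by rewrite (_ : _ \o _ = (fun s => c1%:E * (EFin \o g) s)%E) //; exact: integrableZl.
have i2 : mu.-integrable `[a, b] (EFin \o (fun s : R => c2)).
  by apply: segment_integrable; apply: continuous_subspaceT => x; exact: cvg_cst.
split; first by rewrite RintegralD // RintegralZl // Rintegral_cst // fine_lebesgue_segment.
by rewrite (_ : _ \o _ = ((EFin \o (fun s => (c1 * g s)%R)) \+ (EFin \o (fun s : R => c2)))%E) //;
  exact: integrableD.
Qed.

(** Integrates the bound of [Re_quotient_le] along one side: its length is at least [2 * r], so the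
    term [A / (8 * r)] yields at least [A / 4], and four sides yield [A]. *)
Lemma edge_le (h g : R -> R) (a b r A : R) : 0 < r -> 0 <= A -> 2 * r <= b - a ->
  {within `[a, b], continuous h} -> {within `[a, b], continuous g} ->
  (forall s, a <= s <= b -> h s <= g s / r - A / (8 * r)) ->
  \int[mu]_(s in `[a, b]) h s <= r^-1 * \int[mu]_(s in `[a, b]) g s - A / 4.
Proof.
move=> r0 A0 rab ch cg hg.
have ab : a <= b by move: r0 rab; clear; lra.
have [e i] := Rintegral_segment_affine g _ _ r^-1 (- (A / (8 * r))) ab cg.
have h1 : \int[mu]_(s in `[a, b]) h s <= \int[mu]_(s in `[a, b]) (r^-1 * g s + - (A / (8 * r))).
  apply: le_Rintegral => //; first exact: segment_integrable.
  by move=> s; rewrite /= in_itv /= => /hg; rewrite [g s / r]mulrC.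
apply: (le_trans h1); rewrite e; apply: lerD => //.
rewrite mulNr lerN2 (_ : A / 4 = A / (8 * r) * (2 * r)); last by field; rewrite gt_eqF.
by apply: ler_wpM2l => //; apply: divr_ge0 => //; rewrite mulr_ge0 // ltW.
Qed.

Lemma edge_ge (h g : R -> R) (a b r A : R) : 0 < r -> 0 <= A -> 2 * r <= b - a ->
  {within `[a, b], continuous h} -> {within `[a, b], continuous g} ->
  (forall s, a <= s <= b -> - h s <= g s / r - A / (8 * r)) ->
  - (\int[mu]_(s in `[a, b]) h s) <= r^-1 * \int[mu]_(s in `[a, b]) g s - A / 4.
Proof.
move=> r0 A0 rab ch cg hg.
have -> : - (\int[mu]_(s in `[a, b]) h s) = \int[mu]_(s in `[a, b]) (- h s).
  rewrite -[LHS]mulN1r -RintegralZl //; last exact: segment_integrable.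
  by apply: eq_Rintegral => s _; rewrite mulN1r.
apply: edge_le => //.
by move=> x; apply: (@cvgN _ R); exact: ch.
Qed.

(** Multiplying [z] by [i] or [-i] turns the bottom or the top side into the right one, and turns
    the imaginary part integrated along it into a real part, as [Re_quotient_le] requires. *)
Lemma Re_div_i (b z : C) :
  complex.Re (b / ('i%C * z)) = complex.Im (b / z).
Proof.
have -> : b / ('i%C * z) = (b / z) * ('i%C)^-1 by rewrite invfM mulrA mulrAC.
case: (b / z) => p q /=.
by rewrite expr0n /= expr1n add0r !divr1 mulr0 mulrN mulr1 opprK add0r.
Qed.
Lemma Re_div_Ni (b z : C) :
  complex.Re (b / (- 'i%C * z)) = - complex.Im (b / z).
Proof. 
rewrite mulNr invrN mulrN -Re_div_i. by case: (b / _).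
Qed.

(* Cauchy's formula on a rectangle around [Complex x0 y0], as a bound. *)
Lemma cauchy_rectangle (F : C -> C) (x0 y0 r a b c d : R) (X : seq R) : 0 < r ->
  x0 - 2 * r <= a <= x0 - r -> x0 + r <= b <= x0 + 2 * r ->
  y0 - 2 * r <= c <= y0 - r -> y0 + r <= d <= y0 + 2 * r ->
  (forall x y, a <= x <= b -> c <= y <= d -> ccontinuous_at R F (Complex x y)) ->
  (forall x y, a <= x <= b -> c <= y <= d -> x \notin X ->
     derivable (F : C^o -> C^o) (Complex x y) 1) ->
  derivable (F : C^o -> C^o) (Complex x0 y0) 1 ->
  r * nc (F (Complex x0 y0)) <=
    \int[mu]_(x in `[a, b]) nc (F (Complex x c)) +
    \int[mu]_(x in `[a, b]) nc (F (Complex x d)) +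
    (\int[mu]_(y in `[c, d]) nc (F (Complex b y)) +
    \int[mu]_(y in `[c, d]) nc (F (Complex a y))).
Proof.
move=> r0 ha hb hc hd cF dF /derivableC_eps [l hl]; set w := Complex x0 y0.
pose A := nc (F w); have A0 : 0 <= A by exact: normc_ge0.
(* A unimodular factor rotates the value at the centre onto its modulus. *)
have [u [nu uF]] : exists u : C, nc u = 1 /\ u * F w = A%:C%C.
  have [F0|F0] := eqVneq (F w) 0.
    by exists 1; rewrite Normc.normc1 /A F0 mulr0 Normc.normc0.
  exists (A%:C%C / F w); rewrite mulfVK //; split=> //.
  rewrite normcM normcV -/A /= expr0n addr0 sqrtr_sqr ger0_norm // mulfV //.
  by rewrite normc_eq0.
pose k z := u * dquot F w l z.
have kE z : z != w -> k z = (u * F z - A%:C%C) / (z - w).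
  by move=> zw; rewrite /k /dquot (negPf zw) mulrA mulrBr uF.
have nuF z : nc (u * F z) = nc (F z) by rewrite normcM nu mul1r.
have xI s : a <= s <= b -> `|s - x0| <= 2 * r.
  by move=> h; rewrite ler_norml; move: h ha hb; clear; lra.
have yI s : c <= s <= d -> `|s - y0| <= 2 * r.
  by move=> h; rewrite ler_norml; move: h hc hd; clear; lra.
have rab : 2 * r <= b - a by move: ha hb; clear; lra.
have rcd : 2 * r <= d - c by move: hc hd; clear; lra.
have ab : a <= b by move: rab r0; clear; lra.
have cd : c <= d by move: rcd r0; clear; lra.
have x1 : a <= a <= b by rewrite lexx.
have x2 : a <= b <= b by rewrite lexx ab.
have y1 : c <= c <= d by rewrite lexx.
have y2 : c <= d <= d by rewrite lexx cd.
have ck x y : a <= x <= b -> c <= y <= d -> ccontinuous_at R k (Complex x y).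
  move=> hx hy; apply: ccontinuousM; first exact/derivable_ccontinuous/derivableC_cst.
  by apply: dquot_ccontinuous => //; exact: cF.
have G0 : boundary_integral R (fun x y => complex.Im (k (Complex x y)))
    (fun x y => complex.Re (k (Complex x y))) a b c d = 0.
  apply: (goursat_rectangle _ _ _ _ _ _ (x0 :: X)) => //.
  move=> x y /andP[hx1 hx2] hy; rewrite inE negb_or => /andP[xx0 xX].
  apply: (derivableC_mul (fun=> u) (dquot F w l)); first exact: derivableC_cst.
  apply: dquot_derivable; first by rewrite eq_complex negb_and /= xx0.
  by apply: dF => //; rewrite !ltW.
have pI y : c <= y <= d ->
    {within `[a, b], continuous (fun x => complex.Im (k (Complex x y)))}.
  by move=> hy; apply: row_within_continuous; [exact: Im_lipschitz | move=> x hx; exact: ck].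
have qI x : a <= x <= b ->
    {within `[c, d], continuous (fun y => complex.Re (k (Complex x y)))}.
  by move=> hx; apply: column_within_continuous; [exact: Re_lipschitz | move=> y hy; exact: ck].
have nI y : c <= y <= d ->
    {within `[a, b], continuous (fun x => nc (F (Complex x y)))}.
  by move=> hy; apply: row_within_continuous; [exact: normc_lipschitz | move=> x hx; exact: cF].
have nJ x : a <= x <= b ->
    {within `[c, d], continuous (fun y => nc (F (Complex x y)))}.
  by move=> hx; apply: column_within_continuous; [exact: normc_lipschitz | move=> y hy; exact: cF].
(* The four left-hand sides add up to the boundary integral of [k], which is 0 by [G0]; hence [A] is
   at most [1 / r] times the sum of the integrals of the modulus of [F]. *)
have E1 := edge_le _ _ a b r A r0 A0 rab (pI _ y1) (nI _ y1).
have E2 := edge_ge _ _ a b r A r0 A0 rab (pI _ y2) (nI _ y2).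
have E3 := edge_le _ _ c d r A r0 A0 rcd (qI _ x2) (nJ _ x2).
have E4 := edge_ge _ _ c d r A r0 A0 rcd (qI _ x1) (nJ _ x1).
have na : a != x0 by apply/eqP => h; move: h ha r0; clear; lra.
have nb : b != x0 by apply/eqP => h; move: h hb r0; clear; lra.
have nc0 : c != y0 by apply/eqP => h; move: h hc r0; clear; lra.
have nd : d != y0 by apply/eqP => h; move: h hd r0; clear; lra.
move: G0; rewrite /boundary_integral !RintegralB //; try exact: segment_integrable;
  [ | exact: segment_integrable (qI _ x2) | exact: segment_integrable (qI _ x1)
    | exact: segment_integrable (pI _ y1) | exact: segment_integrable (pI _ y2)].
have e1 s : a <= s <= b ->
    complex.Im (k (Complex s c)) <= nc (F (Complex s c)) / r - A / (8 * r).
  move=> hs; rewrite kE; last by rewrite eq_complex negb_and /= nc0 orbT.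
  set z := _ - w; rewrite -Re_div_i -(nuF (Complex s c)); apply: Re_quotient_le => //.
    by rewrite /z /w /= mul0r mul1r sub0r opprB; move: hc; clear; lra.
  by rewrite /z /w /= mul0r mul1r add0r; exact: xI.
have e2 s : a <= s <= b ->
    - complex.Im (k (Complex s d)) <= nc (F (Complex s d)) / r - A / (8 * r).
  move=> hs; rewrite kE; last by rewrite eq_complex negb_and /= nd orbT.
  set z := _ - w; rewrite -Re_div_Ni -(nuF (Complex s d)); apply: Re_quotient_le => //.
    by rewrite /z /w /= oppr0 mul0r mulN1r sub0r opprK; move: hd; clear; lra.
  by rewrite /z /w /= oppr0 mul0r add0r mulN1r normrN; exact: xI.
have e3 s : c <= s <= d ->
    complex.Re (k (Complex b s)) <= nc (F (Complex b s)) / r - A / (8 * r).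
  move=> hs; rewrite kE; last by rewrite eq_complex negb_and /= nb.
  rewrite -(nuF (Complex b s)); apply: Re_quotient_le => //.
    by rewrite /w /=; move: hb; clear; lra.
  by rewrite /w /=; exact: yI.
have e4 s : c <= s <= d ->
    - complex.Re (k (Complex a s)) <= nc (F (Complex a s)) / r - A / (8 * r).
  move=> hs; rewrite kE; last by rewrite eq_complex negb_and /= na.
  set z := _ - w; set v := _ - A%:C%C.
  have -> : - complex.Re (v / z) = complex.Re (v / (- z)).
    by rewrite invrN mulrN; case: (v / z).
  rewrite -(nuF (Complex a s)); apply: Re_quotient_le => //.
    by rewrite /z /w /= opprB; move: ha; clear; lra.
  by rewrite /z /w /= normrN; exact: yI.
have {}E1 := E1 e1; have {}E2 := E2 e2; have {}E3 := E3 e3; have {}E4 := E4 e4.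
rewrite -(ler_pM2l (_ : 0 < r^-1)) ?invr_gt0 // mulKf ?gt_eqF // -/A.
move: E1 E2 E3 E4; rewrite !mulrDr.
set I1 := Rintegral _ _ _; set J1 := r^-1 * _.
set I2 := Rintegral _ _ _; set J2 := r^-1 * _.
set I3 := Rintegral _ _ _; set J3 := r^-1 * _.
set I4 := Rintegral _ _ _; set J4 := r^-1 * _.
by clear; lra.
Qed.

End cauchy.

(** * Locally uniform limits of holomorphic functions *)

Section weierstrass.
Variable R : realType.
Local Notation C := R[i].
Local Notation nc := (@Normc.normc R).
Local Notation mu := (@lebesgue_measure R).

(** The constant 8 is the perimeter [8 * t] divided by the distance [t] of the sides from the
    centre. *)
Lemma cauchy_square_sup (F : C -> C) (x0 y0 t M : R) (X : seq R) : 0 < t ->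
  (forall x y, x0 - t <= x <= x0 + t -> y0 - t <= y <= y0 + t ->
     ccontinuous_at R F (Complex x y)) ->
  (forall x y, x0 - t <= x <= x0 + t -> y0 - t <= y <= y0 + t -> x \notin X ->
     derivable (F : C^o -> C^o) (Complex x y) 1) ->
  derivable (F : C^o -> C^o) (Complex x0 y0) 1 ->
  (forall x y, x0 - t <= x <= x0 + t -> y0 - t <= y <= y0 + t ->
     `|x - x0| = t \/ `|y - y0| = t -> nc (F (Complex x y)) <= M) ->
  nc (F (Complex x0 y0)) <= 8 * M.
Proof.
move=> t0 cF dF dw FM; 
have x1 : x0 - t <= x0 - t <= x0 + t by move: t0; clear; lra.
have x2 : x0 - t <= x0 + t <= x0 + t by move: t0; clear; lra.
have y1 : y0 - t <= y0 - t <= y0 + t by move: t0; clear; lra.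
have y2 : y0 - t <= y0 + t <= y0 + t by move: t0; clear; lra.
have xx : x0 - t <= x0 + t by case/andP: x1.
have yy : y0 - t <= y0 + t by case/andP: y1.
have np v : `|v + t - v| = t by rewrite addrC addKr ger0_norm // ltW.
have nm v : `|v - t - v| = t by rewrite addrC addKr normrN ger0_norm // ltW.
have bm v : v - 2 * t <= v - t <= v - t by move: t0; clear; lra.
have bp v : v + t <= v + t <= v + 2 * t by move: t0; clear; lra.
have := cauchy_rectangle R F x0 y0 t _ _ _ _ X t0 (bm _) (bp _) (bm _) (bp _) cF dF dw.
have row y : y0 - t <= y <= y0 + t -> `|y - y0| = t ->
    \int[mu]_(x in `[x0 - t, x0 + t]) nc (F (Complex x y)) <= M * (x0 + t - (x0 - t)).
  move=> hy yt; apply: Rintegral_segment_le => //.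
    by apply: row_within_continuous; [exact: normc_lipschitz | move=> x hx; exact: cF].
  by move=> x hx; apply: FM => //; right.
have col x : x0 - t <= x <= x0 + t -> `|x - x0| = t ->
    \int[mu]_(y in `[y0 - t, y0 + t]) nc (F (Complex x y)) <= M * (y0 + t - (y0 - t)).
  move=> hx xt; apply: Rintegral_segment_le => //.
    by apply: column_within_continuous; [exact: normc_lipschitz | move=> y hy; exact: cF].
  by move=> y hy; apply: FM => //; left.
move/le_trans => /(_ _ (lerD (lerD (row _ y1 (nm _)) (row _ y2 (np _)))
  (lerD (col _ x2 (np _)) (col _ x1 (nm _))))).
have -> : M * (x0 + t - (x0 - t)) + M * (x0 + t - (x0 - t)) +
   (M * (y0 + t - (y0 - t)) + M * (y0 + t - (y0 - t))) = t * (8 * M) by ring.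
by rewrite ler_pM2l.
Qed.

Lemma dquotB (f g : C -> C) (w l l' z : C) :
  dquot R f w l z - dquot R g w l' z = dquot R (fun s => f s - g s) w (l - l') z.
Proof.
rewrite /dquot; case: eqP => // _; rewrite -mulrBl; congr (_ / _); ring.
Qed.

Lemma normc_dquot_le (g : C -> C) (w l z : C) (e r : R) : 0 < r ->
  nc (g z) <= e -> nc (g w) <= e -> r <= nc (z - w) ->
  nc (dquot R g w l z) <= 2 * e / r.
Proof.
move=> r0 gz gw rz.
have n0 : 0 < nc (z - w) by apply: lt_le_trans rz.
have e0 : 0 <= e by apply: le_trans gz; exact: normc_ge0.
have zw : z != w by rewrite -subr_eq0 -normc_gt0.
rewrite /dquot (negPf zw) normcM normcV.
apply: (@le_trans _ _ (2 * e * (nc (z - w))^-1)).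
  apply: ler_wpM2r; first by rewrite invr_ge0 ltW.
  by apply: (le_trans (normcB _ _ _)); rewrite mulr_natl mulr2n; exact: lerD.
by apply: ler_wpM2l; [exact: mulr_ge0 | rewrite lef_pV2].
Qed.

(* Cauchy estimate on a square around [z] whose boundary stays away from [z0]. *)
Lemma dquot_uniform_bound (g : C -> C) (z0 l : C) (r e : R) : 0 < r ->
  (forall w, nc (w - z0) < 3 * r -> derivable (g : C^o -> C^o) w 1) ->
  cderivative_at R g z0 l ->
  (forall w, nc (w - z0) < 3 * r -> nc (g w) <= e) ->
  forall z, z != z0 -> nc (z - z0) < r / 2 -> nc (dquot R g z0 l z) <= 32 * e / r.
Proof.
move=> r0 dg hl ge [x0 y0] zz0 zr.
have near x y : x0 - r <= x <= x0 + r -> y0 - r <= y <= y0 + r ->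
    nc (Complex x y - z0) < 3 * r.
  move=> hx hy; have -> : Complex x y - z0 = (Complex x y - Complex x0 y0) + (Complex x0 y0 - z0).
    by rewrite addrA subrK.
  apply: (le_lt_trans (normcD _ _ _)).
  have h1 := normc_le_ReIm _ (Complex x y - Complex x0 y0); rewrite /= in h1.
  have h2 : `|x - x0| <= r by rewrite ler_norml; move: hx; clear; lra.
  have h3 : `|y - y0| <= r by rewrite ler_norml; move: hy; clear; lra.
  rewrite /= in zr *.
  by move: h1 h2 h3 zr r0; clear; lra.
have c0 : nc (z0 - z0) < 3 * r by rewrite subrr Normc.normc0 mulr_gt0.
have r20 : 0 < r / 2 by rewrite divr_gt0.
have xI : x0 - r <= x0 <= x0 + r by move: r0; clear; lra.
have yI : y0 - r <= y0 <= y0 + r by move: r0; clear; lra.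
(* The square has half-side [r] and centre [z] within [r / 2] of [z0]: its boundary is at distance
   at least [r / 2] from [z0], and there the quotient is at most [2 * e / (r / 2)]. *)
have -> : 32 * e / r = 8 * (2 * e / (r / 2)) by field; rewrite gt_eqF.
apply: (cauchy_square_sup (dquot R g z0 l) x0 y0 r _ [:: complex.Re z0] r0).
- move=> x y hx hy; apply: dquot_ccontinuous => //.
  by apply/derivable_ccontinuous/dg/near.
- move=> x y hx hy; rewrite inE => xz; apply: dquot_derivable.
    by apply: contra xz => /eqP <-.
  exact/dg/near.
- by apply: dquot_derivable => //; exact/dg/near.
move=> x y hx hy hb; apply: normc_dquot_le => //; [exact/ge/near | exact: ge | ].
have := abs_Re_le _ (Complex x0 y0 - z0); have := abs_Im_le _ (Complex x0 y0 - z0).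
rewrite Re_sub Im_sub [complex.Re (Complex _ _)]/= [complex.Im (Complex _ _)]/= => h1 h2.
case: hb => hb.
  apply: (le_trans _ (abs_Re_le _ _)); rewrite Re_sub [complex.Re (Complex _ _)]/=.
  have : `|x - x0| <= `|x - complex.Re z0| + `|x0 - complex.Re z0|.
    by rewrite [`|x0 - _|]distrC; exact: ler_distD.
  by rewrite hb; move: h2 zr; clear; lra.
apply: (le_trans _ (abs_Im_le _ _)); rewrite Im_sub [complex.Im (Complex _ _)]/=.
have : `|y - y0| <= `|y - complex.Im z0| + `|y0 - complex.Im z0|.
  by rewrite [`|y0 - _|]distrC; exact: ler_distD.
by rewrite hb; move: h1 zr; clear; lra.
Qed.

(** An exchange of limits: the quotients [K n] are uniformly Cauchy on a punctured disc and
    continuous at [z0], so their values [l n] at [z0] converge, and the limit is the derivative of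
    [f]. *)
Lemma derivable_uniform_limit (fs : nat -> C -> C) (f : C -> C) (z0 : C) (r : R) :
  0 < r ->
  (forall n w, nc (w - z0) < 3 * r -> derivable (fs n : C^o -> C^o) w 1) ->
  (forall e : R, 0 < e -> exists n0, forall n, (n0 <= n)%N ->
     forall w, nc (w - z0) < 3 * r -> nc (fs n w - f w) <= e) ->
  derivable (f : C^o -> C^o) z0 1.
Proof.
move=> r0 dfs unif.
have c0 : nc (z0 - z0) < 3 * r by rewrite subrr Normc.normc0 mulr_gt0.
have r20 : 0 < r / 2 by rewrite divr_gt0.
have : forall n, exists l, cderivative_at R (fs n) z0 l.
  by move=> n; apply/derivableC_eps/dfs.
move=> /choice [l hl]; pose K n := dquot R (fs n) z0 (l n).
have hlB m n : cderivative_at R (fun s => fs m s - fs n s) z0 (l m - l n).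
  move=> e e0; have e20 : 0 < e / 2 by rewrite divr_gt0.
  have [t1 t10 h1] := hl m _ e20; have [t2 t20 h2] := hl n _ e20.
  exists (Num.min t1 t2); first by rewrite lt_min t10.
  move=> w; rewrite lt_min => /andP[/h1 k1 /h2 k2].
  have -> : fs m w - fs n w - (fs m z0 - fs n z0) - (l m - l n) * (w - z0) =
    (fs m w - fs m z0 - l m * (w - z0)) - (fs n w - fs n z0 - l n * (w - z0)) by ring.
  by apply: (le_trans (normcB _ _ _)); move: k1 k2; clear; lra.
have Kb (e : R) : 0 < e -> exists n0, forall m n, (n0 <= m)%N -> (n0 <= n)%N ->
    forall z, z != z0 -> nc (z - z0) < r / 2 -> nc (K m z - K n z) <= 64 * e / r.
  move=> e0; have [n0 hn] := unif e e0; exists n0 => m n hm hn' z zz0 zr.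
  rewrite /K dquotB (_ : 64 * e / r = 32 * (2 * e) / r); last by field; rewrite gt_eqF.
  apply: dquot_uniform_bound => //.
    by move=> w hw; apply: (derivableC_sub R (fs m) (fs n)); exact: dfs.
  move=> w hw; have -> : fs m w - fs n w = (fs m w - f w) - (fs n w - f w) by ring.
  apply: (le_trans (normcB _ _ _)); rewrite mulr_natl mulr2n.
  by apply: lerD; exact: hn.
have cK n : ccontinuous_at R (K n) z0.
  by apply: dquot_ccontinuous => //; exact/derivable_ccontinuous/dfs.
have Kz n : K n z0 = l n by rewrite /K /dquot eqxx.
(* Each final estimate adds at most three terms [e / k] and one term [64 * (e / k) / r] coming from
   [Kb]; together these make [e]. *)
pose k := 3 + 64 / r.
have k0 : 0 < k by rewrite addr_gt0 // divr_gt0.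
have ekE (e : R) : e = 3 * (e / k) + 64 * (e / k) / r.
  rewrite -[in LHS](divfK (lt0r_neq0 k0) e); move: (e / k) => x.
  by rewrite /k; field; rewrite gt_eqF.
have [L hL] : exists L, forall e : R, 0 < e -> exists n0, forall n, (n0 <= n)%N ->
    nc (l n - L) <= e.
  apply: complex_cauchy_cvg => e e0.
  have ek0 : 0 < e / k by rewrite divr_gt0.
  have [n0 hn] := Kb _ ek0; exists n0 => m n hm hn'.
  have [t1 t10 h1] := cK m _ ek0; have [t2 t20 h2] := cK n _ ek0.
  pose t := Num.min (Num.min t1 t2) (r / 2).
  have t0 : 0 < t by rewrite !lt_min t10 t20.
  (* [Kb] says nothing at [z0] itself, so [l m] and [l n] are compared through a nearby point. *)
  pose z := z0 + (t / 2)%:C%C.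
  have nz : nc (z - z0) = t / 2.
    rewrite /z [z0 + _]addrC addrK /= expr0n addr0 sqrtr_sqr ger0_norm // divr_ge0 // ltW //.
  have zt : nc (z - z0) < t by rewrite nz; move: t0; clear; lra.
  move: (zt); rewrite !lt_min => /andP[/andP[/h1 k1 /h2 k2] k3].
  have zz0 : z != z0 by rewrite -subr_eq0 -normc_gt0 nz divr_gt0.
  rewrite !Kz in k1 k2; have k4 := hn m n hm hn' z zz0 k3.
  have -> : l m - l n = (K m z - K n z) - (K m z - l m) + (K n z - l n) by ring.
  apply: (le_trans (normcD _ _ _)).
  have k5 := normcB _ (K m z - K n z) (K m z - l m).
  by rewrite [leRHS]ekE; move: k1 k2 k4 k5 ek0; clear; lra.
apply/derivableC_eps; exists L => e e0.
have ek0 : 0 < e / k by rewrite divr_gt0.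
have [n1 hn1] := Kb _ ek0; have [n2 hn2] := hL _ ek0.
pose n := maxn n1 n2; have [t1 t10 h1] := cK n _ ek0.
exists (Num.min t1 (r / 2)); first by rewrite lt_min t10.
move=> z; rewrite lt_min => /andP[/h1 k1 k2].
have [->|zz0] := eqVneq z z0; first by rewrite !subrr mulr0 subrr Normc.normc0 mulr0.
have nz0 : 0 < nc (z - z0) by rewrite normc_gt0 subr_eq0.
(* The index [m] may depend on [z]: it makes [fs m] close to [f] relative to the distance from [z]
   to [z0]. The index [n], and with it the radius, is fixed beforehand. *)
have eta0 : 0 < e / k * nc (z - z0) / 2 by rewrite divr_gt0 // mulr_gt0.
have [n3 hn3] := unif _ eta0; pose m := maxn n1 n3.
have z3 : nc (z - z0) < 3 * r by move: k2 r0; clear; lra.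
pose q := (f z - f z0) / (z - z0).
have k3 : nc (q - K m z) <= e / k.
  have -> : q - K m z = ((f z - fs m z) - (f z0 - fs m z0)) / (z - z0).
    by rewrite /q /K /dquot (negPf zz0) -mulrBl; congr (_ / _); ring.
  rewrite normcM normcV ler_pdivrMr //.
  apply: (le_trans (normcB _ _ _)).
  have j1 := hn3 m (leq_maxr _ _) z z3; have j2 := hn3 m (leq_maxr _ _) z0 c0.
  rewrite (normc_distC _ (f z)) (normc_distC _ (f z0)).
  by move: j1 j2; clear; lra.
have k4 := hn1 m n (leq_maxl _ _) (leq_maxl _ _) z zz0 k2.
have k5 := hn2 n (leq_maxr _ _).
rewrite Kz in k1.
have -> : f z - f z0 - L * (z - z0) = (q - L) * (z - z0).
  by rewrite mulrBl /q mulfVK // subr_eq0.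
rewrite normcM; apply: ler_wpM2r; first exact: normc_ge0.
have -> : q - L = (q - K m z) + (K m z - K n z) + ((K n z - l n) + (l n - L)) by ring.
apply: (le_trans (normcD _ _ _)).
have k6 := normcD _ (q - K m z) (K m z - K n z).
have k7 := normcD _ (K n z - l n) (l n - L).
rewrite [leRHS]ekE; move: k1 k3 k4 k5 k6 k7; clear; lra.
Qed.

End weierstrass.

(** * Square-integrable functions on the disc *)

Section disc_integral.
Variable R : realType.
Local Notation C := R[i].
Local Notation D := (@disc2 R).
Local Notation m := (@area R).
Implicit Types (u v w : C -> C) (phi psi : C -> R).

Lemma normsq_ge0 (z : C) : 0 <= normsq z.
Proof. by rewrite addr_ge0 ?sqr_ge0. Qed.

Lemma normsqM (z w : C) : normsq (z * w) = normsq z * normsq w.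
Proof. by rewrite -!normc_sqr normcM exprMn. Qed.

Lemma in_discE (z : C) : in_disc z <-> normsq z < 1.
Proof.
rewrite /in_disc normCE -[1]/(1%:C%C) ltcR -normc_sqr.
by rewrite -{2}(expr1n R 2) ltr_pXn2r ?nnegrE ?normc_ge0.
Qed.

Lemma disc2E (x : R2 R) : D x <-> in_disc (toC x).
Proof. by rewrite in_discE. Qed.

Lemma measurable_disc2 : measurable D.
Proof.
have mf : measurable_fun setT (fun x : R2 R => x.1 ^+ 2 + x.2 ^+ 2 : R).
  by apply: measurable_funD; apply: measurable_funX; [exact: measurable_fst | exact: measurable_snd].
have := mf measurableT `]-oo, (1 : R)[%classic (measurable_itv _).
by rewrite setTI; congr (measurable _).
Qed.
Local Hint Resolve measurable_disc2 : core.

Lemma area_disc2_lty : (m D < +oo)%E.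
Proof.
pose I : set R := `[(-1 : R), 1]%classic.
have sub : D `<=` I `*` I.
  move=> x; rewrite /I /disc2 /= !in_itv /= => h; rewrite -!ler_norml.
  have n1 (s t : R) : s ^+ 2 + t ^+ 2 < 1 -> `|s| <= 1.
    move=> st; rewrite -(@ler_pXn2r _ 2) ?nnegrE // real_normK ?num_real // expr1n.
    by have := sqr_ge0 t; move: st; clear; lra.
  by split; [exact: n1 h | apply: (n1 _ x.1); rewrite addrC].
have mI : measurable I by exact: measurable_itv.
have mX := measurableX mI mI.
have h := le_measure m (mem_set measurable_disc2) (mem_set mX) sub.
apply: (le_lt_trans h).
suff : (m (I `*` I) < +oo)%E by [].
have -> : m (I `*` I) =
    (lebesgue_measure I * lebesgue_measure I)%E.
  exact: product_measure1E.
by rewrite /I lebesgue_measure_itv; case: ifP => _; rewrite /= ?mul0e ?mule0 // -EFinM ltry.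
Qed.

Definition cmeasurable u := measurable_fun D (fun x => complex.Re (u (toC x))) /\
  measurable_fun D (fun x => complex.Im (u (toC x))).

Lemma cmeasurableD u v : cmeasurable u -> cmeasurable v -> cmeasurable (fun z => u z + v z).
Proof.
move=> [u1 u2] [v1 v2]; split.
  by under eq_fun do rewrite Re_add; exact: measurable_funD.
by under eq_fun do rewrite Im_add; exact: measurable_funD.
Qed.

Lemma cmeasurableM u v : cmeasurable u -> cmeasurable v -> cmeasurable (fun z => u z * v z).
Proof.
move=> [u1 u2] [v1 v2]; split.
  by under eq_fun do rewrite Re_mul; apply: measurable_funB; exact: measurable_funM.
by under eq_fun do rewrite Im_mul; apply: measurable_funD; exact: measurable_funM.
Qed.

Lemma cmeasurable_cst (c : C) : cmeasurable (fun=> c).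
Proof. by split; exact: measurable_cst. Qed.

Lemma cmeasurable_id : cmeasurable id.
Proof. by split; apply: measurable_funTS; [exact: measurable_fst | exact: measurable_snd]. Qed.

Lemma cmeasurable_conj u : cmeasurable u -> cmeasurable (fun z => (u z)^*).
Proof.
move=> [u1 u2]; split.
  by rewrite (_ : (fun x => _) = fun x => complex.Re (u (toC x))) //;
    apply/funext => x; case: (u _).
rewrite (_ : (fun x => _) = fun x => - complex.Im (u (toC x))).
  exact: measurable_funN.
by apply/funext => x; case: (u _).
Qed.

Lemma cmeasurableX u n : cmeasurable u -> cmeasurable (fun z => u z ^+ n).
Proof.
move=> mu; elim: n => [|n IH].
  by under eq_fun do rewrite expr0; exact: cmeasurable_cst.
by under eq_fun do rewrite exprS; exact: cmeasurableM.
Qed.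

Lemma cmeasurableN u : cmeasurable u -> cmeasurable (fun z => - u z).
Proof.
by move=> mu; under eq_fun do rewrite -mulN1r; apply: cmeasurableM => //; exact: cmeasurable_cst.
Qed.

Lemma cmeasurableB u v : cmeasurable u -> cmeasurable v -> cmeasurable (fun z => u z - v z).
Proof. by move=> mu mv; apply: cmeasurableD => //; exact: cmeasurableN. Qed.

Lemma cmeasurable_sum (I : Type) (s : seq I) (F : I -> C -> C) :
  (forall i, cmeasurable (F i)) -> cmeasurable (fun z => \sum_(i <- s) F i z).
Proof.
move=> mF; elim: s => [|i s IH].
  by under eq_fun do rewrite big_nil; exact: cmeasurable_cst.
by under eq_fun do rewrite big_cons; exact: cmeasurableD.
Qed.

Lemma measurable_normsq u : cmeasurable u ->
  measurable_fun D (fun x => normsq (u (toC x))).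
Proof. by move=> [u1 u2]; apply: measurable_funD; exact: measurable_funX. Qed.

Definition dA_integrable phi := m.-integrable D (EFin \o (fun x => phi (toC x))).

Lemma dA_integrable_le phi psi : measurable_fun D (fun x => phi (toC x)) ->
  (forall z, in_disc z -> `|phi z| <= psi z) -> dA_integrable psi -> dA_integrable phi.
Proof.
move=> mphi le; apply: le_integrable => //; first exact/measurable_EFinP.
move=> x /disc2E /le h; rewrite /= lee_fin; apply: (le_trans h); exact: ler_norm.
Qed.

Lemma dA_integrableD phi psi : dA_integrable phi -> dA_integrable psi ->
  dA_integrable (fun z => phi z + psi z).
Proof. by move=> i1 i2; exact: (integrableD _ i1 i2). Qed.

Lemma dA_integrableZ (a : R) phi : dA_integrable phi -> dA_integrable (fun z => a * phi z).
Proof. by move=> i1; exact: (integrableZl _ a i1). Qed.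

Lemma dA_integrable_cst (a : R) : dA_integrable (fun=> a).
Proof.
apply: measurable_bounded_integrable => //; first exact: area_disc2_lty.
by exists `|a|; split; rewrite ?num_real // => y hy x _ /=; exact: ltW.
Qed.

Lemma dA_intD phi psi : dA_integrable phi -> dA_integrable psi ->
  dA_int (fun z => phi z + psi z) = dA_int phi + dA_int psi.
Proof. by move=> i1 i2; rewrite /dA_int RintegralD // mulrDl. Qed.

Lemma dA_intZ (a : R) phi : dA_integrable phi ->
  dA_int (fun z => a * phi z) = a * dA_int phi.
Proof. by move=> i1; rewrite /dA_int RintegralZl // mulrA. Qed.

Lemma dA_int_le phi psi : dA_integrable phi -> dA_integrable psi ->
  (forall z, in_disc z -> phi z <= psi z) -> dA_int phi <= dA_int psi.
Proof.
move=> i1 i2 le; rewrite /dA_int; apply: ler_wpM2r; first by rewrite invr_ge0 pi_ge0.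
by apply: le_Rintegral => // x /disc2E; exact: le.
Qed.

Lemma dA_int_ge0 phi : (forall z, in_disc z -> 0 <= phi z) -> 0 <= dA_int phi.
Proof.
move=> h; apply: divr_ge0; last exact: pi_ge0.
by apply: Rintegral_ge0 => x /disc2E; exact: h.
Qed.

Lemma eq_dA_int phi psi : (forall z, in_disc z -> phi z = psi z) -> dA_int phi = dA_int psi.
Proof.
move=> h; rewrite /dA_int; congr (_ / _); apply: eq_Rintegral => x.
by rewrite inE => /disc2E; exact: h.
Qed.

Lemma inL2DE u : inL2D u <-> cmeasurable u /\ dA_integrable (fun z => normsq (u z)).
Proof.
have pi0 : pi != 0 :> R by rewrite gt_eqF // pi_gt0.
split=> [[u1 [u2 h]]|[[u1 u2] h]].
  have mu : cmeasurable u by [].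
  split=> //.
  have : dA_integrable (fun z => normsq (u z) / pi).
    apply/integrableP; split.
      apply/measurable_EFinP; apply: measurable_funM; last exact: measurable_cst.
      exact: measurable_normsq.
    apply: le_lt_trans h; rewrite le_eqVlt; apply/orP; left; apply/eqP/eq_integral => x _.
    by rewrite /= ger0_norm // divr_ge0 ?normsq_ge0 ?pi_ge0.
  move/(dA_integrableZ pi); rewrite /dA_integrable.
  by under eq_fun do rewrite mulrC divfK //.
split=> //; split=> //.
have := dA_integrableZ pi^-1 _ h => /integrableP [_]; apply: le_lt_trans.
rewrite le_eqVlt; apply/orP; left; apply/eqP/eq_integral => x _.
by rewrite /= ger0_norm mulrC // divr_ge0 ?normsq_ge0 ?pi_ge0.
Qed.

Lemma normsqD_le (z w : C) : normsq (z + w) <= 2 * normsq z + 2 * normsq w.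
Proof.
case: z => a b; case: w => c d; rewrite /normsq /=.
have := sqr_ge0 (a - c); have := sqr_ge0 (b - d); rewrite !expr2; clear; lra.
Qed.

Lemma Re_mul_conj (z w : C) : complex.Re (z * w^*) =
  complex.Re z * complex.Re w + complex.Im z * complex.Im w.
Proof. by case: z => a b; case: w => c d /=; ring. Qed.

Lemma Im_mul_conj (z w : C) : complex.Im (z * w^*) =
  complex.Im z * complex.Re w - complex.Re z * complex.Im w.
Proof. by case: z => a b; case: w => c d /=; ring. Qed.

Lemma Re_mul_conj_le (z w : C) : `|complex.Re (z * w^*)| <= normsq z + normsq w.
Proof.
rewrite Re_mul_conj; case: z => a b; case: w => c d; rewrite /normsq /= ler_norml.
have := sqr_ge0 (a - c); have := sqr_ge0 (b - d).
have := sqr_ge0 (a + c); have := sqr_ge0 (b + d).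
have := sqr_ge0 a; have := sqr_ge0 b; have := sqr_ge0 c; have := sqr_ge0 d.
by rewrite !expr2 => *; apply/andP; split; lra.
Qed.

Lemma inL2D_mul (phi : C -> C) (M : R) u : cmeasurable phi ->
  (forall z, in_disc z -> normsq (phi z) <= M) -> inL2D u ->
  inL2D (fun z => phi z * u z).
Proof.
move=> mphi bd /inL2DE [mu iu]; apply/inL2DE; split; first exact: cmeasurableM.
apply: (dA_integrable_le _ (fun z => M * normsq (u z))).
- by apply: (measurable_normsq (fun z => phi z * u z)); exact: cmeasurableM.
- move=> z zD; rewrite normsqM ger0_norm ?mulr_ge0 ?normsq_ge0 //.
  by apply: ler_wpM2r; [exact: normsq_ge0 | exact: bd].
- exact: dA_integrableZ.
Qed.

Lemma inL2D_add u v : inL2D u -> inL2D v -> inL2D (fun z => u z + v z).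
Proof.
move=> /inL2DE [mu iu] /inL2DE [mv iv]; apply/inL2DE; split; first exact: cmeasurableD.
apply: (dA_integrable_le _ (fun z => 2 * normsq (u z) + 2 * normsq (v z))).
- by apply: (measurable_normsq (fun z => u z + v z)); exact: cmeasurableD.
- by move=> z zD; rewrite ger0_norm ?normsq_ge0 //; exact: normsqD_le.
- by apply: dA_integrableD; exact: dA_integrableZ.
Qed.

Lemma inL2D_scale (c : C) u : inL2D u -> inL2D (fun z => c * u z).
Proof.
by move=> Lu; apply: (inL2D_mul (fun=> c) (normsq c)) => //; exact: cmeasurable_cst.
Qed.

Lemma inL2D_sub u v : inL2D u -> inL2D v -> inL2D (fun z => u z - v z).
Proof.
move=> Lu Lv; apply: inL2D_add => //.
by under eq_fun do rewrite -mulN1r; exact: inL2D_scale.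
Qed.

Lemma inL2D_bounded u (M : R) : cmeasurable u ->
  (forall z, in_disc z -> normsq (u z) <= M) -> inL2D u.
Proof.
move=> mu bd; apply/inL2DE; split=> //.
apply: (dA_integrable_le _ (fun=> M)); [exact: measurable_normsq | | exact: dA_integrable_cst].
by move=> z zD; rewrite ger0_norm ?normsq_ge0 //; exact: bd.
Qed.

(** The real part of [inner], to which the abstract results over real scalars are applied. *)
Definition rinner u v : R := dA_int (fun z => complex.Re (u z * (v z)^*)).

Lemma rinner_integrable u v : inL2D u -> inL2D v ->
  dA_integrable (fun z => complex.Re (u z * (v z)^*)).
Proof.
move=> /inL2DE [mu iu] /inL2DE [mv iv].
apply: (dA_integrable_le _ (fun z => normsq (u z) + normsq (v z))).
- by case: (cmeasurableM _ _ mu (cmeasurable_conj _ mv)).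
- by move=> z _; exact: Re_mul_conj_le.
- exact: dA_integrableD.
Qed.

Lemma normsqE (z : C) : normsq z = complex.Re (z * z^*).
Proof. by rewrite Re_mul_conj. Qed.

Lemma rinnerxx u : rinner u u = dA_int (fun z => normsq (u z)).
Proof. by apply: eq_dA_int => z _; rewrite normsqE. Qed.

Lemma rinner_ge0 u : 0 <= rinner u u.
Proof. by rewrite rinnerxx; apply: dA_int_ge0 => z _; exact: normsq_ge0. Qed.

Lemma rinnerC u v : rinner u v = rinner v u.
Proof. by apply: eq_dA_int => z _; rewrite !Re_mul_conj; ring. Qed.

Lemma rinner_linear (a : R) u v w : inL2D u -> inL2D v -> inL2D w ->
  rinner (fun z => a%:C%C * u z + v z) w = a * rinner u w + rinner v w.
Proof.
move=> Lu Lv Lw; rewrite /rinner -dA_intZ ?rinner_integrable // -dA_intD.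
- by apply: eq_dA_int => z _; rewrite !Re_mul_conj Re_add Im_add Re_mul Im_mul /=; ring.
- by apply: dA_integrableZ; exact: rinner_integrable.
- exact: rinner_integrable.
Qed.

End disc_integral.

(** * The Bergman space *)

Section point_evaluation.
Variable R : realType.
Local Notation C := R[i].
Local Notation D := (@disc2 R).
Local Notation m := (@area R).
Local Notation mu := (@lebesgue_measure R).
Local Notation nc := (@Normc.normc R).
Implicit Types (N : R2 R -> R) (J Y : set R).

(** Averaging: if every row of the band carried more than [K], Tonelli would give at least
    [K * (c2 - c1)] over the band. *)
Lemma exists_row_le N (J : set R) (c1 c2 K : R) : measurable_fun D N ->
  (forall x, D x -> 0 <= N x) -> measurable J -> c1 < c2 ->
  J `*` `[c1, c2] `<=` D ->
  (\int[m]_(x in D) (N x)%:E < (K * (c2 - c1))%:E)%E -> 0 <= K ->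
  exists2 c, c1 <= c <= c2 & (\int[mu]_(x in J) (N (x, c))%:E <= K%:E)%E.
Proof.
move=> mN N0 mJ c12 sub lt K0; apply: contrapT => hn.
have big c : c1 <= c <= c2 -> (K%:E <= \int[mu]_(x in J) (N (x, c))%:E)%E.
  by move=> hc; rewrite leNgt; apply/negP => /ltW h; apply: hn; exists c.
move: lt; apply/negP; rewrite -leNgt.
pose S : set (R2 R) := J `*` `[c1, c2].
have mS : measurable S by apply: measurableX => //; exact: measurable_itv.
pose g := (fun x : R2 R => (N x)%:E) \_ S.
have g0 x : (0 <= g x)%E.
  by rewrite /g patchE; case: ifPn => // /set_mem /sub /N0; rewrite lee_fin.
have mg : measurable_fun setT g.
  apply/(measurable_restrictT _ mS)/measurable_EFinP.
  by apply: measurable_funS mN => //; exact: measurable_disc2.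
have h1 : (\int[m]_(x in S) (N x)%:E <= \int[m]_(x in D) (N x)%:E)%E.
  apply: ge0_subset_integral => //; first exact: measurable_disc2.
  exact/measurable_EFinP.
apply: (le_trans _ h1); rewrite integral_mkcond.
rewrite [X in (_ <= X)%E](fubini_tonelli2 g mg g0).
have mG : measurable_fun setT (fubini_G mu g) by exact: measurable_fun_fubini_tonelli_G.
have mI : measurable `[c1, c2]%classic by exact: measurable_itv.
apply: (@le_trans _ _ (\int[mu]_(y in `[c1, c2]) fubini_G mu g y)%E); last first.
  apply: ge0_subset_integral => //.
  by move=> y _; apply: integral_ge0.
apply: (@le_trans _ _ (\int[mu]_(y in `[c1, c2]) K%:E)%E).
  rewrite integral_cst // EFinM; apply: lee_wpmul2l; first by rewrite lee_fin.
  suff : ((c2 - c1)%:E <= mu `[c1, c2])%E by [].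
  by rewrite lebesgue_measure_itv /= lte_fin c12 EFinB.
apply: ge0_le_integral => //.
- by apply: measurable_funTS.
- move=> y /= yI; rewrite /fubini_G.
  rewrite in_itv /= in yI.
  suff e : (\int[mu]_(x in J) (N (x, y))%:E = \int[mu]_x g (x, y))%E.
    by have := big y yI; rewrite e.
  rewrite integral_mkcond; apply: eq_integral => x _.
  rewrite /g !patchE; congr (if _ then _ else _); apply/idP/idP; rewrite !inE.
    by move=> xJ; split => //=; rewrite in_itv.
  by case.
Qed.

Lemma exists_column_le N (J : set R) (c1 c2 K : R) : measurable_fun D N ->
  (forall x, D x -> 0 <= N x) -> measurable J -> c1 < c2 ->
  `[c1, c2] `*` J `<=` D ->
  (\int[m]_(x in D) (N x)%:E < (K * (c2 - c1))%:E)%E -> 0 <= K ->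
  exists2 c, c1 <= c <= c2 & (\int[mu]_(y in J) (N (c, y))%:E <= K%:E)%E.
Proof.
move=> mN N0 mJ c12 sub lt K0; apply: contrapT => hn.
have big c : c1 <= c <= c2 -> (K%:E <= \int[mu]_(y in J) (N (c, y))%:E)%E.
  by move=> hc; rewrite leNgt; apply/negP => /ltW h; apply: hn; exists c.
move: lt; apply/negP; rewrite -leNgt.
pose S : set (R2 R) := `[c1, c2] `*` J.
have mS : measurable S by apply: measurableX => //; exact: measurable_itv.
pose g := (fun x : R2 R => (N x)%:E) \_ S.
have g0 x : (0 <= g x)%E.
  by rewrite /g patchE; case: ifPn => // /set_mem /sub /N0; rewrite lee_fin.
have mg : measurable_fun setT g.
  apply/(measurable_restrictT _ mS)/measurable_EFinP.
  by apply: measurable_funS mN => //; exact: measurable_disc2.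
have h1 : (\int[m]_(x in S) (N x)%:E <= \int[m]_(x in D) (N x)%:E)%E.
  apply: ge0_subset_integral => //; first exact: measurable_disc2.
  exact/measurable_EFinP.
apply: (le_trans _ h1); rewrite integral_mkcond.
rewrite [X in (_ <= X)%E](fubini_tonelli1 g mg g0).
have mF : measurable_fun setT (fubini_F mu g) by exact: measurable_fun_fubini_tonelli_F.
have mI : measurable `[c1, c2]%classic by exact: measurable_itv.
apply: (@le_trans _ _ (\int[mu]_(x in `[c1, c2]) fubini_F mu g x)%E); last first.
  apply: ge0_subset_integral => //.
  by move=> y _; apply: integral_ge0.
apply: (@le_trans _ _ (\int[mu]_(x in `[c1, c2]) K%:E)%E).
  rewrite integral_cst // EFinM; apply: lee_wpmul2l; first by rewrite lee_fin.
  suff : ((c2 - c1)%:E <= mu `[c1, c2])%E by [].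
  by rewrite lebesgue_measure_itv /= lte_fin c12 EFinB.
apply: ge0_le_integral => //.
- by apply: measurable_funTS.
- move=> x /= xI; rewrite /fubini_F.
  rewrite in_itv /= in xI.
  suff e : (\int[mu]_(y in J) (N (x, y))%:E = \int[mu]_y g (x, y))%E.
    by have := big x xI; rewrite e.
  rewrite integral_mkcond; apply: eq_integral => y _.
  rewrite /g !patchE; congr (if _ then _ else _); apply/idP/idP; rewrite !inE.
    by move=> yJ; split => //=; rewrite in_itv.
  by case.
Qed.

(** A good row or column is selected over the full width of a square, before the corners of the
    rectangle are known; the bound then passes to the shorter side. *)
Lemma segment_Rintegral_le (g : R -> R) (a b a' b' K : R) : a' <= a -> b <= b' ->
  {within `[a', b'], continuous g} -> (forall x, a' <= x <= b' -> 0 <= g x) ->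
  (\int[mu]_(x in `[a', b']) (g x)%:E <= K%:E)%E ->
  \int[mu]_(x in `[a, b]) g x <= K.
Proof.
move=> aa bb cg g0 h; have ig := segment_integrable _ _ _ _ cg.
have sub : `[a, b] `<=` `[a', b'].
  by move=> x /=; rewrite !in_itv /= => /andP[h1 h2]; rewrite (le_trans aa h1) (le_trans h2 bb).
have iab : mu.-integrable `[a, b] (EFin \o g) by apply: integrableS ig.
rewrite -lee_fin /Rintegral fineK; last exact: integrable_fin_num.
apply: le_trans h; apply: ge0_subset_integral => //; first exact: measurable_int ig.
Qed.

(** Each side is chosen in a band of width [r], between distances [r] and [2 * r] from the centre,
    with [|f|^2] integrating to at most [(I + e) / r] along it. Cauchy's estimate for [f^2] then
    reads [r |f|^2 <= 4 (I + e) / r] at the centre. *)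
Lemma bergman_square_eval (f : C -> C) (x0 y0 r : R) : bergman f -> 0 < r ->
  (forall x y, x0 - 2 * r <= x <= x0 + 2 * r -> y0 - 2 * r <= y <= y0 + 2 * r ->
     in_disc (Complex x y)) ->
  r ^+ 2 * normsq (f (Complex x0 y0)) <= 4 * pi * dA_int (fun z => normsq (f z)).
Proof.
move=> [hf /inL2DE [mf i_f]] r0 sq.
pose N (x : R2 R) := normsq (f (toC x)).
pose I := Rintegral m D N.
have -> : 4 * pi * dA_int (fun z => normsq (f z)) = 4 * I.
  by rewrite /dA_int -[Rintegral _ _ _]/I -mulrA [pi * _]mulrC divfK // lt0r_neq0 // pi_gt0.
have IE : (\int[m]_(x in D) (N x)%:E = I%:E)%E.
  by rewrite /I /Rintegral fineK //; apply: integrable_fin_num => //; exact: measurable_disc2.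
rewrite -subr_le0; apply: (@le0_of_le_eps _ _ 4) => e e0.
(* The [e] provides the strict inequality on which the averaging rests. *)
pose K := (I + e) / r.
have I0 : 0 <= I by apply: Rintegral_ge0 => x _; exact: normsq_ge0.
have K0 : 0 <= K by apply: divr_ge0; [exact: addr_ge0 (ltW e0) | exact: ltW].
have Kr c : (\int[m]_(x in D) (N x)%:E < (K * (c + r - c))%:E)%E.
  rewrite IE lte_fin /K [c + r - c]addrC addKr divfK ?gt_eqF //.
  by rewrite ltrDl.
have mN : measurable_fun D N by exact: measurable_normsq.
have N0 x : D x -> 0 <= N x by move=> _; exact: normsq_ge0.
pose F z := f z * f z.
have NF x y : N (x, y) = nc (F (Complex x y)).
  by rewrite /N /F normcM -expr2 normc_sqr.
have dF x y : x0 - 2 * r <= x <= x0 + 2 * r -> y0 - 2 * r <= y <= y0 + 2 * r ->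
    derivable (F : C^o -> C^o) (Complex x y) 1.
  by move=> hx hy; apply: (derivableC_mul R f f); apply/hf/sq.
have cF x y : x0 - 2 * r <= x <= x0 + 2 * r -> y0 - 2 * r <= y <= y0 + 2 * r ->
    ccontinuous_at R F (Complex x y).
  by move=> hx hy; apply/derivable_ccontinuous/dF.
pose Jx := `[x0 - 2 * r, x0 + 2 * r]%classic; pose Jy := `[y0 - 2 * r, y0 + 2 * r]%classic.
have mJx : measurable Jx by exact: measurable_itv.
have mJy : measurable Jy by exact: measurable_itv.
have row (c1 : R) : y0 - 2 * r <= c1 -> c1 + r <= y0 + 2 * r ->
    exists2 c, c1 <= c <= c1 + r &
    forall a b, x0 - 2 * r <= a -> b <= x0 + 2 * r ->
      \int[mu]_(x in `[a, b]) nc (F (Complex x c)) <= K.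
  move=> h1 h2.
  have [||c hc hK] := exists_row_le N Jx c1 (c1 + r) K mN N0 mJx _ _ (Kr c1) K0.
  - by rewrite ltrDl.
  - move=> [x y] [/=]; rewrite !in_itv /= => hx hy; apply/disc2E/sq => //.
    by rewrite /=; move: hy h1 h2; clear; lra.
  exists c => // a b ha hb; apply: (segment_Rintegral_le _ _ _ _ _ _ ha hb).
  - apply: row_within_continuous; first exact: normc_lipschitz.
    by move=> x hx; apply: cF => //; move: hc h1 h2; clear; lra.
  - by move=> x _; exact: normc_ge0.
  - by under eq_integral do rewrite -NF.
have col (c1 : R) : x0 - 2 * r <= c1 -> c1 + r <= x0 + 2 * r ->
    exists2 c, c1 <= c <= c1 + r &
    forall a b, y0 - 2 * r <= a -> b <= y0 + 2 * r ->
      \int[mu]_(y in `[a, b]) nc (F (Complex c y)) <= K.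
  move=> h1 h2.
  have [||c hc hK] := exists_column_le N Jy c1 (c1 + r) K mN N0 mJy _ _ (Kr c1) K0.
  - by rewrite ltrDl.
  - move=> [x y] [/=]; rewrite !in_itv /= => hx hy; apply/disc2E/sq => //.
    by rewrite /=; move: hx h1 h2; clear; lra.
  exists c => // a b ha hb; apply: (segment_Rintegral_le _ _ _ _ _ _ ha hb).
  - apply: column_within_continuous; first exact: normc_lipschitz.
    by move=> y hy; apply: cF => //; move: hc h1 h2; clear; lra.
  - by move=> y _; exact: normc_ge0.
  - by under eq_integral do rewrite -NF.
have [||c hc Hc] := row (y0 - 2 * r); [by move: r0; clear; lra | by move: r0; clear; lra |].
have [||d hd Hd] := row (y0 + r); [by move: r0; clear; lra | by move: r0; clear; lra |].
have [||a ha Ha] := col (x0 - 2 * r); [by move: r0; clear; lra | by move: r0; clear; lra |].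
have [||b hb Hb] := col (x0 + r); [by move: r0; clear; lra | by move: r0; clear; lra |].
have a1 : x0 - 2 * r <= a <= x0 - r by move: ha; clear; lra.
have b1 : x0 + r <= b <= x0 + 2 * r by move: hb; clear; lra.
have c1 : y0 - 2 * r <= c <= y0 - r by move: hc; clear; lra.
have d1 : y0 + r <= d <= y0 + 2 * r by move: hd; clear; lra.
have inx x : a <= x <= b -> x0 - 2 * r <= x <= x0 + 2 * r by move: a1 b1; clear; lra.
have iny y : c <= y <= d -> y0 - 2 * r <= y <= y0 + 2 * r by move: c1 d1; clear; lra.
have xI : x0 - 2 * r <= x0 <= x0 + 2 * r by move: r0; clear; lra.
have yI : y0 - 2 * r <= y0 <= y0 + 2 * r by move: r0; clear; lra.
have := cauchy_rectangle R F x0 y0 r a b c d [::] r0 a1 b1 c1 d1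
  (fun x y hx hy => cF x y (inx x hx) (iny y hy))
  (fun x y hx hy _ => dF x y (inx x hx) (iny y hy)) (dF x0 y0 xI yI).
case/andP: a1 => a1 _; case/andP: b1 => _ b1; case/andP: c1 => c1 _; case/andP: d1 => _ d1.
have k1 := Hc a b a1 b1; have k2 := Hd a b a1 b1.
have k3 := Hb c d c1 d1; have k4 := Ha c d c1 d1.
move/le_trans => /(_ _ (lerD (lerD k1 k2) (lerD k3 k4))).
rewrite -NF -[N (x0, y0)]/(normsq (f (Complex x0 y0))) => h.
have : r * (r * normsq (f (Complex x0 y0))) <= r * (K + K + (K + K)).
  by apply: ler_wpM2l => //; exact: ltW.
have -> : r * (K + K + (K + K)) = 4 * (I + e) by rewrite /K; field; rewrite gt_eqF.
by rewrite expr2; clear; lra.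
Qed.

Lemma bergman_local_eval (z0 : C) : in_disc z0 -> exists r K : R, [/\ 0 < r,
  forall w, nc (w - z0) < 3 * r -> in_disc w &
  forall f w, bergman f -> nc (w - z0) < 3 * r ->
    normsq (f w) <= K * dA_int (fun z => normsq (f z))].
Proof.
rewrite /in_disc normCE -[1]/(1%:C%C) ltcR => z1; pose d := 1 - nc z0.
have d0 : 0 < d by rewrite subr_gt0.
have inD w : nc (w - z0) < d -> in_disc w.
  move=> h; rewrite /in_disc normCE -[1]/(1%:C%C) ltcR.
  have -> : w = (w - z0) + z0 by rewrite subrK.
  by apply: (le_lt_trans (normcD _ _ _)); move: h; rewrite /d; clear; lra.
(* A point [w] with [|w - z0| < 3 * (d / 12) = d / 4] has around it a square of half-side
   [2 * (d / 8) = d / 4], whose points are within [d / 2] of [w], hence closer than [d] to [z0]. *)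
exists (d / 12), (4 * pi / (d / 8) ^+ 2).
split; first by rewrite divr_gt0.
  by move=> w h; apply: inD; move: h d0; clear; lra.
have r0 : 0 < d / 8 by rewrite divr_gt0.
move=> f [x0 y0] bf hw.
have := bergman_square_eval f x0 y0 (d / 8) bf r0.
rewrite [X in _ -> _ <= X]mulrAC ler_pdivlMr ?exprn_gt0 // [normsq _ * _]mulrC; apply => x y hx hy.
apply: inD.
have -> : Complex x y - z0 = (Complex x y - Complex x0 y0) + (Complex x0 y0 - z0).
  by rewrite addrA subrK.
apply: (le_lt_trans (normcD _ _ _)).
have h1 := normc_le_ReIm _ (Complex x y - Complex x0 y0); rewrite /= in h1.
have h2 : `|x - x0| <= 2 * (d / 8) by rewrite ler_norml; move: hx; clear; lra.
have h3 : `|y - y0| <= 2 * (d / 8) by rewrite ler_norml; move: hy; clear; lra.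
rewrite /= in hw *.
by move: h1 h2 h3 hw d0; clear; lra.
Qed.

End point_evaluation.

(** * Completeness of the Bergman space *)

Section bergman_complete.
Variable R : realType.
Local Notation C := R[i].
Local Notation D := (@disc2 R).
Local Notation m := (@area R).
Local Notation nc := (@Normc.normc R).
Implicit Types (f g : C -> C).

Lemma limn_einf_le (u : nat -> \bar R) (c : \bar R) : (forall n, (u n <= c)%E) ->
  (limn_einf u <= c)%E.
Proof.
move=> uc; rewrite limn_einf_lim; apply: lime_le; first exact: is_cvg_einfs.
near=> n; apply: ge_ereal_inf; exists (u n) => //; exists n => //=.
Unshelve. all: by end_near. Qed.

Lemma bergman_scale (c : C) f : bergman f -> bergman (fun z => c * f z).
Proof.
move=> [hf Lf]; split; last exact: inL2D_scale.
move=> z zD; apply: (derivableC_mul R (fun=> c) f); first exact: derivableC_cst.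
exact: hf.
Qed.

Lemma bergman_add f g : bergman f -> bergman g -> bergman (fun z => f z + g z).
Proof.
move=> [hf Lf] [hg Lg]; split; last exact: inL2D_add.
by move=> z zD; apply: (@derivableD _ C^o C^o f g); [exact: hf | exact: hg].
Qed.

Lemma bergman_sub f g : bergman f -> bergman g -> bergman (fun z => f z - g z).
Proof.
move=> [hf Lf] [hg Lg]; split; last exact: inL2D_sub.
by move=> z zD; apply: (derivableC_sub R f g); [exact: hf | exact: hg].
Qed.

Let cauchy (s : nat -> C -> C) := forall e : R, 0 < e -> exists n0, forall k n,
  (n0 <= k)%N -> (n0 <= n)%N -> dA_int (fun z => normsq (s k z - s n z)) <= e.

Lemma bergman_cauchy_local_uniform (s : nat -> C -> C) z0 : (forall n, bergman (s n)) ->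
  cauchy s -> in_disc z0 ->
  exists r : R, [/\ 0 < r, forall w, nc (w - z0) < 3 * r -> in_disc w &
    forall e : R, 0 < e -> exists n0, forall k n, (n0 <= k)%N -> (n0 <= n)%N ->
      forall w, nc (w - z0) < 3 * r -> nc (s k w - s n w) <= e].
Proof.
move=> bs cs zD; have [r [K [r0 sub ev]]] := bergman_local_eval R z0 zD.
exists r; split=> // e e0; pose K' := `|K| + 1.
have K'0 : 0 < K' by rewrite ltr_wpDl.
have e20 : 0 < e ^+ 2 / K' by rewrite divr_gt0 // exprn_gt0.
have [n0 hn] := cs _ e20; exists n0 => k n hk hn' w hw.
have h1 := ev _ w (bergman_sub _ _ (bs k) (bs n)) hw.
have h2 := hn k n hk hn'; move: h1 h2; set I := dA_int _ => h1 h2.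
have I0 : 0 <= I by apply: dA_int_ge0 => z _; exact: normsq_ge0.
rewrite -(@ler_pXn2r _ 2) ?nnegrE ?normc_ge0 //; last exact: ltW.
rewrite normc_sqr; apply: (le_trans h1).
apply: (@le_trans _ _ (K' * I)).
  by apply: ler_wpM2r => //; apply: (le_trans (ler_norm _)); rewrite lerDl.
by move: h2; rewrite ler_pdivlMr // mulrC.
Qed.

(** The limit is built pointwise. Convergence in norm follows from Fatou's lemma applied to
    [|s n - s k|^2] with [n] fixed and [k] tending to infinity; [f] is then square-integrable as the
    difference of [s n] and [s n - f]. *)
Lemma bergman_complete (s : nat -> C -> C) : (forall n, bergman (s n)) -> cauchy s ->
  exists2 f, bergman f & forall e : R, 0 < e -> exists n0, forall n, (n0 <= n)%N ->
    dA_int (fun z => normsq (s n z - f z)) <= e.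
Proof.
move=> bs cs.
have : forall z, exists l, in_disc z -> forall e : R, 0 < e ->
    exists n0, forall n, (n0 <= n)%N -> nc (s n z - l) <= e.
  move=> z; have [zD|nz] := pselect (in_disc z); last by exists 0 => /nz.
  have [r [r0 _ hr]] := bergman_cauchy_local_uniform s z bs cs zD.
  have [|l hl] := complex_cauchy_cvg R (fun n => s n z); last by exists l.
  move=> e e0; have [n0 hn] := hr e e0; exists n0 => k n hk hn'; apply: hn => //.
  by rewrite subrr Normc.normc0 mulr_gt0.
move=> /choice [f hf].
have f_hol : holomorphic_on_disc f.
  move=> z0 zD; have [r [r0 sub hr]] := bergman_cauchy_local_uniform s z0 bs cs zD.
  apply: (derivable_uniform_limit R s f z0 r r0).
    by move=> n w hw; case: (bs n) => hol _; exact/hol/sub.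
  move=> e e0; have e20 : 0 < e / 2 by rewrite divr_gt0.
  have [n0 hn] := hr _ e20; exists n0 => n hn' w hw.
  (* [n1] depends on [w] but serves only as an intermediate index; [n0] is uniform in [w]. *)
  have [n1 hn1] := hf w (sub w hw) _ e20.
  have -> : s n w - f w = (s n w - s (maxn n0 n1) w) + (s (maxn n0 n1) w - f w) by ring.
  apply: (le_trans (normcD _ _ _)).
  have k1 := hn n (maxn n0 n1) hn' (leq_maxl _ _) w hw.
  have k2 := hn1 (maxn n0 n1) (leq_maxr _ _).
  by move: k1 k2; clear; lra.
have cvgRe z : in_disc z -> (fun n => complex.Re (s n z)) @ \oo --> complex.Re (f z).
  move=> zD; apply/cvgrPdist_le => e e0; have [n0 hn] := hf z zD e e0.
  exists n0 => // n /= /hn; apply: le_trans; rewrite distrC -Re_sub; exact: abs_Re_le.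
have cvgIm z : in_disc z -> (fun n => complex.Im (s n z)) @ \oo --> complex.Im (f z).
  move=> zD; apply/cvgrPdist_le => e e0; have [n0 hn] := hf z zD e e0.
  exists n0 => // n /= /hn; apply: le_trans; rewrite distrC -Im_sub; exact: abs_Im_le.
have ms n : cmeasurable R (s n) by case: (bs n) => _ /inL2DE[].
have mf : cmeasurable R f.
  split.
    apply: (@measurable_fun_cvg _ _ _ _ (fun n x => complex.Re (s n (toC x)))).
      by move=> n; case: (ms n).
    by move=> x /disc2E; exact: cvgRe.
  apply: (@measurable_fun_cvg _ _ _ _ (fun n x => complex.Im (s n (toC x)))).
    by move=> n; case: (ms n).
  by move=> x /disc2E; exact: cvgIm.
have main (e : R) : 0 < e -> exists n0, forall n, (n0 <= n)%N ->
    (\int[m]_(x in D) (normsq (s n (toC x) - f (toC x)))%:E <= (pi * e)%:E)%E.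
  move=> e0; have [n0 hn] := cs e e0; exists n0 => n hn'.
  (* The shift by [n0] makes the Cauchy bound available for every [k], so that the lower limit is
     bounded termwise. *)
  pose h k (x : R2 R) := (normsq (s n (toC x) - s (k + n0)%N (toC x)))%:E.
  have mh k : measurable_fun D (h k).
    apply/measurable_EFinP.
    by apply: (measurable_normsq R (fun z => s n z - s (k + n0)%N z)); exact: cmeasurableB.
  have h0 k x : D x -> (0 <= h k x)%E by move=> _; rewrite lee_fin normsq_ge0.
  have Fa := fatou m (measurable_disc2 R) mh h0.
  apply: (le_trans (le_trans _ Fa)).
    rewrite le_eqVlt; apply/orP; left; apply/eqP; apply: eq_integral => x.
    rewrite inE => /disc2E xD; apply/esym.
    suff hc : (fun k => h k x) @ \oo --> (normsq (s n (toC x) - f (toC x)))%:E.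
      by have [-> _] := cvg_limn_einf_sup hc.
    apply: cvg_EFin; first by near=> k.
    have shift (u : nat -> R) (l : R) : u @ \oo --> l -> (fun k => u (k + n0)%N) @ \oo --> l.
      by move=> hu; rewrite (cvg_shiftn n0 u).
    have hre : (fun k => complex.Re (s n (toC x)) - complex.Re (s (k + n0)%N (toC x))) @ \oo -->
        complex.Re (s n (toC x)) - complex.Re (f (toC x)).
      apply: cvgB; first exact: cvg_cst.
      exact: (shift (fun k => complex.Re (s k (toC x))) _ (cvgRe _ xD)).
    have him : (fun k => complex.Im (s n (toC x)) - complex.Im (s (k + n0)%N (toC x))) @ \oo -->
        complex.Im (s n (toC x)) - complex.Im (f (toC x)).
      apply: cvgB; first exact: cvg_cst.
      exact: (shift (fun k => complex.Im (s k (toC x))) _ (cvgIm _ xD)).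
    have hD := cvgD (cvgM hre hre) (cvgM him him).
    rewrite /normsq Re_sub Im_sub !expr2.
    rewrite (_ : fine \o _ = fun k =>
      (complex.Re (s n (toC x)) - complex.Re (s (k + n0)%N (toC x))) *
      (complex.Re (s n (toC x)) - complex.Re (s (k + n0)%N (toC x))) +
      (complex.Im (s n (toC x)) - complex.Im (s (k + n0)%N (toC x))) *
      (complex.Im (s n (toC x)) - complex.Im (s (k + n0)%N (toC x)))).
      exact: hD.
    by apply/funext => k; rewrite /= /normsq Re_sub Im_sub !expr2.
  apply: limn_einf_le => k.
  have i_k : dA_integrable R (fun z => normsq (s n z - s (k + n0)%N z)).
    by have [_ /inL2DE []] := bergman_sub _ _ (bs n) (bs (k + n0)%N).
  have := hn n (k + n0)%N hn' (leq_addl _ _).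
  rewrite /dA_int ler_pdivrMr ?pi_gt0 // mulrC -lee_fin /Rintegral fineK //.
  by apply: integrable_fin_num => //; exact: measurable_disc2.
have msf n : cmeasurable R (fun z => s n z - f z) by exact: cmeasurableB.
have L2 (e : R) : 0 < e -> exists n0, forall n, (n0 <= n)%N ->
    inL2D (fun z => s n z - f z) /\ dA_int (fun z => normsq (s n z - f z)) <= e.
  move=> e0; have [n0 hn] := main e e0; exists n0 => n /hn le.
  have i_n : dA_integrable R (fun z => normsq (s n z - f z)).
    apply/integrableP; split.
      by apply/measurable_EFinP; exact: (measurable_normsq R _ (msf n)).
    apply: le_lt_trans (ltry (pi * e)); apply: le_trans le.
    rewrite le_eqVlt; apply/orP; left; apply/eqP; apply: eq_integral => x _.
    by rewrite /= ger0_norm // normsq_ge0.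
  split; first by apply/inL2DE.
  rewrite /dA_int ler_pdivrMr ?pi_gt0 // mulrC -lee_fin /Rintegral fineK //.
  by apply: integrable_fin_num => //; exact: measurable_disc2.
exists f; last by move=> e /L2 [n0 hn]; exists n0 => n /hn [].
split=> //; have [n0 /(_ n0 (leqnn _)) [h _]] := L2 1 ltr01.
have [_ Ls] := bs n0.
have := inL2D_sub R _ _ Ls h.
by congr (inL2D _); apply/funext => z; ring.
Unshelve. all: by end_near. Qed.

End bergman_complete.

(** * Toeplitz operators with coercive symbol *)

Section coercive.
Variable R : realType.
Local Notation C := R[i].
Local Notation nc := (@Normc.normc R).
Implicit Types (f g h u v phi : C -> C).

(** The imaginary part of [<u, h>] is the real part of [<u, i h>], and [i h] is again in the Bergman
    space. *)
Lemma inner_eq0_of_rinner u : (forall h, bergman h -> rinner R u h = 0) ->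
  forall h, bergman h -> inner u h = 0.
Proof.
move=> hu h bh; rewrite /inner -/(rinner R u h) hu //.
suff -> : dA_int (fun z => complex.Im (u z * (h z)^*)) = rinner R u (fun z => 'i%C * h z).
  by rewrite hu //; exact: bergman_scale.
apply: eq_dA_int => z _; rewrite Im_mul_conj Re_mul_conj Re_mul Im_mul /=; ring.
Qed.

Lemma rinner_of_inner_eq0 u h : inner u h = 0 -> rinner R u h = 0.
Proof. by move/(congr1 (@complex.Re R)). Qed.

Lemma rinnerBl u v h : inL2D u -> inL2D v -> inL2D h ->
  rinner R (fun z => u z - v z) h = rinner R u h - rinner R v h.
Proof.
move=> Lu Lv Lh; have e := rinner_linear R (-1) v u h Lv Lu Lh.
have -> : (fun z => u z - v z) = (fun z => (-1)%:C%C * v z + u z).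
  by apply/funext => z; rewrite rmorphN rmorph1 mulN1r addrC.
by rewrite e mulN1r addrC.
Qed.

(** Young's inequality; the weight [s] is tuned so that one of the two squares can be absorbed after
    integration. *)
Lemma Re_mul_conj_amgm (z w : C) (s : R) : 0 < s ->
  complex.Re (z * w^*) <= s / 2 * normsq w + (2 * s)^-1 * normsq z.
Proof.
move=> s0; rewrite Re_mul_conj /normsq; case: z => a b; case: w => c d /=.
have h (x y : R) : x * y <= s / 2 * y ^+ 2 + (2 * s)^-1 * x ^+ 2.
  have -> : s / 2 * y ^+ 2 + (2 * s)^-1 * x ^+ 2 = x * y + (2 * s)^-1 * (s * y - x) ^+ 2.
    by field; rewrite gt_eqF.
  by rewrite lerDl mulr_ge0 ?sqr_ge0 // invr_ge0 mulr_ge0 // ltW.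
by have := h a c; have := h b d; clear; lra.
Qed.

Variables (phi : C -> C) (delta M : R).
Hypotheses (mphi : cmeasurable R phi) (delta0 : 0 < delta).
Hypothesis phi_bd : forall z, in_disc z -> normsq (phi z) <= M.
Hypothesis phi_co : forall z, in_disc z -> delta <= complex.Re (phi z).

Lemma coercive_rinner f : inL2D f ->
  delta * dA_int (fun z => normsq (f z)) <= rinner R (fun z => phi z * f z) f.
Proof.
move=> Lf; have /inL2DE [mf i_f] := Lf; rewrite -dA_intZ //.
apply: dA_int_le; first exact: dA_integrableZ.
  by apply: rinner_integrable => //; exact: inL2D_mul phi_bd Lf.
move=> z zD; rewrite Re_mul_conj Re_mul Im_mul.
have := phi_co z zD; rewrite /normsq.
move: (complex.Re (f z)) (complex.Im (f z)) (complex.Re (phi z)) (complex.Im (phi z)) => a b c d h.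
have -> : (c * a - d * b) * a + (c * b + d * a) * b = c * (a ^+ 2 + b ^+ 2) by ring.
by apply: ler_wpM2r => //; rewrite addr_ge0 ?sqr_ge0.
Qed.

(** Testing [T f = g] against [f]: [delta ||f||^2 <= Re <g, f>], and Young's inequality with weight
    [delta] absorbs half of the left side. *)
Lemma coercive_bound f g : bergman f -> toeplitz phi f g ->
  delta ^+ 2 * dA_int (fun z => normsq (f z)) <= dA_int (fun z => normsq (g z)).
Proof.
move=> bf [bg orth]; have [_ Lf] := bf; have [_ Lg] := bg.
have Lpf : inL2D (fun z => phi z * f z) by exact: inL2D_mul phi_bd Lf.
have /rinner_of_inner_eq0 := orth f bf; rewrite rinnerBl // => /eqP.
rewrite subr_eq0 => /eqP e.
have h1 := coercive_rinner f Lf; rewrite e in h1.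
have /inL2DE [_ i_f] := Lf; have /inL2DE [_ i_g] := Lg.
have h2 : rinner R g f <= delta / 2 * dA_int (fun z => normsq (f z)) +
    (2 * delta)^-1 * dA_int (fun z => normsq (g z)).
  rewrite -!dA_intZ // -dA_intD; try exact: dA_integrableZ.
  apply: dA_int_le; first exact: rinner_integrable.
    by apply: dA_integrableD; exact: dA_integrableZ.
  by move=> z _; exact: Re_mul_conj_amgm.
move: h1 h2; set F := dA_int _; set G := dA_int _ => h1 h2.
have h3 : delta / 2 * F <= (2 * delta)^-1 * G by move: h1 h2; lra.
have h4 : 2 * delta * (delta / 2 * F) <= 2 * delta * ((2 * delta)^-1 * G).
  by apply: ler_wpM2l => //; rewrite mulr_ge0 // ltW.
have e1 : 2 * delta * (delta / 2 * F) = delta ^+ 2 * F by field.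
have e2 : 2 * delta * ((2 * delta)^-1 * G) = G by field; rewrite gt_eqF.
by rewrite e1 e2 in h4.
Qed.

Lemma coercive_surjective g : bergman g -> exists f, bergman f /\ toeplitz phi f g.
Proof.
move=> bg; have [_ Lg] := bg.
pose M' := M + delta ^+ 2 + 1.
have M0 : 0 <= M.
  apply: (le_trans (normsq_ge0 R (phi 0))); apply: phi_bd.
  by rewrite /in_disc normr0 ltr01.
have d20 : 0 < delta ^+ 2 by rewrite exprn_gt0.
have M'0 : 0 < M' by rewrite /M'; move: M0 d20; lra.
(* [|1 - rho phi|^2 <= 1 - 2 rho delta + rho^2 M'] is smallest for this [rho], with value [k2]; the
   summand [delta ^+ 2] of [M'] keeps [k2] nonnegative. *)
pose rho := delta / M'; have rho0 : 0 < rho by rewrite divr_gt0.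
pose k2 := 1 - delta ^+ 2 / M'.
have k20 : 0 <= k2.
  by rewrite subr_ge0 ler_pdivrMr // mul1r /M'; move: M0; lra.
have k21 : k2 < 1 by rewrite ltrBlDr ltrDl divr_gt0.
pose k := Num.sqrt k2.
have kk : 0 <= k < 1.
  by rewrite sqrtr_ge0 -sqrtr1 ltr_sqrt.
(* [Rcomplex R] is [R[i]] as a real vector space, so the functions form a module over [R]; [linE]
   identifies its operations with complex multiplication by real numbers. *)
pose V : lmodType R := (C -> Rcomplex R)%type.
pose T (u : V) : V := fun z => (1 - rho%:C%C * phi z) * u z.
have linE a (u v : V) : (a *: u + v : V) = (fun z => a%:C%C * u z + v z).
  apply/funext => z; rewrite -[LHS]/(a *: u z + v z); congr (_ + _).
  by case: (u z) => x y; apply/eqP; rewrite eq_complex /= !mul0r subr0 addr0 !eqxx.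
have mT : cmeasurable R (fun z => 1 - rho%:C%C * phi z).
  apply: cmeasurableB; first exact: cmeasurable_cst.
  by apply: cmeasurableM => //; exact: cmeasurable_cst.
have Tb z : in_disc z -> normsq (1 - rho%:C%C * phi z) <= k2.
  move=> zD; have h1 := phi_bd z zD; have h2 := phi_co z zD.
  have -> : normsq (1 - rho%:C%C * phi z) =
      1 - 2 * rho * complex.Re (phi z) + rho ^+ 2 * normsq (phi z).
    by rewrite /normsq; case: (phi z) => x y /=; ring.
  have h3 : 2 * rho * delta <= 2 * rho * complex.Re (phi z).
    by apply: ler_wpM2l => //; rewrite mulr_ge0 // ltW.
  have h4 : rho ^+ 2 * normsq (phi z) <= rho ^+ 2 * M'.
    by apply: ler_wpM2l; rewrite ?sqr_ge0 //; apply: (le_trans h1); rewrite /M'; move: d20; lra.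
  have e1 : 2 * rho * delta = 2 * (delta ^+ 2 / M') by rewrite /rho; field; rewrite gt_eqF.
  have e2 : rho ^+ 2 * M' = delta ^+ 2 / M' by rewrite /rho; field; rewrite gt_eqF.
  by rewrite /k2; move: h3 h4; rewrite e1 e2; lra.
have [] := @contraction_projection_fixpoint R V (@inL2D R) (@bergman R) (rinner R)
  _ _ _ _ _ _ _ _ T k (fun z => rho%:C%C * g z) kk.
- by move=> a u v Lu Lv; rewrite linE; apply: inL2D_add => //; exact: inL2D_scale.
- by move=> a u v Lu Lv; rewrite linE; apply: bergman_add => //; exact: bergman_scale.
- have := bergman_scale R 0 g bg.
  by congr bergman; apply/funext => z; rewrite mul0r.
- by move=> u [].
- by move=> u v; exact: rinnerC.
- by move=> a u v w Lu Lv Lw; rewrite linE; exact: rinner_linear.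
- by move=> u; exact: rinner_ge0.
- move=> s bs cs; have [|f bf hf] := bergman_complete R s bs.
    move=> e /cs [n0 hn]; exists n0 => i j hi hj.
    by rewrite -(rinnerxx R (fun z => s i z - s j z)); exact: hn.
  exists f => // e /hf [n0 hn]; exists n0 => n /hn.
  by rewrite -(rinnerxx R (fun z => s n z - f z)).
- exact: inL2D_scale.
- by move=> u Lu; exact: (inL2D_mul R _ _ _ mT Tb Lu).
- move=> u v Lu Lv.
  have Luv : inL2D (fun z => u z - v z) by exact: inL2D_sub.
  have /inL2DE [_ i1] := Luv.
  have /inL2DE [_ i2] := inL2D_mul R _ _ _ mT Tb Luv.
  rewrite sqr_sqrtr // -[u - v]/(fun z => u z - v z).
  have -> : T u - T v = (fun z => (1 - rho%:C%C * phi z) * (u z - v z)).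
    by apply/funext => z; rewrite mulrBr.
  rewrite !rinnerxx -dA_intZ //; apply: dA_int_le => //; first exact: dA_integrableZ.
  move=> z zD; rewrite normsqM; apply: ler_wpM2r; first exact: normsq_ge0.
  exact: Tb.
move=> f bf orth; exists f; split=> //; split=> //.
apply: inner_eq0_of_rinner => h bh.
have [_ Lf] := bf; have [_ Lh] := bh.
have Lpf : inL2D (fun z => phi z * f z) by exact: inL2D_mul phi_bd Lf.
have Ld : inL2D (fun z => phi z * f z - g z) by exact: inL2D_sub.
have L0 : inL2D (fun z => (0 : C)).
  by apply: (inL2D_bounded R _ 0); [exact: cmeasurable_cst | move=> z _; rewrite /normsq /= expr0n addr0].
have := rinner_linear R (- rho) _ _ _ Ld L0 Lh.
have -> : rinner R (fun z => 0) h = 0.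
  have := rinner_linear R 0 _ _ _ L0 L0 Lh; rewrite mul0r add0r.
  have := rinner_linear R 1 _ _ _ L0 L0 Lh.
  have -> : (fun z : C => 1%:C%C * 0 + 0) = (fun z => 0 : C) by apply/funext => z; rewrite mulr0 addr0.
  by move=> h1 _; move: h1; rewrite mul1r; lra.
(* The fixed point equation says that [(1 - rho phi) f + rho g - f = - rho (phi f - g)] is
   orthogonal to the Bergman space; it remains to divide by [- rho]. *)
have -> : (fun z => (- rho)%:C%C * (phi z * f z - g z) + 0) =
    (T f + (fun z => rho%:C%C * g z) - f : V).
  apply/funext => z; rewrite addr0.
  rewrite -[RHS]/((1 - rho%:C%C * phi z) * f z + rho%:C%C * g z - f z) rmorphN; ring.
rewrite orth // addr0 => /eqP; rewrite eq_sym mulf_eq0 oppr_eq0 gt_eqF //=.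
by move/eqP.
Qed.

Lemma coercive_invertible : toeplitz_invertible phi.
Proof.
split; first exact: coercive_surjective.
have d20 : 0 < delta ^+ 2 by rewrite exprn_gt0.
split.
  move=> f1 f2 g bf1 bf2 t1 t2.
  pose f z := f1 z - f2 z; have bf : bergman f by exact: bergman_sub.
  have [_ Lf1] := bf1; have [_ Lf2] := bf2; have [_ Lf] := bf.
  have [[_ Lg] o1] := t1; have [_ o2] := t2.
  have Lp1 : inL2D (fun z => phi z * f1 z) by exact: inL2D_mul phi_bd Lf1.
  have Lp2 : inL2D (fun z => phi z * f2 z) by exact: inL2D_mul phi_bd Lf2.
  have e1 := rinner_of_inner_eq0 _ _ (o1 f bf); rewrite rinnerBl // in e1.
  have e2 := rinner_of_inner_eq0 _ _ (o2 f bf); rewrite rinnerBl // in e2.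
  have e : rinner R (fun z => phi z * f z) f = 0.
    have -> : (fun z => phi z * f z) = (fun z => phi z * f1 z - phi z * f2 z).
      by apply/funext => z; rewrite /f mulrBr.
    by rewrite rinnerBl //; move: e1 e2; lra.
  have := coercive_rinner f Lf; rewrite e => h.
  have I0 : dA_int (fun z => normsq (f z)) = 0.
    apply/eqP; rewrite eq_le; apply/andP; split; last first.
      by apply: dA_int_ge0 => z _; exact: normsq_ge0.
    by rewrite -(ler_pM2l delta0) mulr0.
  (* Bounded point evaluation turns a zero norm into vanishing at every point of the disc. *)
  move=> z zD; have [r [K [r0 _ ev]]] := bergman_local_eval R z zD.
  have := ev f z bf; rewrite I0 mulr0 subrr Normc.normc0 mulr_gt0 // => /(_ isT) nf.
  apply/eqP; rewrite -subr_eq0 -normc_eq0 -sqrf_eq0 normc_sqr.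
  by rewrite eq_le nf normsq_ge0.
exists delta^-1; split; first by rewrite invr_gt0.
move=> f g bf tf; have := coercive_bound f g bf tf.
rewrite /normA2; set F := dA_int _; set G := dA_int _ => h.
have F0 : 0 <= F by apply: dA_int_ge0 => z _; exact: normsq_ge0.
rewrite -(ler_pM2l delta0) mulrA mulfV ?gt_eqF // mul1r.
have -> : delta * Num.sqrt F = Num.sqrt (delta ^+ 2 * F).
  rewrite [RHS]sqrtrM; last exact: sqr_ge0.
  by rewrite sqrtr_sqr ger0_norm // ltW.
exact: ler_wsqrtr.
Qed.

End coercive.

(** * Symbols vanishing on the circle *)

Section vanishing.
Variable R : realType.
Local Notation C := R[i].
Local Notation nc := (@Normc.normc R).
Local Notation m := (@area R).
Implicit Types (f g phi : C -> C).

Lemma normsqX (z : C) n : normsq (z ^+ n) = normsq z ^+ n.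
Proof.
elim: n => [|n IH]; last by rewrite !exprS normsqM IH.
by rewrite !expr0 -normc_sqr Normc.normc1 expr1n.
Qed.

(* Testing [T f = g] against [g] itself turns the bound on the inverse into a
   lower bound for multiplication by [phi]. *)
Lemma invertible_lower_bound phi (M : R) : cmeasurable R phi ->
  (forall z, in_disc z -> normsq (phi z) <= M) -> toeplitz_invertible phi ->
  exists2 c, 0 < c & forall g, bergman g ->
    dA_int (fun z => normsq (g z)) <= c * dA_int (fun z => normsq (phi z) * normsq (g z)).
Proof.
move=> mphi bd [surj [_ [c0 [c00 bnd]]]]; exists (c0 ^+ 2); first exact: exprn_gt0.
move=> g bg; have [f [bf tf]] := surj g bg.
have [_ Lf] := bf; have [_ Lg] := bg; have [_ orth] := tf.
have Lpf : inL2D (fun z => phi z * f z) by exact: (inL2D_mul R _ _ _ mphi bd Lf).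
have Lpg : inL2D (fun z => phi z * g z) by exact: (inL2D_mul R _ _ _ mphi bd Lg).
have /inL2DE [_ i_f] := Lf; have /inL2DE [_ i_pg] := Lpg.
have ipg : dA_integrable R (fun z => normsq (phi z) * normsq (g z)).
  by move: i_pg; congr dA_integrable; apply/funext => z; rewrite normsqM.
have fg := bnd f g bf tf; rewrite /normA2 in fg.
have e := rinner_of_inner_eq0 R _ _ (orth g bg); rewrite rinnerBl // rinnerxx in e.
move: e => /eqP; rewrite subr_eq0 => /eqP e.
(* [phi] is moved onto [g], and Young's inequality has weight [c0 ^+ 2]: since
   [||f||^2 <= c0^2 ||g||^2], the last term is at most half of [||g||^2] and is absorbed. *)
have le : rinner R (fun z => phi z * f z) g <=
    c0 ^+ 2 / 2 * dA_int (fun z => normsq (phi z) * normsq (g z)) +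
    (2 * c0 ^+ 2)^-1 * dA_int (fun z => normsq (f z)).
  rewrite -!dA_intZ // -dA_intD; try exact: dA_integrableZ.
  apply: dA_int_le; first exact: rinner_integrable.
    by apply: dA_integrableD; exact: dA_integrableZ.
  move=> z _.
  have -> : phi z * f z * (g z)^* = f z * ((phi z)^* * g z)^*.
    by rewrite rmorphM /= conjCK; ring.
  apply: (le_trans (Re_mul_conj_amgm R _ _ _ (exprn_gt0 2 c00))).
  have -> : normsq ((phi z)^* * g z) = normsq (phi z) * normsq (g z).
    by rewrite normsqM; congr (_ * _); rewrite /normsq; case: (phi z) => a b /=; ring.
  by [].
have G0 : 0 <= dA_int (fun z => normsq (g z)) by apply: dA_int_ge0 => z _; exact: normsq_ge0.
have F0 : 0 <= dA_int (fun z => normsq (f z)) by apply: dA_int_ge0 => z _; exact: normsq_ge0.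
rewrite e in le; move: le fg G0 F0.
move: (dA_int (fun z => normsq (f z))) (dA_int (fun z => normsq (g z)))
  (dA_int (fun z => normsq (phi z) * normsq (g z))) => F G H le fg G0 F0.
have FG : F <= c0 ^+ 2 * G.
  rewrite -(sqr_sqrtr F0) -(sqr_sqrtr G0) -exprMn ler_pXn2r ?nnegrE ?sqrtr_ge0 //.
  by rewrite mulr_ge0 ?sqrtr_ge0 // ltW.
have h : (2 * c0 ^+ 2)^-1 * F <= G / 2.
  have -> : G / 2 = (2 * c0 ^+ 2)^-1 * (c0 ^+ 2 * G) by field; rewrite gt_eqF.
  by apply: ler_wpM2l => //; rewrite invr_ge0 mulr_ge0 // sqr_ge0.
by move: le h; clear; lra.
Qed.

(** Provides a set of positive area near [zeta] on which the peaking functions are bounded below. *)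
Lemma dA_int_box_gt0 (a b a' b' : R) : a < b -> a' < b' ->
  (forall x y, a <= x <= b -> a' <= y <= b' -> in_disc (Complex x y)) ->
  exists2 chi : C -> R, dA_integrable R chi /\ 0 < dA_int chi &
    forall z, chi z = (if (a <= complex.Re z <= b) && (a' <= complex.Im z <= b')
                       then 1 else 0).
Proof.
move=> ab ab' inD; pose I : set R := `[a, b]%classic; pose J : set R := `[a', b']%classic.
pose S : set (R2 R) := I `*` J.
have mI : measurable I by exact: measurable_itv.
have mJ : measurable J by exact: measurable_itv.
have mS : measurable S by exact: measurableX.
pose chi (z : C) : R := if (a <= complex.Re z <= b) && (a' <= complex.Im z <= b') then 1 else 0.
have chiE (x : R2 R) : chi (toC x) = \1_S x.
  rewrite indicE /chi /=; case: ifPn => h.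
    by rewrite mem_set //; case/andP: h; split; rewrite ?/I ?/J /= in_itv.
  rewrite memNset // => -[h1 h2]; move/negP: h; apply; move: h1 h2.
  by rewrite /I /J /= !in_itv /= => -> ->.
exists chi => //.
have mchi : measurable_fun (@disc2 R) (fun x => chi (toC x)).
  under eq_fun do rewrite chiE; exact: measurable_indic.
split.
  apply: (dA_integrable_le R _ (fun=> 1) mchi); last exact: dA_integrable_cst.
  by move=> z _; rewrite /chi; case: ifP; rewrite ?normr1 ?normr0 ?ler01.
apply: divr_gt0; last exact: pi_gt0.
rewrite /Rintegral.
under eq_integral do rewrite chiE.
rewrite integral_indic //; last exact: measurable_disc2.
have -> : S `&` @disc2 R = S.
  apply/setIidl => -[x y] [h1 h2]; move: h1 h2; rewrite /I /J /= !in_itv /= => h1 h2.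
  by apply/disc2E; exact: inD.
have -> : m S = ((b - a) * (b' - a'))%:E.
  have -> : m S = (lebesgue_measure I * lebesgue_measure J)%E by exact: product_measure1E.
  by rewrite /I /J !lebesgue_measure_itv /= !lte_fin ab ab' -!EFinB -EFinM.
by rewrite /= mulr_gt0 // subr_gt0.
Qed.

Lemma geometric_domination (al be A B : R) : 0 <= al -> al < be -> 0 < A ->
  exists n : nat, B * al ^+ n < A * be ^+ n.
Proof.
move=> al0 alb A0; have be0 : 0 < be by apply: le_lt_trans alb.
have : (fun n => B * (al / be) ^+ n) @ \oo --> (0 : R).
  rewrite -(mulr0 B); apply: cvgMr; apply: cvg_expr.
  by rewrite ger0_norm ?divr_ge0 // ?ltr_pdivrMr ?mul1r // ltW.
move/cvgrPdist_lt => /(_ A A0) [n _ hn]; exists n.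
have := hn n (leqnn n); rewrite /= sub0r normrN => /(le_lt_trans (ler_norm _)).
by rewrite expr_div_n mulrA ltr_pdivrMr // exprn_gt0.
Qed.

Definition peak (zeta z : C) : C := (2^-1)%:C%C * (1 + z * zeta^*).

(** For unimodular [zeta], [|1 + z conj zeta| = |z + zeta|]; the formula is then the parallelogram
    law. *)
Lemma normsq_peakE (zeta z : C) : normsq zeta = 1 ->
  normsq (peak zeta z) = (2 + 2 * normsq z - normsq (z - zeta)) / 4.
Proof.
rewrite /peak normsqM; case: zeta => a b; case: z => x y; rewrite /normsq /= => e.
have -> : (2^-1 ^+ 2 + 0 ^+ 2) * ((1 + (x * a - y * - b)) ^+ 2 + (0 + (x * - b + y * a)) ^+ 2) =
  (1 + 2 * (x * a + y * b) + (x ^+ 2 + y ^+ 2) * (a ^+ 2 + b ^+ 2)) / 4 by field.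
have -> : (x - a) ^+ 2 + (y - b) ^+ 2 =
  x ^+ 2 + y ^+ 2 + (a ^+ 2 + b ^+ 2) - 2 * (x * a + y * b) by ring.
by rewrite e; field.
Qed.

Lemma normsq_peak_le (zeta z : C) : normsq zeta = 1 -> in_disc z ->
  normsq (peak zeta z) <= 1 - normsq (z - zeta) / 4.
Proof. by move=> z1 /in_discE; rewrite normsq_peakE //; move: (normsq z) (normsq (z - zeta)) => x y; lra. Qed.

(** With [y = |z - zeta| <= 1] one has [|z| >= 1 - y], and [normsq_peakE] gives at least
    [1 - y + y^2 / 4]; for [y > 1] the bound is trivial. *)
Lemma normsq_peak_ge (zeta z : C) : normsq zeta = 1 ->
  1 - nc (z - zeta) <= normsq (peak zeta z).
Proof.
move=> z1; have [y1|y1] := leP (nc (z - zeta)) 1; last first.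
  by apply: (@le_trans _ _ 0); [rewrite subr_le0 ltW | exact: normsq_ge0].
rewrite normsq_peakE // -!normc_sqr; have zeta1 : nc zeta = 1.
  by apply/eqP; rewrite -(@eqrXn2 _ 2) ?normc_ge0 // normc_sqr z1 expr1n.
have : 1 <= nc z + nc (z - zeta).
  have := normcB _ z (z - zeta).
  by rewrite (_ : z - (z - zeta) = zeta) ?zeta1 //; ring.
have := normc_ge0 _ z; have := normc_ge0 _ (z - zeta).
move: (nc z) (nc (z - zeta)) y1 => x y y1 y0 x0 h.
have : (1 - y) ^+ 2 <= x ^+ 2 by rewrite ler_pXn2r ?nnegrE //; lra.
by have := sqr_ge0 y; rewrite !expr2; clear; lra.
Qed.

Lemma bergman_peakX (zeta : C) n : normsq zeta = 1 -> bergman (fun z => peak zeta z ^+ n).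
Proof.
move=> zeta1; have mp : cmeasurable R (peak zeta).
  apply: cmeasurableM; first exact: cmeasurable_cst.
  apply: cmeasurableD; first exact: cmeasurable_cst.
  by apply: cmeasurableM; [exact: cmeasurable_id | exact: cmeasurable_cst].
have dp z : derivable (peak zeta : C^o -> C^o) z 1.
  apply: (derivableC_mul R (fun=> (2^-1)%:C%C) (fun z => 1 + z * zeta^*)).
    exact: derivableC_cst.
  apply: (@derivableD _ C^o C^o (fun=> 1) (fun z => z * zeta^*)); first exact: derivableC_cst.
  apply: (derivableC_mul R id (fun=> zeta^*)); last exact: derivableC_cst.
  exact: (@derivable_id _ C^o).
split.
  move=> z _; elim: n => [|n IH].
    have -> : (fun z => peak zeta z ^+ 0) = (fun=> 1) by apply/funext => ?; rewrite expr0.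
    exact: derivableC_cst.
  have -> : (fun z => peak zeta z ^+ n.+1) = (fun z => peak zeta z * peak zeta z ^+ n).
    by apply/funext => ?; rewrite exprS.
  exact: (derivableC_mul R (peak zeta) (fun z => peak zeta z ^+ n) z (dp z) IH).
apply: (inL2D_bounded R _ 1); first exact: cmeasurableX.
move=> z zD; have le1 : normsq (peak zeta z) <= 1.
  have := normsq_peak_le zeta z zeta1 zD; have := normsq_ge0 R (z - zeta).
  by move: (normsq (peak zeta z)) (normsq (z - zeta)) => x y; lra.
by rewrite normsqX; apply: exprn_ile1 => //; exact: normsq_ge0.
Qed.

(** For [g = peak ^ n], the difference [|g|^2 - c |phi|^2 |g|^2] is at least [|g|^2 / 2] near [zeta]
    and at least [- 4 c W al^n] elsewhere. On a box near [zeta], [|g|^2 >= be^n] with [be > al], so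
    for large [n] the integral is positive, against the lower bound for multiplication by [phi]. *)
Lemma vanishing_not_invertible phi (zeta : C) (W : R) : cmeasurable R phi ->
  normsq zeta = 1 -> 0 < W ->
  (forall z, in_disc z -> normsq (phi z) <= W * normsq (z - zeta)) ->
  ~ toeplitz_invertible phi.
Proof.
move=> mphi zeta1 W0 van inv.
have far z : in_disc z -> normsq (z - zeta) <= 4.
  move=> zD; have := normsq_peak_le zeta z zeta1 zD; have := normsq_ge0 R (peak zeta z).
  by move: (normsq (peak zeta z)) (normsq (z - zeta)) => x y; clear; lra.
have bd z : in_disc z -> normsq (phi z) <= W * 4.
  by move=> zD; apply: (le_trans (van z zD)); apply: ler_wpM2l; [exact: ltW | exact: far].
have [c c0 low] := invertible_lower_bound phi (W * 4) mphi bd inv.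
have cW0 : 0 < c * W by exact: mulr_gt0.
(* Where [|z - zeta|^2 <= q], [c |phi|^2 <= c W q <= 1 / 2]. *)
pose q := (2 * (c * W) + 1)^-1.
have q0 : 0 < q by rewrite invr_gt0; move: cW0; clear; lra.
have P0 : 0 < 2 * (c * W) + 1 by move: cW0; clear; lra.
have q1 : q <= 1 by rewrite /q invf_le1 //; move: cW0; clear; lra.
have cWq : c * W * q <= 2^-1.
  by rewrite /q ler_pdivrMr //; move: cW0; clear; lra.
pose eta := q / 8; have eta0 : 0 < eta by rewrite divr_gt0.
have eta1 : eta <= 1 / 8 by rewrite /eta; move: q1; clear; lra.
case: zeta zeta1 van far => z1 z2 zeta1 van far; set zeta := Complex z1 z2 in zeta1 van far *.
have nz1 : nc zeta = 1.
  by apply/eqP; rewrite -(@eqrXn2 _ 2) ?normc_ge0 // normc_sqr zeta1 expr1n.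
(* A box centred at [(1 - eta / 2) zeta] whose points are within [eta / 4] of the centre: it lies in
   the disc and within [eta] of [zeta]. *)
pose c1 := (1 - eta / 2) * z1; pose c2 := (1 - eta / 2) * z2; pose d := eta / 8.
have d0 : 0 < d by rewrite divr_gt0.
have near x y : c1 - d <= x <= c1 + d -> c2 - d <= y <= c2 + d ->
    nc (Complex x y - Complex c1 c2) <= eta / 4.
  move=> hx hy; apply: (le_trans (normc_le_ReIm _ _)) => /=.
  have h1 : `|x - c1| <= d by rewrite ler_norml; move: hx; clear; lra.
  have h2 : `|y - c2| <= d by rewrite ler_norml; move: hy; clear; lra.
  by move: h1 h2; rewrite /d; clear; lra.
have cE : Complex c1 c2 = (1 - eta / 2)%:C%C * zeta.
  by apply/eqP; rewrite eq_complex /= /c1 /c2 !mul0r subr0 addr0 !eqxx.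
have ncr (r : R) : nc r%:C%C = `|r| by rewrite /= expr0n addr0 sqrtr_sqr.
have box_disc x y : c1 - d <= x <= c1 + d -> c2 - d <= y <= c2 + d ->
    in_disc (Complex x y).
  move=> hx hy; rewrite /in_disc normCE -[1]/(1%:C%C) ltcR.
  have -> : Complex x y = (Complex x y - Complex c1 c2) + Complex c1 c2 by rewrite subrK.
  apply: (le_lt_trans (normcD _ _ _)); have := near x y hx hy.
  rewrite cE [X in _ -> _ + X < _]normcM nz1 mulr1 ncr ger0_norm; last by move: eta1; clear; lra.
  by move: eta0; clear; lra.
have box_near x y : c1 - d <= x <= c1 + d -> c2 - d <= y <= c2 + d ->
    nc (Complex x y - zeta) <= eta.
  move=> hx hy.
  have -> : Complex x y - zeta = (Complex x y - Complex c1 c2) + (Complex c1 c2 - zeta).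
    by rewrite addrA subrK.
  apply: (le_trans (normcD _ _ _)); have := near x y hx hy.
  have -> : Complex c1 c2 - zeta = (- (eta / 2))%:C%C * zeta.
    rewrite cE -{2}[zeta]mul1r -mulrBl; congr (_ * _); apply/eqP.
    by rewrite eq_complex /= subr0 eqxx andbT; apply/eqP; ring.
  rewrite [X in _ -> _ + X <= _]normcM nz1 mulr1 ncr normrN ger0_norm; last by move: eta0; clear; lra.
  by move: eta0; clear; lra.
have [||chi [ichi chi0] chiE] := dA_int_box_gt0 (c1 - d) (c1 + d) (c2 - d) (c2 + d) _ _ box_disc.
- by move: d0; clear; lra.
- by move: d0; clear; lra.
(* [al] bounds [|peak|^2] from above where [|z - zeta|^2 > q], [be] from below on the box;
   [eta = q / 8] gives [al < be]. *)
pose al := 1 - q / 4; pose be := 1 - eta.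
have al0 : 0 <= al by rewrite /al; move: q1; clear; lra.
have be0 : 0 <= be by rewrite /be; move: eta1; clear; lra.
have alb : al < be by rewrite /al /be /eta; move: q0; clear; lra.
have A0 : 0 < 2^-1 * dA_int chi by rewrite mulr_gt0 // invr_gt0.
have [n hn] := geometric_domination al be (2^-1 * dA_int chi)
  (c * (W * 4) * dA_int (fun _ : C => 1)) al0 alb A0.
pose g z := peak zeta z ^+ n.
have bg : bergman g by exact: bergman_peakX.
have gE z : normsq (g z) = normsq (peak zeta z) ^+ n.
  exact: normsqX.
have [_ Lg] := bg; have /inL2DE [mg ig] := Lg.
have ipg : dA_integrable R (fun z => normsq (phi z) * normsq (g z)).
  have /inL2DE [_] := inL2D_mul R _ _ _ mphi bd Lg.
  by congr dA_integrable; apply/funext => z; rewrite normsqM.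
have key : 2^-1 * be ^+ n * dA_int chi + - (c * (W * 4) * al ^+ n) * dA_int (fun _ : C => 1) <=
    dA_int (fun z => normsq (g z)) + - c * dA_int (fun z => normsq (phi z) * normsq (g z)).
  have i1 := dA_integrable_cst R 1.
  rewrite -!dA_intZ // -!dA_intD //; try exact: dA_integrableZ.
  apply: dA_int_le; try by apply: dA_integrableD => //; exact: dA_integrableZ.
  move=> z zD; rewrite mulr1.
  have p0 := normsq_ge0 R (peak zeta z).
  have ph0 := normsq_ge0 R (phi z).
  have aln : 0 <= c * (W * 4) * al ^+ n.
    by rewrite mulr_ge0 ?exprn_ge0 // mulr_ge0 ?ltW // mulr_gt0.
  have gz0 : 0 <= normsq (g z) by exact: normsq_ge0.
  have [hq|hq] := leP (normsq (z - zeta)) q.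
    have cphi : c * normsq (phi z) <= 2^-1.
      apply: le_trans cWq; rewrite -mulrA; apply: ler_wpM2l; first exact: ltW.
      by apply: (le_trans (van z zD)); apply: ler_wpM2l => //; exact: ltW.
    have h1 : 2^-1 * normsq (g z) <= normsq (g z) + - c * (normsq (phi z) * normsq (g z)).
      have := ler_wpM2r gz0 cphi; clear; lra.
    have h2 : be ^+ n * chi z <= normsq (g z).
      rewrite chiE; case: ifPn => [/andP[hx hy]|_]; last by rewrite mulr0.
      rewrite mulr1 gE; apply: lerXn2r; rewrite ?nnegrE //.
      have := normsq_peak_ge zeta z zeta1; case: z hx hy {zD p0 ph0 gz0 hq cphi h1} => x y hx hy.
      by have := box_near x y hx hy; rewrite /be; clear; lra.
    by move: h1 h2 aln; clear; lra.
  have gal : normsq (g z) <= al ^+ n.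
    rewrite gE; apply: lerXn2r; rewrite ?nnegrE //.
    by have := normsq_peak_le zeta z zeta1 zD; move: hq; rewrite /al; clear; lra.
  (* The box lies in the region already treated, because [eta ^ 2 <= q]. *)
  have chi0z : chi z = 0.
    rewrite chiE; case: ifPn => // /andP[hx hy]; exfalso.
    move: hq; apply/negP; rewrite -leNgt -normc_sqr.
    have h : nc (z - zeta) <= eta by case: z hx hy {zD p0 ph0 gz0 gal} => x y; exact: box_near.
    have : nc (z - zeta) ^+ 2 <= eta ^+ 2 by rewrite ler_pXn2r ?nnegrE ?normc_ge0 // ltW.
    by move/le_trans; apply; rewrite expr2 /eta; move: q0 q1; clear => q0 q1; nra.
  rewrite chi0z mulr0 add0r mulNr.
  have h3 : c * (normsq (phi z) * normsq (g z)) <= c * (W * 4 * al ^+ n).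
    apply: ler_wpM2l; first exact: ltW.
    by apply: ler_pM => //; exact: bd.
  by move: h3 gz0; rewrite -!mulrA; clear; lra.
have := low g bg; move: key hn.
move: (dA_int chi) (dA_int (fun _ : C => 1)) (dA_int (fun z => normsq (g z)))
  (dA_int (fun z => normsq (phi z) * normsq (g z))) (al ^+ n) (be ^+ n) => *; nra.
Qed.

End vanishing.

(** * The harmonic polynomial symbol *)

Section trigonometric_terms.
Variable R : realType.
Local Notation C := R[i].
Local Notation nc := (@Normc.normc R).

Definition expi (t : R) : C := Complex (cos t) (sin t).

Lemma expiD (s t : R) : expi (s + t) = expi s * expi t.
Proof.
by apply/eqP; rewrite eq_complex /= cosD sinD eqxx /= addrC eqxx.
Qed.

Lemma expi0 : expi 0 = 1.
Proof. by rewrite /expi cos0 sin0. Qed.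

Lemma expiN (t : R) : expi (- t) = (expi t)^*.
Proof. by rewrite /expi cosN sinN. Qed.

Lemma normsq_expi (t : R) : normsq (expi t) = 1.
Proof. exact: cos2Dsin2. Qed.

Lemma normc_expi (t : R) : nc (expi t) = 1.
Proof. by rewrite /= cos2Dsin2 sqrtr1. Qed.

Lemma expiX (t : R) n : expi t ^+ n = expi (n%:R * t).
Proof.
elim: n => [|n IH]; first by rewrite expr0 mul0r expi0.
by rewrite exprS IH -expiD -[n.+1]add1n natrD mulrDl mul1r.
Qed.

Lemma expi_pi : expi pi = -1.
Proof. by rewrite /expi cospi sinpi; apply/eqP; rewrite eq_complex /= oppr0 !eqxx. Qed.

Lemma expi_2piz (k : int) : expi (2 * pi * k%:~R) = 1.
Proof.
have e1 : expi (2 * pi) = 1 by rewrite mulr_natl mulr2n expiD expi_pi mulrNN mulr1.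
have nat_case (n : nat) : expi (2 * pi * n%:R) = 1 by rewrite mulrC -expiX e1 expr1n.
case: k => n; first by rewrite -pmulrn nat_case.
by rewrite NegzE mulrNz mulrN expiN -pmulrn nat_case rmorph1.
Qed.

Lemma polar_unit (z : C) : normsq z = 1 -> exists2 t : R, 0 <= t <= 2 * pi & z = expi t.
Proof.
case: z => x y; rewrite /normsq /= => e.
have x1 : -1 <= x <= 1.
  rewrite -ler_norml -(@ler_pXn2r _ 2) ?nnegrE // real_normK ?num_real // expr1n.
  by have := sqr_ge0 y; move: e; clear; lra.
have ca : cos (acos x) = x by apply: acosK; rewrite in_itv /= x1.
have sa : sin (acos x) = `|y|.
  rewrite sin_acos // -sqrtr_sqr; congr Num.sqrt; move: e; clear; lra.
have a0 := acos_ge0 x1; have ap := acos_lepi x1; have pi0 := pi_ge0 R.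
have [y0|y0] := leP 0 y.
  exists (acos x); first by move: a0 ap pi0; clear; lra.
  by rewrite /expi ca sa ger0_norm.
exists (2 * pi - acos x); first by move: a0 ap pi0; clear; lra.
have := expi_2piz 1; rewrite mulr1 => e1.
by rewrite expiD e1 mul1r expiN /expi ca sa ltr0_norm // -[RHS]/(Complex x (- - y)) opprK.
Qed.

Lemma polar (z : C) : exists2 t : R, 0 <= t <= 2 * pi & z = (nc z)%:C%C * expi t.
Proof.
have [->|z0] := eqVneq z 0.
  by exists 0; rewrite ?lexx ?mulr_ge0 ?pi_ge0 // Normc.normc0 mul0r.
have n0 : (nc z)%:C%C != 0 by rewrite eq_complex /= eqxx andbT normc_eq0.
have [|t ht e] := polar_unit (z / (nc z)%:C%C).
  rewrite -normc_sqr normcM normcV [nc (_%:C%C)]/= expr0n addr0 sqrtr_sqr.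
  by rewrite ger0_norm ?normc_ge0 // mulfV ?expr1n // normc_eq0.
by exists t => //; rewrite -e mulrC divfK.
Qed.

Lemma Re_realM (r : R) (z : C) : complex.Re (r%:C%C * z) = r * complex.Re z.
Proof. by case: z => a b /=; rewrite mul0r subr0. Qed.

Lemma Re_sum (I : Type) (s : seq I) (F : I -> C) :
  complex.Re (\sum_(i <- s) F i) = \sum_(i <- s) complex.Re (F i).
Proof. by apply: (big_morph (@complex.Re R)) => //; exact: Re_add. Qed.

Lemma normc_sum_le (I : Type) (s : seq I) (F : I -> C) :
  nc (\sum_(i <- s) F i) <= \sum_(i <- s) nc (F i).
Proof.
elim: s => [|i s IH]; first by rewrite !big_nil Normc.normc0.
by rewrite !big_cons; apply: (le_trans (normcD _ _ _)); rewrite lerD2l.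
Qed.

Lemma normcX (z : C) n : nc (z ^+ n) = nc z ^+ n.
Proof.
elim: n => [|n IH]; first by rewrite !expr0 Normc.normc1.
by rewrite !exprS normcM IH.
Qed.

Lemma normc_conj (z : C) : nc z^* = nc z.
Proof. by case: z => a b /=; rewrite sqrrN. Qed.

Lemma normcX_sub_le (z w : C) n : nc z <= 1 -> nc w <= 1 ->
  nc (z ^+ n - w ^+ n) <= n%:R * nc (z - w).
Proof.
move=> z1 w1; elim: n => [|n IH]; first by rewrite !expr0 subrr Normc.normc0 mul0r.
have -> : z ^+ n.+1 - w ^+ n.+1 = z * (z ^+ n - w ^+ n) + (z - w) * w ^+ n.
  by rewrite !exprS; ring.
apply: (le_trans (normcD _ _ _)); rewrite !normcM normcX -[n.+1]addn1 natrD mulrDl mul1r.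
apply: lerD.
  by apply: le_trans IH; rewrite ler_piMl ?normc_ge0.
by rewrite ler_piMr ?normc_ge0 // exprn_ile1 // normc_ge0.
Qed.

Implicit Types S : seq (nat * C).

Lemma Re_ge_Nnormc (z : C) : - nc z <= complex.Re z.
Proof. by rewrite lerNl; apply: (le_trans _ (abs_Re_le _ z)); rewrite ler_normr lexx orbT. Qed.

Lemma term_ge S (z : C) : nc z <= 1 ->
  - (\sum_(t <- S) nc t.2) <= \sum_(t <- S) complex.Re (t.2 * z ^+ t.1).
Proof.
move=> z1; rewrite -sumrN; apply: ler_sum => t _.
apply: (le_trans _ (Re_ge_Nnormc _)); rewrite lerN2 normcM normcX.
by rewrite ler_piMr ?normc_ge0 // exprn_ile1 // normc_ge0.
Qed.

(** The numbers [|c| + Re (c e^(i k w))] are nonnegative with sum at most 0, so each vanishes; a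
    number whose real part is minus its modulus has imaginary part 0. *)
Lemma term_equality S (w : R) : \sum_(t <- S) nc t.2 = 1 ->
  1 + \sum_(t <- S) complex.Re (t.2 * expi w ^+ t.1) <= 0 ->
  forall t, t \in S -> t.2 * expi w ^+ t.1 = - (nc t.2)%:C%C.
Proof.
move=> S1 le t tS.
have nE (u : nat * C) : nc (u.2 * expi w ^+ u.1) = nc u.2.
  by rewrite normcM normcX normc_expi expr1n mulr1.
have nn (u : nat * C) : 0 <= nc u.2 + complex.Re (u.2 * expi w ^+ u.1).
  by have := Re_ge_Nnormc (u.2 * expi w ^+ u.1); rewrite nE -subr_ge0 opprK addrC.
have z : \sum_(u <- S) (nc u.2 + complex.Re (u.2 * expi w ^+ u.1)) == 0.
  rewrite eq_le; apply/andP; split; first by rewrite big_split /= S1.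
  by apply: sumr_ge0 => u _; exact: nn.
move: z; rewrite psumr_eq0; last by move=> u _; exact: nn.
move=> /allP /(_ t tS) /= /eqP e.
have a1 : complex.Re (t.2 * expi w ^+ t.1) = - nc t.2 by move: e; clear; lra.
have := normc_sqr _ (t.2 * expi w ^+ t.1); rewrite nE /normsq a1 sqrrN.
move/eqP; rewrite eq_sym -subr_eq0 addrC addKr sqrf_eq0 => /eqP a2.
by apply/eqP; rewrite eq_complex a1 a2 /= oppr0 !eqxx.
Qed.

Lemma Re_term_scale (c e : C) (r : R) n :
  complex.Re (c * (r%:C%C * e) ^+ n) = r ^+ n * complex.Re (c * e ^+ n).
Proof. by rewrite exprMn -rmorphXn mulrCA Re_realM. Qed.

Lemma term_continuous S : continuous (fun w : R => \sum_(t <- S) complex.Re (t.2 * expi w ^+ t.1)).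
Proof.
have one (t : nat * C) : continuous (fun w : R => complex.Re (t.2 * expi w ^+ t.1)).
  have -> : (fun w : R => complex.Re (t.2 * expi w ^+ t.1)) =
     (fun w => complex.Re t.2 * cos (t.1%:R * w) - complex.Im t.2 * sin (t.1%:R * w)).
    by apply/funext => w; rewrite expiX Re_mul.
  move=> w; have lin : (fun w : R => t.1%:R * w) @ w --> t.1%:R * w by apply: cvgMr; exact: cvg_id.
  apply: cvgB; apply: cvgMr.
    by apply: (@continuous_comp _ _ _ (fun w : R => t.1%:R * w) cos w lin); exact: continuous_cos.
  by apply: (@continuous_comp _ _ _ (fun w : R => t.1%:R * w) sin w lin); exact: continuous_sin.
elim: S => [|t S IH] w.
  have -> : (fun w : R => \sum_(t <- [::] : seq (nat * C)) complex.Re (t.2 * expi w ^+ t.1)) = cst 0.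
    by apply/funext => ?; rewrite big_nil.
  exact: cvg_cst.
have -> : (fun w : R => \sum_(u <- t :: S) complex.Re (u.2 * expi w ^+ u.1)) =
   (fun w => complex.Re (t.2 * expi w ^+ t.1) + \sum_(u <- S) complex.Re (u.2 * expi w ^+ u.1)).
  by apply/funext => ?; rewrite big_cons.
by apply: cvgD; [exact: one | exact: IH].
Qed.

(** Let [d0] be the minimum on the circle and [z = r e^(i w)]. For an exponent [1 <= k <= K], [r^k
    Re c' = r^k (|c'| + Re c') - r^k |c'| >= r^K (|c'| + Re c') - r |c'|], with [c'] the term at
    [e^(i w)]. Summing gives the lower bound [1 - r + r^K d0]. *)
Lemma term_coercive S : \sum_(t <- S) nc t.2 = 1 -> (forall t, t \in S -> (0 < t.1)%N) ->
  (forall w : R, 0 <= w <= 2 * pi -> 0 < 1 + \sum_(t <- S) complex.Re (t.2 * expi w ^+ t.1)) ->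
  exists2 delta : R, 0 < delta &
    forall z, in_disc z -> delta <= 1 + \sum_(t <- S) complex.Re (t.2 * z ^+ t.1).
Proof.
move=> S1 Spos circ.
have pi0 : 0 <= 2 * pi :> R by rewrite mulr_ge0 // pi_ge0.
have [w0 w0I wmin] := EVT_min pi0 (continuous_subspaceT (term_continuous S)).
rewrite in_itv /= in w0I.
have [d0 d00 d0P] : exists2 d0 : R, 0 < d0 & forall w, 0 <= w <= 2 * pi ->
    d0 <= 1 + \sum_(t <- S) complex.Re (t.2 * expi w ^+ t.1).
  exists (1 + \sum_(t <- S) complex.Re (t.2 * expi w0 ^+ t.1)); first exact: circ.
  by move=> w wI; rewrite lerD2l; apply: wmin; rewrite in_itv.
have [K KS] : exists K, forall t, t \in S -> (t.1 <= K)%N.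
  by exists (\max_(t <- S) t.1) => t tS; exact: leq_bigmax_seq.
pose h : R := 2^-1; have h0 : 0 < h by rewrite invr_gt0.
(* For [r <= 1 / 2] the part [1 - r] is at least [h]; for [r > 1 / 2] the part [r ^+ K * d0] is at
   least [h ^+ K * d0]. *)
exists (Num.min h (h ^+ K * d0)).
  by rewrite lt_min h0 mulr_gt0 // exprn_gt0.
move=> z zD; have [w wI zE] := polar z.
have r1 : nc z <= 1 by apply: ltW; move: zD; rewrite /in_disc normCE -[1]/(1%:C%C) ltcR.
have r0 := normc_ge0 _ z.
move: (nc z) zE r0 r1 => r -> r0 r1 {zD}.
have d0w := d0P w wI.
have main : 1 - r + r ^+ K * d0 <= 1 + \sum_(t <- S) complex.Re (t.2 * (r%:C%C * expi w) ^+ t.1).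
  have rK : r ^+ K * d0 <= r ^+ K * (1 + \sum_(t <- S) complex.Re (t.2 * expi w ^+ t.1)).
    by apply: ler_wpM2l => //; exact: exprn_ge0.
  rewrite -addrA lerD2l.
  apply: (@le_trans _ _ (\sum_(t <- S) (r ^+ K * (nc t.2 + complex.Re (t.2 * expi w ^+ t.1)) - r * nc t.2))).
    rewrite big_split /= -mulr_sumr big_split /= S1 sumrN -mulr_sumr S1 mulr1.
    by rewrite addrC lerD2r.
  rewrite big_seq [leRHS]big_seq; apply: ler_sum => t tS.
  rewrite Re_term_scale.
  have e0 : 0 <= nc t.2 + complex.Re (t.2 * expi w ^+ t.1).
    have := Re_ge_Nnormc (t.2 * expi w ^+ t.1).
    by rewrite normcM normcX normc_expi expr1n mulr1 -subr_ge0 opprK addrC.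
  have k1 : r ^+ K * (nc t.2 + complex.Re (t.2 * expi w ^+ t.1)) <=
      r ^+ t.1 * (nc t.2 + complex.Re (t.2 * expi w ^+ t.1)).
    by apply: ler_wpM2r => //; apply: ler_wiXn2l => //; exact: KS.
  have k2 : r ^+ t.1 * nc t.2 <= r * nc t.2.
    apply: ler_wpM2r; first exact: normc_ge0.
    by rewrite -[leRHS]expr1; apply: ler_wiXn2l => //; exact: Spos.
  by move: k1 k2; clear; lra.
apply: (le_trans _ main); have [rh|rh] := leP r h.
  rewrite ge_min; apply/orP; left.
  have := mulr_ge0 (exprn_ge0 K r0) (ltW d00).
  by move: rh; rewrite /h; clear; lra.
rewrite ge_min; apply/orP; right.
have : h ^+ K * d0 <= r ^+ K * d0.
  apply: (ler_wpM2r (ltW d00)).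
  by apply: lerXn2r; rewrite ?nnegrE //; exact: ltW.
by move: r1; clear; lra.
Qed.

End trigonometric_terms.

(** * The symbol and its arguments *)

Section symbol.
Variable R : realType.
Local Notation C := R[i].
Local Notation nc := (@Normc.normc R).

(* [Re (q * conj z ^ n) = Re (conj q * z ^ n)], so that the real part of the
   symbol is the real part of an analytic polynomial with these terms. *)
Definition symbol_terms (M N : seq nat) (p q : nat -> C) : seq (nat * C) :=
  [seq (m, p m) | m <- M] ++ [seq (n, (q n)^*) | n <- N].

Lemma Re_symbolP p0 (M N : seq nat) (p q : nat -> C) (z : C) :
  complex.Re (symbolP p0 M N p q z) =
  p0 + \sum_(t <- symbol_terms M N p q) complex.Re (t.2 * z ^+ t.1).
Proof.
rewrite /symbolP !Re_add !Re_sum big_cat /= !big_map addrA; congr (_ + _).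
apply: eq_bigr => n _.
have -> : (q n)^* * z ^+ n = (q n * z^* ^+ n)^* by rewrite rmorphM rmorphXn /= conjCK.
by case: (q n * _).
Qed.

Lemma sum_symbol_terms (M N : seq nat) (p q : nat -> C) :
  \sum_(t <- symbol_terms M N p q) nc t.2 = \sum_(m <- M) nc (p m) + \sum_(n <- N) nc (q n).
Proof.
rewrite big_cat /= !big_map; congr (_ + _).
by apply: eq_bigr => n _; rewrite normc_conj.
Qed.

Lemma cmeasurable_symbolP p0 (M N : seq nat) (p q : nat -> C) :
  cmeasurable R (symbolP p0 M N p q).
Proof.
apply: cmeasurableD; first apply: cmeasurableD; first exact: cmeasurable_cst.
- apply: cmeasurable_sum => m; apply: cmeasurableM; first exact: cmeasurable_cst.
  exact/cmeasurableX/cmeasurable_id.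
- apply: cmeasurable_sum => n; apply: cmeasurableM; first exact: cmeasurable_cst.
  by apply: cmeasurableX; exact: (cmeasurable_conj R id (cmeasurable_id R)).
Qed.

(** With [w] a zero of the symbol on the circle, this Lipschitz bound is the rate of vanishing that
    [vanishing_not_invertible] asks for. *)
Lemma normc_symbolP_sub_le p0 (M N : seq nat) (p q : nat -> C) (z w : C) :
  nc z <= 1 -> nc w <= 1 ->
  nc (symbolP p0 M N p q z - symbolP p0 M N p q w) <=
  (\sum_(m <- M) nc (p m) * m%:R + \sum_(n <- N) nc (q n) * n%:R) * nc (z - w).
Proof.
move=> z1 w1.
have -> : symbolP p0 M N p q z - symbolP p0 M N p q w =
    \sum_(m <- M) p m * (z ^+ m - w ^+ m) + \sum_(n <- N) q n * (z^* ^+ n - w^* ^+ n).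
  rewrite /symbolP; have split_sum (s : seq nat) (c a b : nat -> C) :
      \sum_(i <- s) c i * (a i - b i) = \sum_(i <- s) c i * a i - \sum_(i <- s) c i * b i.
    by rewrite -sumrB; apply: eq_bigr => i _; rewrite mulrBr.
  have alg (a b b' c c' : C) : a + b + c - (a + b' + c') = (b - b') + (c - c') by ring.
  by rewrite !split_sum; exact: alg.
apply: (le_trans (normcD _ _ _)); rewrite mulrDl !mulr_suml; apply: lerD.
  apply: (le_trans (normc_sum_le _ _ _ _)); apply: ler_sum => m _.
  by rewrite normcM -mulrA; apply: ler_wpM2l; [exact: normc_ge0 | exact: normcX_sub_le].
apply: (le_trans (normc_sum_le _ _ _ _)); apply: ler_sum => n _.
rewrite normcM -mulrA; apply: ler_wpM2l; first exact: normc_ge0.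
apply: (le_trans (normcX_sub_le _ _ _ _ _ _)); rewrite ?normc_conj //.
by rewrite -rmorphB normc_conj.
Qed.

Lemma normsq_symbolP_le (p0 : R) (M N : seq nat) (p q : nat -> C) : 0 <= p0 ->
  \sum_(m <- M) nc (p m) + \sum_(n <- N) nc (q n) = 1 ->
  forall z, in_disc z -> normsq (symbolP p0 M N p q z) <= (p0 + 1) ^+ 2.
Proof.
move=> p00 S1 z; rewrite /in_disc normCE -[1]/(1%:C%C) ltcR => /ltW z1.
have pw (c w : C) n : nc w <= 1 -> nc (c * w ^+ n) <= nc c.
  by move=> w1; rewrite normcM normcX ler_piMr ?normc_ge0 // exprn_ile1 // normc_ge0.
rewrite -normc_sqr ler_pXn2r ?nnegrE ?normc_ge0 ?addr_ge0 //.
rewrite -[in leRHS]S1 addrA /symbolP; apply: (le_trans (normcD _ _ _)); apply: lerD.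
  apply: (le_trans (normcD _ _ _)); apply: lerD.
    by rewrite /= expr0n addr0 sqrtr_sqr ger0_norm.
  by apply: (le_trans (normc_sum_le _ _ _ _)); apply: ler_sum => m _; exact: pw.
apply: (le_trans (normc_sum_le _ _ _ _)); apply: ler_sum => n _; apply: pw.
by rewrite normc_conj.
Qed.

(** Translates an equation between arguments into the alignment of a term of the symbol with the
    negative real axis. *)
Lemma arg_opposite (c : C) (a b : R) (k : int) : is_arg c a ->
  b + a = pi + 2 * pi * k%:~R -> c * expi R b = - `|c|.
Proof.
rewrite /is_arg -/(expi R a) => cE e.
have -> : c * expi R b = `|c| * (expi R a * expi R b) by rewrite mulrA -cE.
by rewrite -expiD addrC e expiD expi_2piz expi_pi mulr1 mulrN1.
Qed.

Lemma opposite_is_arg (c : C) (a : R) : c * expi R a = - (nc c)%:C%C -> is_arg c (pi - a).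
Proof.
move=> e; rewrite /is_arg -/(expi R (pi - a)) normCE.
rewrite expiD expi_pi mulN1r mulrN -mulNr -e -mulrA -expiD subrr expi0 mulr1 //.
Qed.

End symbol.

Theorem theorem3p3 (R : realType) (p0 : R) (M N : seq nat) (p q : nat -> R[i])
  (hp0 : 1 <= p0)
  (hMu : uniq M) (hNu : uniq N)
  (hMpos : forall m, m \in M -> (0 < m)%N)
  (hNpos : forall n, n \in N -> (0 < n)%N)
  (hp : forall m, m \in M -> p m != 0)
  (hq : forall n, n \in N -> q n != 0)
  (hsum : \sum_(m <- M) `|p m| + \sum_(n <- N) `|q n| = 1) :
  (1 < p0 -> toeplitz_invertible (symbolP p0 M N p q)) /\
  (p0 = 1 ->
    (~ toeplitz_invertible (symbolP p0 M N p q) <->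
     exists lam : R, 0 <= lam <= 2 * pi /\
       (forall m, m \in M -> exists a : R, is_arg (p m) a /\
          exists k : int, m%:R * lam + a = pi + 2 * pi * k%:~R) /\
       (forall n, n \in N -> exists b : R, is_arg (q n) b /\
          exists l : int, - (n%:R * lam) + b = pi + 2 * pi * l%:~R))).
Proof.
pose S := symbol_terms R M N p q.
have S1' : \sum_(m <- M) Normc.normc (p m) + \sum_(n <- N) Normc.normc (q n) = 1.
  have := congr1 (@complex.Re R) hsum; rewrite Re_add !Re_sum /= => <-.
  by congr (_ + _); apply: eq_bigr => i _; rewrite normCE.
have S1 : \sum_(t <- S) Normc.normc t.2 = 1 by rewrite sum_symbol_terms.
have Spos t : t \in S -> (0 < t.1)%N.
  by rewrite mem_cat => /orP[] /mapP[i iM ->]; [exact: hMpos | exact: hNpos].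
have p00 : 0 <= p0 by apply: le_trans hp0.
have mP := cmeasurable_symbolP R p0 M N p q.
have bP := normsq_symbolP_le R p0 M N p q p00 S1'.
split.
  move=> p01; apply: (coercive_invertible R _ (p0 - 1) _ mP _ bP); first by rewrite subr_gt0.
  move=> z; rewrite /in_disc normCE -[1]/(1%:C%C) ltcR => /ltW z1.
  by rewrite Re_symbolP lerD2l -S1; exact: term_ge.
move=> p01; split.
  (* If no [lam] exists, [1 + Re] of the sum is positive on the whole circle: were it at most 0 at
     [w], [term_equality] would make [w] such a [lam]. *)
  move=> ninv; apply: contrapT => nlam; apply: ninv.
  have [delta d0 hd] : exists2 delta : R, 0 < delta &
      forall z, in_disc z -> delta <= 1 + \sum_(t <- S) complex.Re (t.2 * z ^+ t.1).
    apply: term_coercive => // w wI; rewrite ltNge; apply/negP => le.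
    have eqS := term_equality R S w S1 le; apply: nlam; exists w; split=> //; split.
      (* With the argument [pi - m w] the required equation holds with integer 0. *)
      move=> m mM; exists (pi - m%:R * w); split; last by exists 0; rewrite mulr0 addr0 addrC subrK.
      have mS : (m, p m) \in S by rewrite mem_cat map_f.
      by apply: opposite_is_arg; rewrite -expiX; exact: eqS mS.
    move=> n nN; exists (pi - - (n%:R * w)); split; last by exists 0; rewrite mulr0 addr0 addrC subrK.
    have nS : (n, (q n)^*) \in S by rewrite mem_cat (map_f (fun n => (n, (q n)^*))) ?orbT.
    (* The list stores the conjugate of [q n]; conjugating the alignment restores [q n] and reverses
       the sign of [n w]. *)
    apply: opposite_is_arg; have /= := eqS _ nS; rewrite expiX => /(congr1 Num.conj).
    rewrite rmorphM /= conjCK -expiN rmorphN /= normc_conj => ->; congr (- _).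
    by apply/eqP; rewrite eq_complex /= oppr0 !eqxx.
  apply: (coercive_invertible R _ delta _ mP d0 bP) => z zD.
  by rewrite Re_symbolP p01; exact: hd.
move=> [lam [_ [hM hN]]]; pose zeta := expi R lam.
have zeta1 : normsq zeta = 1 by exact: normsq_expi.
have P0 : symbolP p0 M N p q zeta = 0.
  rewrite /symbolP p01.
  have -> : \sum_(m <- M) p m * zeta ^+ m = - \sum_(m <- M) `|p m|.
    rewrite -sumrN big_seq [RHS]big_seq; apply: eq_bigr => m /hM [a [arga [k e]]].
    by rewrite expiX (arg_opposite _ _ _ _ _ arga e).
  have -> : \sum_(n <- N) q n * zeta^* ^+ n = - \sum_(n <- N) `|q n|.
    rewrite -sumrN big_seq [RHS]big_seq; apply: eq_bigr => n /hN [b [argb [k e]]].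
    by rewrite -expiN expiX mulrN (arg_opposite _ _ _ _ _ argb e).
  by rewrite -addrA -opprD hsum; exact: subrr.
pose L := \sum_(m <- M) Normc.normc (p m) * m%:R + \sum_(n <- N) Normc.normc (q n) * n%:R.
have L0 : 0 <= L.
  by apply: addr_ge0; apply: sumr_ge0 => i _; rewrite mulr_ge0 ?normc_ge0.
(* [L] is a Lipschitz constant of the symbol; adding 1 makes the constant visibly positive. *)
apply: (vanishing_not_invertible R _ zeta (L ^+ 2 + 1) mP zeta1).
  by rewrite ltr_wpDl // sqr_ge0.
move=> z; rewrite /in_disc normCE -[1]/(1%:C%C) ltcR => /ltW z1.
have := normc_symbolP_sub_le R p0 M N p q z zeta z1.
rewrite normc_expi P0 subr0 -/L => /(_ (lexx _)) h.
rewrite -!normc_sqr; apply: (@le_trans _ _ ((L * Normc.normc (z - zeta)) ^+ 2)).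
  by rewrite ler_pXn2r ?nnegrE ?mulr_ge0 ?normc_ge0.
by rewrite exprMn; apply: ler_wpM2r; rewrite ?sqr_ge0 // lerDl.
Qed.
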